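(* Let $0\le l<k\le n$ be integers, let $\Omega\subset\mathbb{R}^n$ be a $C^3$ bounded domain with outer unit normal $\nu$ on $\partial\Omega$, let $f\in C^1(\overline{\Omega})$ be a positive function and $\varphi\in C^3(\partial\Omega)$. Let $u\in C^3(\Omega)\cap C^2(\overline{\Omega})$ be a $k$-admissible solution of $$\frac{\sigma_k(D^2u)}{\sigma_l(D^2u)} = f(x) \ \text{ in } \Omega, \qquad u_\nu = -u + \varphi(x) \ \text{ on } \partial\Omega.$$ Then $$\sup_{\Omega_\mu}|Du|\le\max\{M_1,\widetilde{M_1}\},$$ where $M_1$ is a constant depending only on $n$, $k$, $l$, $\mu$, $M_0$ and $|Df|_{C^0}$, and $\widetilde{M_1}$ is a constant depending only on $n$, $k$, $l$, $\mu$, $\Omega$, $M_0$, $\sup f$, $|Df|_{C^0}$ and $|\varphi|_{C^3}$.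
   Context: For $\lambda\in\mathbb{R}^n$, $\sigma_j(\lambda)=\sum_{1\le i_1<\cdots<i_j\le n}\lambda_{i_1}\cdots\lambda_{i_j}$ and $\sigma_0=1$. For a symmetric matrix $A$, $\sigma_j(A)=\sigma_j(\lambda(A))$, where $\lambda(A)$ is the vector of eigenvalues of $A$. $\Gamma_k=\{\lambda\in\mathbb{R}^n:\sigma_i(\lambda)>0 \text{ for all } 1\le i\le k\}$. A solution $u$ is $k$-admissible if $\lambda(D^2u(x))\in\Gamma_k$ for every $x\in\Omega$. Let $d(x)=\mathrm{dist}(x,\partial\Omega)$ and $\Omega_\mu=\{x\in\Omega: d(x)<\mu\}$, where $0<\mu<\frac1{10}$ is a small constant depending only on $\Omega$, chosen so that $d\in C^3(\overline{\Omega_\mu})$. $M_0$ denotes a constant with $\sup_\Omega|u|\le M_0$ that depends only on $n$, $k$, $l$, $\mathrm{diam}(\Omega)$, $\max_{\partial\Omega}|\varphi|$ and $\sup_\Omega f$ (such a bound holds for every such solution $u$). *)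

(* Defs.v *)
From HB Require Import structures.
From mathcomp Require Export all_boot all_order all_algebra.
From mathcomp Require Export all_classical all_reals all_analysis.

Set Implicit Arguments.
Unset Strict Implicit.
Unset Printing Implicit Defensive.

Import Order.TTheory GRing.Theory Num.Theory.
Import numFieldNormedType.Exports.

Local Open Scope classical_set_scope.
Local Open Scope ring_scope.

(* The canonical norm of 'rV[R]_n is the maximum norm: it induces the usual
   topology, derivatives and bounded sets, but lengths and distances have to be
   measured with the Euclidean norm below. *)
Definition enorm (R : realType) (n : nat) (x : 'rV[R]_n) : R :=
  Num.sqrt (\sum_i x 0 i ^+ 2).

(* [pderivs [:: i1; ...; im] f] is the iterated partial derivative
   D_i1 (... (D_im f)). *)
Definition pderivs (R : realType) (n : nat) (s : seq 'I_n)
    (f : 'rV[R]_n -> R) : 'rV[R]_n -> R :=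
  foldr (fun i g => 'D_(delta_mx 0 i) g) f s.

Definition grad (R : realType) (n : nat) (f : 'rV[R]_n -> R) (x : 'rV[R]_n) :
    'rV[R]_n :=
  \row_i pderivs [:: i] f x.

Definition hess (R : realType) (n : nat) (f : 'rV[R]_n -> R) (x : 'rV[R]_n) :
    'M[R]_n :=
  \matrix_(i, j) pderivs [:: i; j] f x.

(* C^k(U) for U open *)
Definition Ck_in (R : realType) (n k : nat) (U : set 'rV[R]_n)
    (f : 'rV[R]_n -> R) : Prop :=
  forall (s : seq 'I_n) (x : 'rV[R]_n), U x ->
    ((size s <= k)%N -> {for x, continuous (pderivs s f)}) /\
    ((size s < k)%N -> forall i, derivable (pderivs s f) x (delta_mx 0 i)).

(* C^k(closure U) for U open: f is C^k in U, continuous on the closure, and its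
   derivatives of order at most k extend continuously to the closure. *)
Definition Ck_upto (R : realType) (n k : nat) (U : set 'rV[R]_n)
    (f : 'rV[R]_n -> R) : Prop :=
  [/\ Ck_in k U f,
      {within closure U, continuous f} &
      forall s : seq 'I_n, (size s <= k)%N ->
        exists g : 'rV[R]_n -> R,
          {within closure U, continuous g} /\
          forall x, U x -> g x = pderivs s f x].

(* |f|_{C^k} = \sum_{j <= k} max_{|s| = j} sup_U |D^s f| *)
Definition Ck_norm (R : realType) (n k : nat) (U : set 'rV[R]_n)
    (f : 'rV[R]_n -> R) : R :=
  \sum_(j < k.+1) sup [set r : R | exists (s : seq 'I_n) (x : 'rV[R]_n),
                         [/\ size s = j, U x & r = `|pderivs s f x| ] ].

Definition bdry (R : realType) (n : nat) (A : set 'rV[R]_n) : set 'rV[R]_n :=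
  closure A `\` A°.

(* Near x0, after relabelling (i) and reorienting (s) the coordinate axes, Om is
   the part of space lying above the graph of the C^k function g of the n - 1
   other coordinates; col' i x is x with its i-th coordinate deleted. *)
Definition graph_chart (R : realType) (n k : nat) (Om : set 'rV[R]_n)
    (x0 : 'rV[R]_n) (i : 'I_n) (s : bool) (g : 'rV[R]_n.-1 -> R) : Prop :=
  Ck_in k [set: 'rV[R]_n.-1] g /\
  \forall x \near x0, Om x <-> g (col' i x) < (-1) ^+ s * x 0 i.

(* The point over y of the graph described by (i, s, g) *)
Definition graph_pt (R : realType) (n : nat) (i : 'I_n) (s : bool)
    (g : 'rV[R]_n.-1 -> R) (y : 'rV[R]_n.-1) : 'rV[R]_n :=
  \row_j if unlift i j is Some j' then y 0 j' else (-1) ^+ s * g y.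

Definition Ck_domain (R : realType) (n k : nat) (Om : set 'rV[R]_n) : Prop :=
  [/\ open Om, connected Om, Om !=set0 &
      forall x0, bdry Om x0 -> exists i s g, graph_chart k Om x0 i s g].

(* v = D rho / |D rho| at x, where rho is the local defining function
   g (col' i y) - (+/-) y_i, which is negative exactly inside Om. *)
Definition outer_unit_normal (R : realType) (n : nat) (Om : set 'rV[R]_n)
    (x v : 'rV[R]_n) : Prop :=
  exists i s g, graph_chart 1 Om x i s g /\
    let rho := fun y : 'rV[R]_n => g (col' i y) - (-1) ^+ s * y 0 i in
    v = (enorm (grad rho x))^-1 *: grad rho x.

(* phi in C^k(bdry Om): phi is C^k in the coordinates of C^k charts of the
   boundary. *)
Definition Ck_bdry (R : realType) (n k : nat) (Om : set 'rV[R]_n)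
    (phi : 'rV[R]_n -> R) : Prop :=
  forall x0, bdry Om x0 -> exists i s g,
    graph_chart k Om x0 i s g /\
    exists V : set 'rV[R]_n.-1,
      [/\ open V, V (col' i x0) & Ck_in k V (phi \o graph_pt i s g)].

(* |phi|_{C^k(bdry Om)}: infimum of the norms of the C^k(closure Om) extensions
   of phi, as in Gilbarg-Trudinger. *)
Definition Ck_bdry_norm (R : realType) (n k : nat) (Om : set 'rV[R]_n)
    (phi : 'rV[R]_n -> R) : R :=
  inf [set Ck_norm k Om Phi | Phi in
        [set Phi : 'rV[R]_n -> R |
          Ck_upto k Om Phi /\ forall x, bdry Om x -> Phi x = phi x]].

(* u_v at a boundary point x; the gradient at x is the limit of the gradient
   taken from inside Om. *)
Definition normal_deriv (R : realType) (n : nat) (Om : set 'rV[R]_n)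
    (u : 'rV[R]_n -> R) (x v : 'rV[R]_n) : R :=
  \sum_i v 0 i * lim (pderivs [:: i] u y @[y --> within Om (nbhs x)]).

Definition dist_bdry (R : realType) (n : nat) (Om : set 'rV[R]_n)
    (x : 'rV[R]_n) : R :=
  inf [set enorm (x - y) | y in bdry Om].

Definition collar (R : realType) (n : nat) (Om : set 'rV[R]_n) (mu : R) :
    set 'rV[R]_n :=
  [set x | Om x /\ dist_bdry Om x < mu].

(* Vector of eigenvalues, counted with multiplicity; it exists for symmetric A
   and is unique up to order.  The value is 0 when A has no such vector. *)
Definition eigenvals (R : realType) (n : nat) (A : 'M[R]_n) : 'rV[R]_n :=
  xget 0 [set lam : 'rV[R]_n |
            char_poly A = \prod_i ('X - (lam 0 i)%:P)].

Definition sigma (R : realType) (n j : nat) (lam : 'rV[R]_n) : R :=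
  \sum_(I : {set 'I_n} | #|I| == j) \prod_(i in I) lam 0 i.

Definition sigma_mx (R : realType) (n j : nat) (A : 'M[R]_n) : R :=
  sigma j (eigenvals A).

Definition Gamma (R : realType) (n k : nat) : set 'rV[R]_n :=
  [set lam | forall i, (1 <= i <= k)%N -> 0 < sigma i lam].

Definition admissible (R : realType) (n k : nat) (Om : set 'rV[R]_n)
    (u : 'rV[R]_n -> R) : Prop :=
  forall x, Om x -> Gamma k (eigenvals (hess u x)).

(* Main.v *)
Require Import Defs.
From HB Require Import structures.
From mathcomp Require Import fingroup perm.
From mathcomp Require Import ring lra zify.

Set Implicit Arguments.
Unset Strict Implicit.
Unset Printing Implicit Defensive.

Import Order.TTheory GRing.Theory Num.Theory.

Local Open Scope ring_scope.

(** The proof is Bernstein's method, made global. Let [D] be a function of class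
    [C^3] up to the boundary that is 0 there, with gradient [- nu], and takes values
    in [[0, 1/10]]; it is a function of the distance to the boundary, flattened
    away from it ([cut_dist]). Let [Phi] be an extension of [phi] whose [C^3] norm
    exceeds that of [phi] by at most 1 ([bdry_norm_extension]). The function
    [w = (1 - D) u + Phi D] then has vanishing normal derivative on the boundary,
    and with [b = 1 / (2 (2 M0 + 1)^2)] one studies a maximum point, over the closure
    of the domain, of
      [H = |Dw|^2 exp eta],   [eta = b (u + M0 + 1)^2 + A D].

    At a boundary point ([no_boundary_max]) the function [Dw . DD] tends to 0 along
    the boundary, so its derivative in the tangential direction [Dw] vanishes
    ([tangential_derivative]). This bounds the normal derivative of [|Dw|^2] by
    [|D^2 D| |Dw|^2], and for large [A] the function [H] increases towards the
    interior, which excludes a maximum unless [Dw] vanishes identically.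

    At an interior point ([interior_estimate]) the equation is differentiated in an
    orthonormal eigenbasis [e_a] of the Hessian of [u]. With [mu_a] the derivative
    of [sigma_k / sigma_l] in the [a]-th eigenvalue, it reads
    [D_z f = \sum_a mu_a D_z D_a D_a u] ([linearized_equation]), and the
    second-order conditions at a maximum of [H], summed with the weights [mu_a],
    contain no third derivative of [u] any more. The first-order condition in the
    direction [z = Dw] gives [D_z D_z u <= - |z|^2] as soon as [|z|] is large
    ([curvature_bound]). Hence the eigenvalues, averaged with the squared components
    of [z / |z|], have mean at most -1, and an inequality for symmetric functions
    says that the same average of the [mu_a] is at least [n^-2] times their sum,
    itself at least [1 / n] ([lin_coef_mean_trace], [lin_coef_trace_ge]). The good
    term [b |z|^2 D_a w ^ 2 / 2] of the second-order condition therefore sums to a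
    multiple of [|z|^4 \sum_a mu_a], whereas all the others are
    [O (|z|^3) \sum_a mu_a]: so [|Dw|] is bounded at the maximum of [H], hence
    everywhere.

    The symmetric functions are treated through Newton's inequality, proved by
    induction on the number of variables ([newton_weak]), and Chebyshev's sum
    inequality ([mean_step]). The bound obtained for [Du] holds in the whole domain;
    it serves as the second constant of the theorem, and the first one is 0. *)

(** * Symmetric functions and the derivative of their quotients *)

Lemma unweight_bracket (R : realFieldType) (t X Y : R) : 0 < t -> 0 <= Y ->
  (t + 1) * X <= t * Y -> X <= Y.
Proof.
by move=> t0 Y0 H; have [X0|X0] := lerP X 0; last nra; first exact: (le_trans X0 Y0).
Qed.

Section Esym.
Variables (R : realFieldType) (I : finType) (lam : I -> R).
Implicit Types (A : {set I}) (i : I) (j : nat).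

Definition genpoly A : {poly R} := \prod_(i in A) (1 + lam i *: 'X).
Definition esymf A (j : nat) : R := (genpoly A)`_j.
(** The elementary symmetric function of order [j - 1], with value 0 at [j = 0],
    so that the deletion formula [esymD1] has no boundary case. *)
Definition esymp A (j : nat) : R := ('X * genpoly A)`_j.

Lemma esympS A j : esymp A j.+1 = esymf A j.
Proof. by rewrite /esymp coefXM. Qed.
Lemma esymp0 A : esymp A 0 = 0.
Proof. by rewrite /esymp coefXM. Qed.

Lemma genpolyD1 A i : i \in A ->
  genpoly A = (1 + lam i *: 'X) * genpoly (A :\ i).
Proof.
move=> iA; rewrite /genpoly (bigD1 i) //=; congr (_ * _).
by apply: eq_bigl => x; rewrite !inE andbC.
Qed.

Lemma esymD1 A i j : i \in A ->
  esymf A j = esymf (A :\ i) j + lam i * esymp (A :\ i) j.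
Proof.
by move=> iA; rewrite /esymf (genpolyD1 iA) mulrDl mul1r coefD -scalerAl coefZ.
Qed.

Lemma esym0 A : esymf A 0 = 1.
Proof.
rewrite /esymf -horner_coef0 /genpoly horner_prod big1 // => i _.
by rewrite !hornerE; ring.
Qed.

Lemma esym_gt_card A j : (#|A| < j)%N -> esymf A j = 0.
Proof.
have [m] := ubnP #|A|; elim: m A j => // m IH A j Am Aj.
have [->|[i iA]] := set_0Vmem A.
  by rewrite /esymf /genpoly big_set0 coefC; case: j Aj => //; rewrite cards0.
have cA := cardsD1 i A; rewrite iA add1n in cA.
rewrite (esymD1 j iA); case: j Aj => [|j] Aj; first by rewrite ltn0 in Aj.
by rewrite esympS !IH ?mulr0 ?addr0 //; lia.
Qed.

Lemma deriv_genpoly A : (genpoly A)^`() = \sum_(i in A) lam i *: genpoly (A :\ i).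
Proof.
have [m] := ubnP #|A|; elim: m A => // m IH A Am.
have [->|[i iA]] := set_0Vmem A.
  by rewrite /genpoly !big_set0 derivC.
have cA := cardsD1 i A; rewrite iA add1n in cA.
rewrite (genpolyD1 iA) derivM IH; last by lia.
rewrite derivD derivZ derivX derivC add0r (big_setD1 i iA) /=; congr (_ + _).
  by rewrite -scalerAl mul1r.
rewrite mulr_sumr; apply: eq_bigr => j /setD1P[ji jA].
rewrite -scalerAr; congr (_ *: _).
have iAj : i \in A :\ j by rewrite !inE eq_sym ji.
rewrite (genpolyD1 iAj); congr (_ * genpoly _).
by apply/setP => x; rewrite !inE; case: (x == i); case: (x == j).
Qed.

(** Euler's identity for a homogeneous polynomial, read off coefficient by
    coefficient from the derivative of the generating polynomial. *)
Lemma esym_euler A j :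
  \sum_(i in A) lam i * esymp (A :\ i) j = j%:R * esymf A j.
Proof.
case: j => [|j].
  by rewrite mul0r big1 // => i _; rewrite esymp0 mulr0.
have := congr1 (fun p : {poly R} => p`_j) (deriv_genpoly A).
rewrite /= coef_deriv coef_sum mulr_natl /esymf => ->.
by apply: eq_bigr => i _; rewrite coefZ esympS.
Qed.

Lemma esym_sumD1 A j :
  \sum_(i in A) esymf (A :\ i) j = (#|A|%:R - j%:R) * esymf A j.
Proof.
rewrite mulrBl -[j%:R * _]esym_euler mulr_natl -sumr_const -sumrB.
by apply: eq_bigr => i iA; rewrite (esymD1 j iA); ring.
Qed.

Lemma esymp_sumD1 A j :
  \sum_(i in A) esymp (A :\ i) j = (#|A|%:R - j.-1%:R) * esymp A j.
Proof.
case: j => [|j]; last by rewrite !esympS -esym_sumD1; apply: eq_bigr => i; rewrite esympS.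
by rewrite esymp0 mulr0 big1 // => i _; rewrite esymp0.
Qed.

(** Newton's bracket of [A] is the sum of the brackets of the sets with one
    variable deleted: this makes Newton's inequality an induction on the number
    of variables. *)
Lemma newton_sum A c :
  \sum_(i in A) (esymf (A :\ i) c ^+ 2 - esymp (A :\ i) c * esymf (A :\ i) c.+1)
  = (#|A|%:R - c%:R) * esymf A c ^+ 2
    - (#|A|%:R - c%:R + 1) * (esymp A c * esymf A c.+1).
Proof.
have E i : i \in A -> esymf (A :\ i) c ^+ 2 - esymp (A :\ i) c * esymf (A :\ i) c.+1
   = esymf A c * esymf (A :\ i) c - esymf A c.+1 * esymp (A :\ i) c.
  by move=> iA; rewrite (esymD1 c iA) (esymD1 c.+1 iA) esympS; ring.
rewrite (eq_bigr _ E) sumrB -!mulr_sumr esym_sumD1 esymp_sumD1.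
case: c {E} => [|c]; first by rewrite !esymp0; ring.
by rewrite esympS /= -(natr1 c); ring.
Qed.

(** Newton's inequality for arbitrary real variables, with weights that survive
    the induction given by [newton_sum]: deleting a variable lowers both weights
    by one, so the bracket of each smaller set is non-negative without weights. *)
Lemma newton_weak A c : (c <= #|A|)%N ->
  (#|A|%:R - c%:R + 1) * (esymp A c * esymf A c.+1)
    <= (#|A|%:R - c%:R) * esymf A c ^+ 2.
Proof.
have [m] := ubnP #|A|; elim: m A => // m IH A Am cA.
rewrite -subr_ge0 -newton_sum; apply: sumr_ge0 => i iA.
have cAi := cardsD1 i A; rewrite iA add1n in cAi.
rewrite subr_ge0.
have [->|nz] := eqVneq (esymf (A :\ i) c.+1) 0; first by rewrite mulr0 sqr_ge0.
have cm : (c < #|A :\ i|)%N.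
  by rewrite ltnNge; apply/negP => h; rewrite esym_gt_card ?eqxx // in nz.
have := IH (A :\ i) _ (ltnW cm); rewrite -ltnS -cAi => /(_ Am).
have : 0 < #|A :\ i|%:R - c%:R :> R by rewrite subr_gt0 ltr_nat.
move=> t0 H; exact: (unweight_bracket t0 (sqr_ge0 _) H).
Qed.

(** The cone [Gamma_k], stated with the trivial condition of order 0 included. *)
Definition gam A (k : nat) := forall j, (j <= k)%N -> 0 < esymf A j.

Lemma gam_esymp A k j : gam A k -> (j <= k.+1)%N -> 0 <= esymp A j.
Proof. by move=> g; case: j => [|j] jk; rewrite ?esymp0 // esympS ltW // g. Qed.

Lemma gamW A k j : (j <= k)%N -> gam A k -> gam A j.
Proof. by move=> jk g a aj; apply: g; lia. Qed.

Lemma newton_weak1 A c : esymp A c * esymf A c.+1 <= esymf A c ^+ 2.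
Proof.
have [->|nz] := eqVneq (esymf A c.+1) 0; first by rewrite mulr0 sqr_ge0.
have cm : (c < #|A|)%N.
  by rewrite ltnNge; apply/negP => h; rewrite esym_gt_card ?eqxx // in nz.
have := newton_weak (ltnW cm).
have : 0 < #|A|%:R - c%:R :> R by rewrite subr_gt0 ltr_nat.
move=> t0 H; exact: (unweight_bracket t0 (sqr_ge0 _) H).
Qed.

(** Deleting a variable costs one order. At a first failure
    [e_(j+1)(A \ i) <= 0] the deleted entry has to be positive, since
    [e_(j+1)(A) > 0]; Newton's inequality then contradicts [e_(j+2)(A) > 0]. *)
Lemma gamD1 A i k : i \in A -> gam A k.+1 -> gam (A :\ i) k.
Proof.
move=> iA g; elim => [|j IH] jk; first by rewrite esym0.
have {IH}a0 := IH (ltnW jk).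
rewrite ltNge; apply/negP => b0.
have g1 := g j.+1 (leqW jk); have g2 := g j.+2 jk.
rewrite (esymD1 _ iA) esympS in g1; rewrite (esymD1 _ iA) esympS in g2.
have N := newton_weak1 (A :\ i) j.+1; rewrite esympS in N.
move: a0 b0 g1 g2 N; set a := esymf _ j; set b := esymf _ j.+1; set d := esymf _ j.+2.
set l := lam i => a0 b0 g1 g2 N.
have l0 : 0 < l by rewrite -(pmulr_lgt0 _ a0); lra.
have : a * (d + l * b) <= b ^+ 2 + (a * l) * b by rewrite mulrDr mulrA lerD2r.
have : 0 < a * (d + l * b) by rewrite mulr_gt0.
have : (b + l * a) * b <= 0 by apply: mulr_ge0_le0 => //; exact: ltW.
by nra.
Qed.

(** Newton's inequality between the orders [l - 1, k] and [k - 1, l], obtained by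
    multiplying the inequalities between adjacent orders. *)
Lemma newton_chain A k l : (l < k)%N -> (k <= #|A|.+1)%N -> gam A k.-1 ->
  (#|A|%:R - l%:R + 1) * (esymp A l * esymf A k)
  <= (#|A|%:R - k%:R + 1) * (esymf A k.-1 * esymf A l).
Proof.
elim: k => // k IH lk kA g /=.
have k1 : (#|A|%:R - k.+1%:R + 1 : R) = #|A|%:R - k%:R by rewrite -natr1; ring.
rewrite k1; case: (ltngtP l k) => [{}lk|kl|<-]; [|lia|].
  have gk : 0 < esymf A k by apply: g.
  have gl : 0 < esymf A l by apply: g; rewrite /=; lia.
  have pl : 0 <= esymp A l by apply: (gam_esymp g); rewrite /=; lia.
  have kc : 0 <= #|A|%:R - k%:R :> R by rewrite subr_ge0 ler_nat; lia.
  have lc : 0 <= #|A|%:R - l%:R :> R by rewrite subr_ge0 ler_nat; lia.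
  have [s0|s0] := lerP (esymf A k.+1) 0.
    apply: (@le_trans _ _ 0); last by rewrite !mulr_ge0 // ltW.
    by apply: mulr_ge0_le0; [rewrite addr_ge0 | exact: mulr_ge0_le0].
  have kA' : (k <= #|A|)%N by [].
  have N := newton_weak kA'.
  have {}IH := IH lk (leqW kA') (gamW (leq_pred k) g).
  have kk : esymp A k = esymf A k.-1 by case: (k) lk => // k' _; rewrite esympS.
  rewrite kk in N.
  rewrite -(ler_pM2l gk).
  have H1 := ler_wpM2r (ltW s0) IH.
  have H2 := ler_wpM2r (ltW gl) N.
  by nra.
rewrite -expr2; apply: newton_weak; lia.
Qed.

End Esym.

(** Chebyshev's inequality: the right side minus the left one is half of the
    double sum of [w_i w_j (a_i - a_j) (b_i - b_j)]. *)
Lemma chebyshev_sum (R : realFieldType) (I : finType) (w a b : I -> R) :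
  (forall i, 0 <= w i) -> (forall i j, 0 <= (a i - a j) * (b i - b j)) ->
  (\sum_i w i * a i) * (\sum_i w i * b i) <=
  (\sum_i w i) * (\sum_i w i * (a i * b i)).
Proof.
move=> w0 ab.
have : 0 <= \sum_i \sum_j w i * w j * ((a i - a j) * (b i - b j)).
  by do 2!(apply: sumr_ge0 => ? _); apply: mulr_ge0 => //; exact: mulr_ge0.
have -> : \sum_i \sum_j w i * w j * ((a i - a j) * (b i - b j)) =
  \sum_i \sum_j (w i * (a i * b i)) * w j + \sum_i \sum_j w i * (w j * (a j * b j))
  - \sum_i \sum_j (w i * a i) * (w j * b j) - \sum_i \sum_j (w i * b i) * (w j * a j).
  rewrite -big_split -sumrB -sumrB; apply: eq_bigr => i _.
  rewrite -big_split -sumrB -sumrB; apply: eq_bigr => j _ /=; ring.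
rewrite -!big_distrlr /=; nra.
Qed.

Section Quotient.
Variables (R : realFieldType) (n : nat) (lam : 'I_n -> R) (k l : nat).
Hypotheses (lk : (l < k)%N) (kn : (k <= n)%N).
Local Notation T := [set: 'I_n].
Hypothesis g : gam lam T k.
Local Notation s j := (esymf lam T j).
Local Notation d i j := (esymf lam (T :\ i) j).
Local Notation dp i j := (esymp lam (T :\ i) j).

(** The derivative of [sigma_k / sigma_l] with respect to the [i]-th eigenvalue. *)
Definition lin_coef (i : 'I_n) : R :=
  (dp i k * s l - s k * dp i l) / s l ^+ 2.

Let k0 : (0 < k)%N. Proof. lia. Qed.
Let gi i : gam lam (T :\ i) k.-1.
Proof. by apply: gamD1; rewrite ?inE // prednK. Qed.
Let gij i j : i != j -> forall m, (m < k)%N -> 0 <= esymp lam (T :\ i :\ j) m.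
Proof.
move=> ij; case=> [|m] mk; first by rewrite esymp0.
rewrite esympS ltW //; have m1 : gam lam (T :\ i) m.+1.
  by apply: gamW (gi i) => //; lia.
by apply: (gamD1 _ m1); rewrite // !inE eq_sym ij.
Qed.
Let card_i (i : 'I_n) : #|T :\ i| = n.-1.
Proof. by have := cardsD1 i T; rewrite cardsT card_ord inE add1n => /(congr1 predn) /= <-. Qed.
Let dpk i : dp i k = d i k.-1. Proof. by rewrite -esympS prednK. Qed.
Let sl0 : 0 < s l. Proof. by apply: g; lia. Qed.

(** The terms containing [lam_i] cancel, and what is left is a bracket of the
    functions of the other variables, bounded below by [newton_chain]. *)
Lemma lin_coef_bracket i :
  (n%:R)^-1 * (d i k.-1 * d i l) <= dp i k * s l - s k * dp i l.
Proof.
rewrite (@esymD1 _ _ lam T i l) ?inE // (@esymD1 _ _ lam T i k) ?inE // dpk.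
have -> : d i k.-1 * (d i l + lam i * dp i l) - (d i k + lam i * d i k.-1) * dp i l
  = d i k.-1 * d i l - dp i l * d i k by ring.
have := @newton_chain _ _ lam (T :\ i) k l lk _ (gi i); rewrite card_i.
have n0 : (0 < n)%N by lia.
have -> : (k <= n.-1.+1)%N by lia.
move=> /(_ isT).
have -> : n.-1%:R = n%:R - 1 :> R by rewrite -[in RHS](prednK n0) -natr1; ring.
have : 0 < d i k.-1 * d i l by rewrite mulr_gt0 // gi //; lia.
have : 1 <= k%:R - l%:R :> R by rewrite lerBrDr nat1r ler_nat.
have : k%:R <= n%:R :> R by rewrite ler_nat.
have : 0 <= l%:R :> R by rewrite ler0n.
have : 1 <= n%:R :> R by rewrite ler1n.
set N := n%:R; set K := k%:R; set L := l%:R; set X := _ * d i l; set Y := _ * d i k.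
move=> N1 L0 KN LK X0 H; clearbody N K L X Y.
have NL : 0 < N - L by lra.
rewrite -(ler_pM2l NL).
have -> : (N - L) * (N^-1 * X) = X - L * X / N.
  by field; rewrite gt_eqF //; lra.
have : 0 <= L * X / N by rewrite divr_ge0 ?mulr_ge0 //; lra.
nra.
Qed.

Lemma lin_coef_ge0 i : 0 <= lin_coef i.
Proof.
rewrite /lin_coef divr_ge0 ?sqr_ge0 //; apply: le_trans (lin_coef_bracket i).
by rewrite !mulr_ge0 ?invr_ge0 // ltW // gi //; lia.
Qed.

(** Euler's identity for a quotient that is homogeneous of degree [k - l]. *)
Lemma lin_coef_homog : \sum_i lin_coef i * lam i = (k%:R - l%:R) * (s k / s l).
Proof.
rewrite /lin_coef.
transitivity ((s l * (\sum_i lam i * dp i k) - s k * (\sum_i lam i * dp i l)) / s l ^+ 2).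
  by rewrite !mulr_sumr -sumrB mulr_suml; apply: eq_bigr => i _; ring.
have EU j : \sum_i lam i * dp i j = j%:R * s j.
  by rewrite -esym_euler; apply: eq_bigl => i; rewrite inE.
by rewrite !EU; field; rewrite gt_eqF.
Qed.

Lemma lin_coef_sum_le : \sum_i lin_coef i <= n%:R * (s k.-1 / s l).
Proof.
have -> : \sum_i lin_coef i = ((\sum_i dp i k) * s l - s k * (\sum_i dp i l)) / s l ^+ 2.
  by rewrite /lin_coef mulr_sumr mulr_suml -sumrB mulr_suml; apply: eq_bigr => i _; ring.
have SU j : \sum_i dp i j = (n%:R - j.-1%:R) * esymp lam T j.
  by rewrite -[n in n%:R]card_ord -cardsT -esymp_sumD1; apply: eq_bigl => i; rewrite inE.
have B : \sum_i dp i k <= n%:R * s k.-1.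
  rewrite SU -[k in esymp _ _ k](prednK k0) esympS ler_wpM2r //.
    by rewrite ltW // g //; lia.
  by rewrite gerBl ler0n.
have C : 0 <= s k * \sum_i dp i l.
  rewrite mulr_ge0 ?(ltW (g _)) // sumr_ge0 // => i _.
  by apply: gam_esymp (gi i) _; lia.
have -> : n%:R * (s k.-1 / s l) = n%:R * s k.-1 * s l / s l ^+ 2.
  by field; rewrite gt_eqF.
rewrite ler_pM2r ?invr_gt0 ?exprn_gt0 //.
by apply: le_trans (ler_wpM2r (ltW sl0) B); rewrite gerBl.
Qed.

(* The weights stand for the squared components of a unit vector in an
   eigenbasis: [wl] says that the curvature in its direction is at most -1. *)
Variable w : 'I_n -> R.
Hypotheses (w0 : forall i, 0 <= w i) (w1 : \sum_i w i = 1)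
  (wl : \sum_i w i * lam i <= -1).
Local Notation m j := (\sum_i w i * d i j).
Local Notation mp j := (\sum_i w i * dp i j).

Let d_anti j i i' : (j < k)%N -> exists2 c, 0 <= c & d i j - d i' j = c * (lam i' - lam i).
Proof.
move=> jk; have [<-|ii] := eqVneq i i'; first by exists 0; rewrite // mul0r subrr.
exists (esymp lam (T :\ i :\ i') j); first exact: gij.
rewrite (@esymD1 _ _ lam (T :\ i) i' j); last by rewrite !inE eq_sym ii.
rewrite (@esymD1 _ _ lam (T :\ i') i j); last by rewrite !inE ii.
have -> : T :\ i' :\ i = T :\ i :\ i'.
  by apply/setP => x; rewrite !inE; case: (x == i); case: (x == i').
ring.
Qed.

(** Here [e_j(T) - e_j(T \ i) = lam_i e_(j-1)(T \ i)], and [lam_i] and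
    [e_(j-1)(T \ i)] are oppositely ordered in [i]: Chebyshev's inequality bounds
    the mean of the product by the mean of the first factor, at most -1, times
    the mean of the second. *)
Lemma mean_step j : (j <= k)%N -> s j + mp j <= m j.
Proof.
move=> jk.
have -> : m j = s j - \sum_i w i * (lam i * dp i j).
  rewrite -[s j]mul1r -w1 mulr_suml -sumrB; apply: eq_bigr => i _.
  by rewrite (@esymD1 _ _ lam T i j) ?inE //; ring.
case: j jk => [|j] jk.
  rewrite !big1 ?subr0 ?addr0 //; by move=> i _; rewrite esymp0 !mulr0.
have C := @chebyshev_sum _ _ w (fun i => - lam i) (fun i => dp i j.+1) w0 _.
have {}C := C (fun i i' => _).
have mp0 : 0 <= mp j.+1.
  apply: sumr_ge0 => i _; rewrite mulr_ge0 // (gam_esymp (gi i)) //; lia.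
have {C} : (\sum_i w i * - lam i) * mp j.+1 <= \sum_i w i * (- lam i * dp i j.+1).
  rewrite -[X in _ <= X]mul1r -w1; apply: C => i i'.
  rewrite !esympS; have [c c0 ->] := d_anti i i' jk.
  have -> : (- lam i - - lam i') * (c * (lam i' - lam i)) = c * (lam i' - lam i) ^+ 2 by ring.
  by rewrite mulr_ge0 ?sqr_ge0.
have -> : \sum_i w i * - lam i = - \sum_i w i * lam i.
  by rewrite -sumrN; apply: eq_bigr => i _; ring.
have -> : \sum_i w i * (- lam i * dp i j.+1) = - \sum_i w i * (lam i * dp i j.+1).
  by rewrite -sumrN; apply: eq_bigr => i _; ring.
move=> C; rewrite lerD2l; apply: le_trans C; rewrite ler_peMl // lerNr; exact: wl.
Qed.

Let m_gt0 j : (j < k)%N -> 0 < m j.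
Proof.
move=> jk; apply: lt_le_trans (mean_step (ltnW jk)).
rewrite ltr_wpDr ?g 1?ltnW //; apply: sumr_ge0 => i _.
by rewrite mulr_ge0 // (gam_esymp (gi i)) //; lia.
Qed.

Let m_mono i j : (i <= j)%N -> (j < k)%N -> m i <= m j.
Proof.
elim: j => [|j IH] ij jk; first by move: ij; rewrite leqn0 => /eqP ->.
move: ij; rewrite leq_eqVlt => /orP[/eqP->//|ij].
apply: (le_trans (IH _ _)); [lia|lia|].
apply: le_trans (mean_step (ltnW jk)).
have -> : mp j.+1 = m j by apply: eq_bigr => ? _; rewrite esympS.
by rewrite lerDr ltW // g //; lia.
Qed.

Let mean_prod : m k.-1 * m l <= \sum_i w i * (d i k.-1 * d i l).
Proof.
have k1 : (k.-1 < k)%N by rewrite prednK.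
rewrite -[X in _ <= X]mul1r -w1; apply: chebyshev_sum => // i i'.
have [c c0 ->] := d_anti i i' k1.
have [c' c'0 ->] := d_anti i i' lk.
have -> : c * (lam i' - lam i) * (c' * (lam i' - lam i)) = c * c' * (lam i' - lam i) ^+ 2 by ring.
by rewrite mulr_ge0 ?sqr_ge0 // mulr_ge0.
Qed.

Let s_le_m j : (j < k)%N -> s j <= m j.
Proof.
move=> jk; apply: le_trans (mean_step (ltnW jk)).
rewrite lerDl; apply: sumr_ge0 => i _.
by rewrite mulr_ge0 // (gam_esymp (gi i)) //; lia.
Qed.

Lemma lin_coef_mean_ge :
  (n%:R)^-1 * (m k.-1 / s l) <= \sum_i w i * lin_coef i.
Proof.
have n0 : (0 < n)%N by lia.
have -> : \sum_i w i * lin_coef i =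
    (\sum_i w i * (dp i k * s l - s k * dp i l)) / s l ^+ 2.
  by rewrite mulr_suml; apply: eq_bigr => i _; rewrite /lin_coef mulrA.
rewrite ler_pdivlMr ?exprn_gt0 //.
have -> : n%:R^-1 * (m k.-1 / s l) * s l ^+ 2 = n%:R^-1 * (m k.-1 * s l).
  by field; rewrite !gt_eqF // ltr0n.
apply: (@le_trans _ _ (n%:R^-1 * (m k.-1 * m l))).
  by rewrite ler_wpM2l ?invr_ge0 // ler_wpM2l ?s_le_m // ltW // m_gt0 //; lia.
apply: (@le_trans _ _ (n%:R^-1 * \sum_i w i * (d i k.-1 * d i l))).
  by rewrite ler_wpM2l ?invr_ge0.
rewrite mulr_sumr; apply: ler_sum => i _.
by rewrite mulrCA ler_wpM2l // lin_coef_bracket.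
Qed.

(** The ellipticity estimate behind the interior bound: in a direction of
    curvature at most -1 the linearised operator is comparable to its trace. *)
Lemma lin_coef_mean_trace :
  (n%:R)^-1 ^+ 2 * \sum_i lin_coef i <= \sum_i w i * lin_coef i.
Proof.
have n0 : (0 < n)%N by lia.
apply: le_trans lin_coef_mean_ge.
have nn : 0 < n%:R :> R by rewrite ltr0n.
apply: (@le_trans _ _ (n%:R^-1 ^+ 2 * (n%:R * (s k.-1 / s l)))).
  by rewrite ler_wpM2l ?exprn_ge0 ?invr_ge0 ?lin_coef_sum_le.
have -> : n%:R^-1 ^+ 2 * (n%:R * (s k.-1 / s l)) = n%:R^-1 * (s k.-1 / s l).
  by field; rewrite !gt_eqF.
rewrite ler_wpM2l ?invr_ge0 // ler_wpM2r ?invr_ge0 ?(ltW sl0) // s_le_m //; lia.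
Qed.

Lemma lin_coef_trace_ge : (n%:R)^-1 <= \sum_i lin_coef i.
Proof.
have n0 : (0 < n)%N by lia.
apply: (@le_trans _ _ (\sum_i w i * lin_coef i)); last first.
  apply: ler_sum => i _; rewrite ler_piMl ?lin_coef_ge0 // -w1 (bigD1 i) //=.
  by rewrite lerDl sumr_ge0.
apply: le_trans lin_coef_mean_ge; rewrite ler_peMr ?invr_ge0 //.
rewrite ler_pdivlMr // mul1r; apply: (le_trans (s_le_m lk)).
by apply: m_mono; lia.
Qed.

End Quotient.

(** * Orthogonal diagonalisation *)

Section Spectral.
Variable R : rcfType.

Lemma char_poly_conj n (P A Q : 'M[R]_n) : P *m Q = 1%:M ->
  char_poly (P *m A *m Q) = char_poly A.
Proof.
move=> PQ; have PQp : map_mx polyC P *m map_mx polyC Q = 1%:M.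
  by rewrite -map_mxM PQ map_mx1.
have -> : char_poly (P *m A *m Q)
    = \det (map_mx polyC P *m char_poly_mx A *m map_mx polyC Q).
  rewrite /char_poly /char_poly_mx; congr (\det _).
  rewrite mulmxBr mulmxBl !map_mxM; congr (_ - _).
  by rewrite scalar_mxC -mulmxA PQp mulmx1.
rewrite !det_mulmx mulrAC -det_mulmx PQp det1 mul1r.
by [].
Qed.

Lemma mulmx_tr_gt0 n (v : 'rV[R]_n) : v != 0 -> 0 < (v *m v^T) 0 0.
Proof.
move=> v0; rewrite lt_def; apply/andP; split; last first.
  by rewrite mxE sumr_ge0 // => i _; rewrite mxE -expr2 sqr_ge0.
apply: contraNneq v0 => /eqP; rewrite mxE psumr_eq0 => [/allP h|i _]; last first.
  by rewrite mxE -expr2 sqr_ge0.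
apply/eqP/rowP => i; rewrite mxE; apply/eqP.
by have := h i (mem_index_enum i); rewrite mxE -expr2 sqrf_eq0.
Qed.

Lemma mx11_scal (M : 'M[R]_1) : M = (M 0 0)%:M.
Proof. by apply/matrixP => i j; rewrite !ord1 mxE eqxx. Qed.

(** The witness is the reflection in the hyperplane orthogonal to [v - e]. *)
Lemma householder n (e v : 'rV[R]_n) : e *m e^T = 1%:M -> v *m v^T = 1%:M ->
  exists Q : 'M[R]_n, [/\ Q^T = Q, Q *m Q = 1%:M & e *m Q = v].
Proof.
move=> ee vv; have [<-|ev] := eqVneq e v.
  by exists 1%:M; rewrite trmx1 !mulmx1.
have y0 : v - e != 0 by rewrite subr_eq0 eq_sym.
set y := v - e in y0; have yy := mulmx_tr_gt0 y0; set c := (y *m y^T) 0 0 in yy.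
have cE : y *m y^T = c%:M by exact: mx11_scal.
have QQ : (1%:M - (2 / c) *: (y^T *m y)) *m (1%:M - (2 / c) *: (y^T *m y)) = 1%:M.
  have ZZ : ((2 / c) *: (y^T *m y)) *m ((2 / c) *: (y^T *m y)) = 2 *: ((2 / c) *: (y^T *m y)).
    rewrite -scalemxAl -scalemxAr [y^T *m y *m _]mulmxA -(mulmxA y^T y) cE.
    rewrite mul_mx_scalar -scalemxAl !scalerA; congr (_ *: _).
    by field; rewrite gt_eqF.
  rewrite mulmxBr mulmxBl mulmxBl ZZ !mul1mx mulmx1 scaler_nat mulr2n.
  by rewrite opprB addrK addrNK.
exists (1%:M - (2 / c) *: (y^T *m y)); split=> //.
  by rewrite linearB /= trmx1 linearZ /= trmx_mul trmxK.
have vyE : v = e + y by rewrite addrC subrK.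
have eyE : e *m y^T = (- c / 2)%:M.
  have := vv; rewrite vyE linearD /= mulmxDl !mulmxDr ee cE.
  rewrite [y *m e^T]mx11_scal [e *m y^T]mx11_scal.
  have -> : (y *m e^T) 0 0 = (e *m y^T) 0 0.
    by rewrite !mxE; apply: eq_bigr => i _; rewrite !mxE mulrC.
  set b := _ 0 0; rewrite -!raddfD /= => /matrixP/(_ 0 0); rewrite !mxE eqxx !mulr1n => H.
  by congr (_%:M); lra.
rewrite mulmxBr mulmx1 -scalemxAr mulmxA eyE mul_scalar_mx scalerA vyE.
rewrite -scaleNr; congr (_ + _); rewrite -[RHS]scale1r; congr (_ *: _).
by field; rewrite gt_eqF.
Qed.

(** A reflection carries the first basis vector to a unit eigenvector; by
    symmetry the conjugated matrix is block diagonal, and one recurses on the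
    smaller block. The eigenvalues are real because the characteristic polynomial
    is assumed to split. *)
Lemma sym_diagonalize n (A : 'M[R]_n) (s : seq R) :
  A^T = A -> char_poly A = \prod_(a <- s) ('X - a%:P) ->
  exists (P : 'M[R]_n) (d : 'rV[R]_n),
    [/\ P *m P^T = 1%:M, P^T *m P = 1%:M & P *m A *m P^T = diag_mx d].
Proof.
elim: n A s => [|n IH] A s symA cA.
  by exists 1%:M, 0; split; apply/matrixP => -[].
have sz : size s = n.+1.
  by have := size_char_poly A; rewrite cA size_prod_XsubC => -[].
case: s sz cA => // a s _ cA.
have : eigenvalue A a.
  by rewrite eigenvalue_root_char cA root_prod_XsubC inE eqxx.
case/eigenvalueP => v0 v0A v0n.
have nv := mulmx_tr_gt0 v0n; set c : R := (_ *m _) 0 0 in nv.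
pose v : 'rV[R]_n.+1 := (Num.sqrt (c : R))^-1 *: v0.
have vv : v *m v^T = 1%:M.
  rewrite [v *m v^T]mx11_scal; congr (_%:M).
  have -> : (v *m v^T) 0 0 = (Num.sqrt c)^-1 ^+ 2 * c.
    rewrite /v; move: (Num.sqrt c)^-1 => b; rewrite /c !mxE mulr_sumr; apply: eq_bigr => i _; rewrite !mxE; ring.
  by rewrite exprVn sqr_sqrtr ?ltW // mulVf ?gt_eqF.
have vA : v *m A = a *: v by rewrite /v -scalemxAl v0A !scalerA mulrC.
pose e : 'rV[R]_n.+1 := delta_mx 0 0.
have ee : e *m e^T = 1%:M.
  by rewrite /e trmx_delta mul_delta_mx; apply/matrixP => i j; rewrite !ord1 !mxE.
have [Q [sQ QQ eQ]] := householder ee vv.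
have [B defB] : {B : 'M[R]_(1 + n) | B = Q *m A *m Q} by exists (Q *m A *m Q).
have symB : B^T = B by rewrite defB !trmx_mul sQ symA mulmxA.
have eB : e *m B = a *: e.
  rewrite defB !mulmxA eQ vA -scalemxAl; congr (_ *: _).
  by rewrite -eQ -mulmxA QQ mulmx1.
have rowB (i j : 'I_(1 + n)) : i = 0 :> nat -> B i j = a * (j == 0 :> nat)%:R.
  move=> i0; have -> : i = 0 by apply/val_inj.
  have /matrixP/(_ 0 j) := eB.
  by rewrite /e -rowE !mxE eqxx andTb => ->.
have ul : ulsubmx B = a%:M.
  by apply/matrixP => i j; rewrite !ord1 !mxE rowB //= mulr1.
have ur : ursubmx B = 0.
  by apply/matrixP => i j; rewrite !ord1 !mxE rowB //= mulr0.
have dl : dlsubmx B = 0 by rewrite -symB -trmx_ursub ur trmx0.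
set B' := drsubmx B.
have BE : B = block_mx a%:M 0 0 B' by rewrite -[B]submxK ul ur dl.
have symB' : B'^T = B' by rewrite /B' trmx_drsub symB.
have cB' : char_poly B' = \prod_(a <- s) ('X - a%:P).
  have : char_poly B = char_poly A by rewrite defB char_poly_conj.
  rewrite cA BE /char_poly char_block_diag_mx det_ublock big_cons.
  rewrite -/(char_poly B').
  have -> : \det (char_poly_mx (a%:M : 'M[R]_1)) = 'X - a%:P.
    by rewrite det_mx11 !mxE eqxx.
  by apply: mulfI; rewrite polyXsubC_eq0.
have [P' [d' [PP PP' PB]]] := IH _ _ symB' cB'.
pose P1 : 'M[R]_(1 + n) := block_mx 1%:M 0 0 P'.
pose d : 'rV_(1 + n) := row_mx a%:M d'.
have P1t : P1^T = block_mx 1%:M 0 0 P'^T by rewrite /P1 tr_block_mx trmx1 !trmx0.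
have PP1 : P1 *m P1^T = 1%:M.
  rewrite P1t mulmx_block !mul0mx !mulmx0 !addr0 !add0r PP mulmx1.
  by rewrite -scalar_mx_block.
have PP1' : P1^T *m P1 = 1%:M.
  rewrite P1t mulmx_block !mul0mx !mulmx0 !addr0 !add0r PP' mulmx1.
  by rewrite -scalar_mx_block.
exists (P1 *m Q), d; rewrite trmx_mul sQ; split.
- by rewrite mulmxA -(mulmxA P1) QQ mulmx1.
- by rewrite mulmxA -(mulmxA Q) PP1' mulmx1.
- have -> : P1 *m Q *m A *m (Q *m P1^T) = P1 *m B *m P1^T by rewrite defB !mulmxA.
  rewrite BE P1t !mulmx_block !mul0mx !mulmx0 !addr0 !add0r mul1mx mulmx1 PB.
  apply: etrans _ (esym (diag_mx_row a%:M d')); congr (block_mx _ _ _ _);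
    rewrite ?mul0mx //.
  by apply/matrixP => i j; rewrite !ord1 !mxE eqxx.
Qed.

(** [det (1 + t A)] is the reversed characteristic polynomial, evaluated at [- t]. *)
Lemma det_1_scale n (A : 'M[R]_n) (s : seq R) t :
  char_poly A = \prod_(a <- s) ('X - a%:P) ->
  \det (1%:M + t *: A) = \prod_(a <- s) (1 + t * a).
Proof.
move=> cA; have sz : size s = n.
  by have := size_char_poly A; rewrite cA size_prod_XsubC => -[].
have [->|t0] := eqVneq t 0.
  by rewrite scale0r addr0 det1 big1 // => i _; rewrite mul0r addr0.
have -> : 1%:M + t *: A = (- t) *: ((- t^-1)%:M - A).
  rewrite scalerBr !scaleNr opprK; congr (_ + _).
  by rewrite scale_scalar_mx mulrN mulfV // raddfN /= opprK.
rewrite detZ.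
have -> : \det ((- t^-1)%:M - A) = (char_poly A).[- t^-1].
  rewrite /char_poly -horner_evalE -det_map_mx; congr (\det _).
  apply/matrixP => i j; rewrite !mxE.
  change (- t^-1 *+ (i == j) - A i j = ('X *+ (i == j) - (A i j)%:P).[- t^-1]).
  by rewrite hornerD hornerN hornerC hornerMn hornerX.
rewrite cA horner_prod -sz.
elim: (s) => [|a s' IH]; first by rewrite !big_nil mulr1.
rewrite !big_cons exprS -IH hornerXsubC.
set X := _ ^+ _; set Y := \prod_(i <- s') _.
transitivity ((- t * - t^-1 + t * a) * (X * Y)); first by ring.
by rewrite mulrNN mulfV.
Qed.

End Spectral.

(** * Inequalities at a maximum point *)

Section Numeric.
Variable R : realFieldType.

Lemma normM_le (x y X Y : R) : `|x| <= X -> `|y| <= Y -> `|x * y| <= X * Y.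
Proof. by move=> hx hy; rewrite normrM; apply: ler_pM. Qed.

Lemma normB_le (x y X Y : R) : `|x| <= X -> `|y| <= Y -> `|x - y| <= X + Y.
Proof. by move=> hx hy; apply: le_trans (ler_normB _ _) (lerD hx hy). Qed.

Lemma normD_le (x y X Y : R) : `|x| <= X -> `|y| <= Y -> `|x + y| <= X + Y.
Proof. by move=> hx hy; apply: le_trans (ler_normD _ _) (lerD hx hy). Qed.

Lemma norm_divv (v x X : R) : 9/10 <= v -> `|v * x| <= X -> `|x| <= 2 * X.
Proof.
move=> v9; rewrite normrM ger0_norm; last by lra.
have := normr_ge0 x; nra.
Qed.

(** Coefficients of the powers of [W = |Dw|] that bound [D_z u] ([bnd1], times
    [W^2]), [D_a eta] ([bnd2], times [W]), [D_z D_a u] ([bnd3], times [W^3]), the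
    error terms of the second-order condition ([bnd4] and [bnd5], times [W^3]),
    their total ([bnd7]), and the error terms of the curvature estimate
    ([bnd9]). *)
Definition bnd1 (K : R) := 2 * (1 + K + K ^+ 2).
Definition bnd2 (K A : R) := bnd1 K + A * K.
Definition bnd3 (K A : R) := bnd2 K A + 4 * K * bnd1 K + 2 * K ^+ 2 + 2 * K.
Definition bnd4 (K A : R) := 2 * K * bnd3 K A + 3 * K * bnd1 K + K ^+ 2 + K.
Definition bnd5 (K A : R) := A * K + A * K * bnd1 K + A ^+ 2 * K ^+ 2.
Definition bnd7 (K A : R) := 2 * bnd4 K A + bnd5 K A + (K ^+ 2 + K) ^+ 2.
Definition bnd9 (K A : R) := (K ^+ 2 + K + A * K) + 2 * K * bnd1 K + K ^+ 2 + K.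

Variables (K A b W v u h1 : R).
Hypotheses (K1 : 1 <= K) (A0 : 0 <= A) (b0 : 0 < b) (b1 : b <= 1) (W1 : 1 <= W)
  (v9 : 9/10 <= v) (v1 : v <= 1) (uK : `|u| <= K) (h0 : 0 <= h1) (h1l : h1 <= 1)
  (hb : h1 ^+ 2 <= 2 * b).

Let K0 : 0 <= K. Proof. exact: le_trans ler01 K1. Qed.
Let W0 : 0 <= W. Proof. exact: le_trans ler01 W1. Qed.
Let C10 : 0 <= bnd1 K. Proof. by rewrite /bnd1 mulr_ge0 ?addr_ge0 ?sqr_ge0. Qed.
Ltac ctx := pose proof K1; pose proof A0; pose proof b0; pose proof b1; pose proof W1;
  pose proof v9; pose proof v1; pose proof h0; pose proof h1l; pose proof hb;
  pose proof K0; pose proof W0; pose proof C10.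
Let WW : W <= W ^+ 2. Proof. by rewrite expr2 ler_peMl. Qed.
Let WW3 : W ^+ 2 <= W ^+ 3. Proof. by rewrite [_ ^+ 3]exprS ler_peMl ?exprn_ge0. Qed.
Let h1n : `|h1| <= 1. Proof. by rewrite ger0_norm. Qed.

Lemma le_mulW13 (c : R) : 0 <= c -> c * W <= c * W ^+ 3.
Proof. by move=> c0; rewrite ler_wpM2l // (le_trans WW WW3). Qed.
Lemma le_mulW23 (c : R) : 0 <= c -> c * W ^+ 2 <= c * W ^+ 3.
Proof. by move=> c0; rewrite ler_wpM2l. Qed.
Lemma le_mulW12 (c : R) : 0 <= c -> c * W <= c * W ^+ 2.
Proof. by move=> c0; rewrite ler_wpM2l. Qed.
Lemma le_mulW1 (c : R) : 0 <= c -> c <= c * W.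
Proof. by move=> c0; rewrite ler_peMr. Qed.

(* [uz, vz, pz] stand for the derivatives of [u], [v], [psi] in the direction
   [z = Dw] at a maximum point, where [|Dw| = W] and [w = v u + psi]; the index
   [a] will denote a derivative in a unit eigendirection of the Hessian. *)
Variables (uz vz pz : R).
Hypotheses (vzK : `|vz| <= K * W) (pzK : `|pz| <= K * W)
  (wzE : v * uz + vz * u + pz = W ^+ 2).

Lemma uz_bnd : `|uz| <= bnd1 K * W ^+ 2.
Proof.
rewrite /bnd1 -mulrA; apply: (norm_divv v9).
have -> : v * uz = W ^+ 2 - (vz * u + pz) by rewrite -wzE; ring.
have B := normB_le (_ : `|W ^+ 2| <= W ^+ 2) (normD_le (normM_le vzK uK) pzK).
apply: (le_trans (B _)); first by rewrite ger0_norm ?exprn_ge0.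
have E1 := le_mulW12 K0; have E2 := le_mulW12 (sqr_ge0 K); ctx; lra.
Qed.

Section Direction.
Variables (ua uza uaa uzaa va vaa vza vzaa pa pza pzaa Da Daa wa : R).
Hypotheses (vaK : `|va| <= K) (vaaK : `|vaa| <= K) (vzaK : `|vza| <= K * W) (vzaaK : `|vzaa| <= K * W)
  (paK : `|pa| <= K) (pzaK : `|pza| <= K * W) (pzaaK : `|pzaa| <= K * W)
  (DaK : `|Da| <= K) (DaaK : `|Daa| <= K) (waW : `|wa| <= W)
  (waE : v * ua + va * u + pa = wa).

Let ea := h1 * ua + A * Da.
Let eaa := h1 * uaa + 2 * b * ua ^+ 2 + A * Daa.
Hypotheses
  (first_order : 2 * (v * uza + vz * ua + va * uz + vza * u + pza) = - (W ^+ 2 * ea))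
  (second_order :
    2 * (v * uzaa + vz * uaa + va * uza + ua * vza + va * uza + ua * vza + vaa * uz + vzaa * u + pzaa)
    + W ^+ 2 * (eaa - ea ^+ 2 / 2) <= 0).

Let ua_bnd : `|ua| <= bnd1 K * W.
Proof.
rewrite /bnd1 -mulrA; apply: (norm_divv v9).
have -> : v * ua = wa - (va * u + pa) by rewrite -waE; ring.
apply: (le_trans (normB_le waW (normD_le (normM_le vaK uK) paK))).
have E1 := le_mulW1 K0; have E2 := le_mulW1 (sqr_ge0 K); ctx; lra.
Qed.

Let ea_bnd : `|ea| <= bnd2 K A * W.
Proof.
have AA : `|A| <= A by rewrite ger0_norm.
apply: (le_trans (normD_le (normM_le h1n ua_bnd) (normM_le AA DaK))).
have E1 := le_mulW1 (mulr_ge0 A0 K0); rewrite /bnd2; ctx; lra.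
Qed.

Let uza_bnd : `|uza| <= bnd3 K A * W ^+ 3.
Proof.
have -> : bnd3 K A * W ^+ 3 = 2 * (bnd2 K A / 2 * W ^+ 3 + 2 * K * bnd1 K * W ^+ 3 + (K ^+ 2 + K) * W ^+ 3).
  by rewrite /bnd3; field.
apply: (norm_divv v9).
have -> : v * uza = - (W ^+ 2 * ea / 2) - (vz * ua + va * uz + vza * u + pza).
  by have := first_order; ctx; lra.
have W2 : `|W ^+ 2| <= W ^+ 2 by rewrite ger0_norm ?exprn_ge0.
have T1 : `|- (W ^+ 2 * ea / 2)| <= W ^+ 2 * (bnd2 K A * W) / 2.
  rewrite normrN normrM [`|2^-1|]ger0_norm ?invr_ge0 ?ler0n // ler_wpM2r ?invr_ge0 ?ler0n //.
  exact: normM_le.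
apply: (le_trans (normB_le T1 (normD_le (normD_le (normD_le (normM_le vzK ua_bnd)
  (normM_le vaK uz_bnd)) (normM_le vzaK uK)) pzaK))).
have E1 := le_mulW13 K0; have E2 := le_mulW13 (sqr_ge0 K); have E3 := le_mulW23 (mulr_ge0 K0 C10).
have -> : W ^+ 2 * (bnd2 K A * W) / 2 = bnd2 K A / 2 * W ^+ 3 by rewrite exprSr; field.
ctx; lra.
Qed.

Let lower_bnd : v * uzaa + vz * uaa - bnd4 K A * W ^+ 3 <=
  v * uzaa + vz * uaa + va * uza + ua * vza + va * uza + ua * vza + vaa * uz + vzaa * u + pzaa.
Proof.
have B1 := normM_le vaK uza_bnd; have B2 := normM_le ua_bnd vzaK.
have B3 := normM_le vaaK uz_bnd; have B4 := normM_le vzaaK uK.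
move: B1 B2 B3 B4 pzaaK; rewrite !ler_norml => /andP[B1 _] /andP[B2 _] /andP[B3 _] /andP[B4 _] /andP[B5 _].
have E1 := le_mulW13 K0; have E2 := le_mulW13 (sqr_ge0 K); have E3 := le_mulW23 (mulr_ge0 K0 C10).
rewrite /bnd4; ctx; lra.
Qed.

Let quad_bnd : W ^+ 2 * (h1 * uaa + b * ua ^+ 2) - bnd5 K A * W ^+ 3 <= W ^+ 2 * (eaa - ea ^+ 2 / 2).
Proof.
have AA : `|A| <= A by rewrite ger0_norm.
have B1 := normM_le AA DaaK.
have B2 := normM_le (normM_le h1n AA) (normM_le ua_bnd DaK).
have B3 := normM_le (normM_le AA DaK) (normM_le AA DaK).
have q1 : h1 ^+ 2 * ua ^+ 2 <= 2 * b * ua ^+ 2 by rewrite ler_wpM2r ?sqr_ge0.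
move: B1 B2 B3; rewrite !ler_norml => /andP[B1 _] /andP[_ B2] /andP[_ B3].
have AK0 := mulr_ge0 A0 K0; have AKC := mulr_ge0 AK0 C10.
have AK2 : 0 <= A ^+ 2 * K ^+ 2 by rewrite mulr_ge0 ?sqr_ge0.
have E1 := le_mulW1 AK0; have E2 := le_mulW1 AK2; have E3 := le_mulW13 AK0.
have L : h1 * uaa + b * ua ^+ 2 - bnd5 K A * W <= eaa - ea ^+ 2 / 2.
  rewrite /eaa /ea /bnd5; ctx; lra.
have := ler_wpM2l (exprn_ge0 2 W0) L.
have -> : W ^+ 2 * (h1 * uaa + b * ua ^+ 2 - bnd5 K A * W) =
   W ^+ 2 * (h1 * uaa + b * ua ^+ 2) - bnd5 K A * W ^+ 3 by ring.
by [].
Qed.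

Let wa_bnd : wa ^+ 2 <= 2 * ua ^+ 2 + 2 * (K ^+ 2 + K) ^+ 2.
Proof.
have r : `|va * u + pa| <= K ^+ 2 + K by rewrite expr2; exact: normD_le (normM_le vaK uK) paK.
have r2 : (va * u + pa) ^+ 2 <= (K ^+ 2 + K) ^+ 2.
  by rewrite -[X in X <= _]real_normK ?num_real // ler_pXn2r ?nnegrE // addr_ge0 ?sqr_ge0.
have v2 : v ^+ 2 * ua ^+ 2 <= ua ^+ 2 by rewrite ler_piMl ?sqr_ge0 // exprn_ile1 //; ctx; lra.
rewrite -waE; move: r2; set t := va * u + pa => r2.
have -> : v * ua + va * u + pa = v * ua + t by rewrite /t; ring.
have := sqr_ge0 (v * ua - t); ctx; nra.
Qed.

(** The second-order condition in one eigendirection. Its mixed terms are bounded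
    by means of the first-order condition, and only three kinds of terms are kept:
    the third derivative and the second derivative of [u], which the linearised
    equation evaluates, and the good square of [D_a w]. *)
Lemma direction_bound :
  2 * v * uzaa + (2 * vz + W ^+ 2 * h1) * uaa + W ^+ 2 * (b / 2) * wa ^+ 2 <= bnd7 K A * W ^+ 3.
Proof.
have P1 : W ^+ 2 * (b / 2) * wa ^+ 2 <= W ^+ 2 * (b / 2) * (2 * ua ^+ 2 + 2 * (K ^+ 2 + K) ^+ 2).
  rewrite ler_wpM2l // mulr_ge0 ?exprn_ge0 //; ctx; lra.
have P2 : W ^+ 2 * (b * (K ^+ 2 + K) ^+ 2) <= (K ^+ 2 + K) ^+ 2 * W ^+ 3.
  apply: le_trans (le_mulW23 (sqr_ge0 _)); rewrite [leRHS]mulrC ler_wpM2l ?exprn_ge0 //.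
  by rewrite ler_piMl ?sqr_ge0.
have := second_order; have := lower_bnd; have := quad_bnd; rewrite /bnd7.
set E := (_ ^+ 2) * (eaa - _); set L := v * uzaa + _ + _ + _ + _ + _ + _ + _ + _; ctx; lra.
Qed.

End Direction.

(** The first-order condition in the direction of the gradient: it contains the
    term [- W^2 h1 u_z / 2], of order [- b W^4], which outweighs all the others
    once [b W] is large. *)
Lemma curvature_bound (uzz vzz pzz Dz : R) : 2 * b <= h1 ->
  `|vzz| <= K * W ^+ 2 -> `|pzz| <= K * W ^+ 2 -> `|Dz| <= K * W ->
  2 * (v * uzz + vz * uz + vz * uz + vzz * u + pzz) = - (W ^+ 2 * (h1 * uz + A * Dz)) ->
  (bnd9 K A + 1) <= b * W -> uzz <= - W ^+ 2.
Proof.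
move=> h2b vzzK pzzK DzK E Wb.
have AA : `|A| <= A by rewrite ger0_norm.
have B1 := normM_le vzK uz_bnd; have B2 := normM_le vzzK uK; have B3 := normM_le AA DzK.
have B4 := normM_le vzK uK.
move: B1 B2 B3 B4 pzK pzzK; rewrite !ler_norml => /andP[B1 _] /andP[B2 _] /andP[B3 _] /andP[_ B4] /andP[_ B5] /andP[B6 _].
have uz1 : W ^+ 2 - (K ^+ 2 + K) * W <= v * uz by have := wzE; ctx; lra.
have K2K : 0 <= K ^+ 2 + K by have := sqr_ge0 K; ctx; lra.
have bK : b * ((K ^+ 2 + K) * W) <= (K ^+ 2 + K) * W by rewrite ler_piMl ?mulr_ge0.
have c9 : 0 <= bnd9 K A.
  have := mulr_ge0 A0 K0; have := mulr_ge0 K0 C10; have := sqr_ge0 K; rewrite /bnd9; ctx; lra.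
have W2p : 0 <= W ^+ 2 by rewrite exprn_ge0.
have Wbig : (bnd9 K A + 1) * W ^+ 3 <= b * W * W ^+ 3 by rewrite ler_wpM2r ?exprn_ge0.
have uz0 : 0 <= v * uz.
  apply: le_trans uz1; have h := ler_wpM2r W0 Wb.
  have hb1 : b * W * W <= W * W by rewrite -mulrA ler_piMl // mulr_ge0.
  have : (K ^+ 2 + K) * W <= (bnd9 K A + 1) * W.
    rewrite ler_wpM2r // /bnd9; have := mulr_ge0 A0 K0; have := mulr_ge0 K0 C10; have := sqr_ge0 K; ctx; lra.
  rewrite expr2; ctx; lra.
have uzp : v * uz <= uz.
  have : 0 <= uz by rewrite -(pmulr_rge0 _ (_ : 0 < v)) //; ctx; lra.
  by move=> ?; rewrite ler_piMl.
have hz : 2 * b * (W ^+ 2 - (K ^+ 2 + K) * W) <= h1 * uz.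
  apply: (@le_trans _ _ (2 * b * (v * uz))); first by rewrite ler_wpM2l //; ctx; lra.
  by apply: ler_pM => //; ctx; lra.
have Eh : 2 * b * W ^+ 2 - (2 * ((K ^+ 2 + K) * W) + A * (K * W)) <= h1 * uz + A * Dz by ctx; lra.
have {Eh} := ler_wpM2l W2p Eh.
have E1 := le_mulW23 (sqr_ge0 K); have E2 := le_mulW23 K0.
have E3 : 0 <= A * K * W ^+ 3 by rewrite !mulr_ge0 ?exprn_ge0.
have E4 : W ^+ 2 <= W ^+ 3 by [].
have -> : W ^+ 2 * (2 * b * W ^+ 2 - (2 * ((K ^+ 2 + K) * W) + A * (K * W))) =
  2 * (b * W * W ^+ 3) - 2 * (K ^+ 2 + K) * W ^+ 3 - A * K * W ^+ 3 by ring.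
move=> Eh.
have B1' : - (K * bnd1 K * W ^+ 3) <= vz * uz by have -> : K * bnd1 K * W ^+ 3 = K * W * (bnd1 K * W ^+ 2) by ring.
have fin : v * uzz <= - W ^+ 2.
  move: Wbig; rewrite /bnd9 => Wbig; ctx; lra.
have : v * uzz <= v * - W ^+ 2.
  apply: (le_trans fin); rewrite mulrN lerN2 ler_piMl //.
by rewrite ler_pM2l //; ctx; lra.
Qed.

End Numeric.

Lemma combine_terms (R : realFieldType) (v X2 X3 X4 h G B E1 E2 : R) :
  - E1 <= v * X2 -> - E2 <= X3 * X4 -> 0 <= h * X4 ->
  2 * v * X2 + (2 * X3 + h) * X4 + G <= B -> G <= B + 2 * (E1 + E2).
Proof. lra. Qed.

(** After summation over the eigendirections the good term is of order [W^4] and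
    the bad ones of order [W^3], all proportional to the trace [M] except for the
    contribution of the equation itself, which [M >= 1/n] absorbs. *)
Lemma bernstein_conclusion (R : realFieldType) (n : nat) (K A b W S1 M : R) :
  (0 < n)%N -> 0 < b -> 1 <= W -> 0 <= S1 -> 0 <= bnd7 K A -> n%:R^-1 <= M ->
  W ^+ 2 * (b / 2) * (n%:R^-1 ^+ 2 * W ^+ 2 * M) <= bnd7 K A * W ^+ 3 * M + S1 * W ->
  W <= 2 * n%:R ^+ 2 * (bnd7 K A + n%:R * S1) / b.
Proof.
move=> n0 b0 W1 S0 C0 Mn H.
have N0 : 0 < n%:R :> R by rewrite ltr0n.
have M0 : 0 < M by apply: lt_le_trans Mn; rewrite invr_gt0.
have W0 : 0 < W by lra.
have NM : 1 <= n%:R * M by rewrite -[leLHS](divff (lt0r_neq0 N0)) ler_pM2l.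
have S1W : S1 * W <= n%:R * S1 * W ^+ 3 * M.
  have : S1 * W <= S1 * W * (n%:R * M) by rewrite ler_peMr // mulr_ge0 // ltW.
  move=> h; apply: (le_trans h).
  have -> : S1 * W * (n%:R * M) = (S1 * (n%:R * M)) * W by ring.
  have -> : n%:R * S1 * W ^+ 3 * M = (S1 * (n%:R * M)) * W ^+ 3 by ring.
  rewrite ler_wpM2l ?mulr_ge0 //; try lra.
  by rewrite -[leLHS]expr1 ler_weXn2l.
rewrite ler_pdivlMr // -(ler_pM2r (_ : 0 < W ^+ 3 * M / (2 * n%:R ^+ 2))); last first.
  by rewrite divr_gt0 ?mulr_gt0 ?exprn_gt0.
have -> : W * b * (W ^+ 3 * M / (2 * n%:R ^+ 2)) = W ^+ 2 * (b / 2) * (n%:R^-1 ^+ 2 * W ^+ 2 * M).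
  by field; rewrite gt_eqF.
have -> : 2 * n%:R ^+ 2 * (bnd7 K A + n%:R * S1) * (W ^+ 3 * M / (2 * n%:R ^+ 2)) =
   bnd7 K A * W ^+ 3 * M + n%:R * S1 * W ^+ 3 * M.
  by field; rewrite gt_eqF.
by apply: (le_trans H); rewrite lerD2l.
Qed.

Import numFieldNormedType.Exports.
Local Open Scope classical_set_scope.

(** * Directional derivatives and functions of class C^1 *)

Section Lines.
Variables (R : realType) (n : nat).
Implicit Types (f g : 'rV[R]_n -> R) (x v : 'rV[R]_n).

Lemma is_derive_line f x v t (df : R) : is_derive (x + t *: v) v f df ->
  is_derive t 1 (fun s => f (x + s *: v)) df.
Proof.
move=> [fd <-]; have E : (fun h : R => h^-1 *: ((fun s => f (x + s *: v)) (h *: 1 + t) - f (x + t *: v)))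
   = (fun h => h^-1 *: (f (h *: v + (x + t *: v)) - f (x + t *: v))).
  apply/funext => h; congr (_ *: (f _ - _)).
  by rewrite [h *: 1]mulr1 scalerDl addrCA.
by split; rewrite /derivable /derive E.
Qed.

Lemma is_derive_line0 f x v (df : R) :
  is_derive (0 : R) 1 (fun s => f (x + s *: v)) df -> is_derive x v f df.
Proof.
have E : (fun h : R => h^-1 *: (f (x + (h *: 1 + 0) *: v) - f (x + 0 *: v)))
   = (fun h : R => h^-1 *: (f (h *: v + x) - f x)).
  apply/funext => h; rewrite addr0 scale0r addr0 [x + _]addrC.
  by rewrite [h *: 1]mulr1.
by move=> [fd <-]; split; [move: fd|]; rewrite /derivable /derive E.
Qed.

Lemma is_derive_comp1 (h : R -> R) f x v (dh df : R) : is_derive x v f df ->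
  is_derive (f x) 1 h dh -> is_derive x v (fun y => h (f y)) (dh * df).
Proof.
move=> fd hd; apply: is_derive_line0.
have fd0 : is_derive (0 : R) 1 (fun s => f (x + s *: v)) df.
  by apply: is_derive_line; rewrite scale0r addr0.
apply: (@is_derive1_comp _ h (fun s => f (x + s *: v))).
by rewrite /= scale0r addr0.
Qed.

Lemma derive_line f x v t : derivable f (x + t *: v) v ->
  is_derive t 1 (fun s => f (x + s *: v)) ('D_v f (x + t *: v)).
Proof. by move=> fd; apply: is_derive_line; exact: derivableP. Qed.

Lemma is_derive_dirZ f x v (c : R) (df : R) : is_derive x v f df ->
  is_derive x (c *: v) f (c * df).
Proof.
move=> [fd <-].
have [->|c0] := eqVneq c 0; first by rewrite scale0r mul0r; exact: is_derive0.
suff H : h^-1 *: (f (h *: (c *: v) + x) - f x) @[h --> 0^'] --> c * 'D_v f x.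
  by split; [apply/cvg_ex; exists (c * 'D_v f x) | apply: cvg_lim].
have E : (fun h : R => h^-1 *: (f (h *: (c *: v) + x) - f x)) =
         (fun h => c *: ((c * h)^-1 *: (f ((c * h) *: v + x) - f x))).
  apply/funext => h; rewrite !scalerA [h * c]mulrC; congr (_ *: _).
  by rewrite invfM mulrA mulfV // mul1r.
rewrite E.
have := fd; rewrite /derivable => H.
have C : (fun h : R => c * h) @ 0^' --> 0^'.
  move=> A; rewrite /= !near_simpl /= => -[e e0 eA].
  exists (e / `|c|); first by rewrite /= divr_gt0 // normr_gt0.
  move=> h /=; rewrite sub0r normrN => he h0; apply: eA => /=.
    by rewrite sub0r normrN normrM mulrC -ltr_pdivlMr ?normr_gt0.
  by rewrite mulf_neq0.
apply: cvgM; first exact: cvg_cst.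
exact: (cvg_comp _ _ C H).
Qed.

Lemma MVT_line f x v :
  (forall s, 0 <= s <= 1 -> derivable f (x + s *: v) v) ->
  exists2 s, 0 < s < 1 & f (x + v) - f x = 'D_v f (x + s *: v).
Proof.
move=> fd.
have [s| |c] := @MVT R (fun s => f (x + s *: v)) (fun s => 'D_v f (x + s *: v)) 0 1 ltr01.
- by rewrite in_itv /= => /andP[s0 s1]; apply: derive_line; apply: fd; rewrite !ltW.
- apply: derivable_within_continuous => s; rewrite in_itv /= => s01.
  by have [] := derive_line (fd s s01).
- rewrite in_itv /= => c01; rewrite scale1r scale0r addr0 subr0 mulr1 => E.
  by exists c.
Qed.

End Lines.

Lemma cvg_bigsum (R : realType) (T I : Type) (F : set_system T) (FF : Filter F)
    (r : seq I) (f : I -> T -> R) (a : I -> R) :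
  (forall i, f i x @[x --> F] --> a i) ->
  \sum_(i <- r) f i x @[x --> F] --> \sum_(i <- r) a i.
Proof.
move=> fa; elim: r => [|i r IH].
  by rewrite big_nil; under eq_fun do rewrite big_nil; exact: cvg_cst.
rewrite big_cons; under eq_fun do rewrite big_cons.
by apply: cvgD.
Qed.

Section C1.
Variables (R : realType) (n : nat).
Implicit Types (f g : 'rV[R]_n -> R) (x v : 'rV[R]_n) (U : set 'rV[R]_n).

Definition grad_lin (c : 'rV[R]_n) (h : 'rV[R]_n) : R := \sum_i h 0 i * c 0 i.

Lemma grad_lin_is_linear c : linear (grad_lin c : 'rV[R]_n -> R^o).
Proof.
move=> a u v; rewrite /grad_lin scaler_sumr -big_split /=.
by apply: eq_bigr => i _; rewrite !mxE mulrDl -mulrA.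
Qed.

HB.instance Definition _ c := GRing.isLinear.Build R 'rV[R]_n R^o *:%R
  (grad_lin c) (@grad_lin_is_linear c).

Lemma coord_le_norm (h : 'rV[R]_n) i : `|h 0 i| <= `|h|.
Proof.
rewrite [leRHS]/Num.Def.normr/= mx_normrE.
exact: (le_bigmax _ (fun ij : 'I_1 * 'I_n => `|h ij.1 ij.2|) (0, i)).
Qed.

Lemma norm_le_coord (h : 'rV[R]_n) e : 0 <= e -> (forall i, `|h 0 i| <= e) -> `|h| <= e.
Proof.
move=> e0 H; rewrite [leLHS]/Num.Def.normr/= mx_normrE.
by apply: bigmax_le => // -[i j] _ /=; rewrite ord1.
Qed.

(** The corners of the coordinate path from 0 to [h]. *)
Definition trunc (h : 'rV[R]_n) (m : nat) : 'rV[R]_n :=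
  \row_i (if (i < m)%N then h 0 i else 0).

Lemma trunc_ge h m : (n <= m)%N -> trunc h m = h.
Proof. by move=> nm; apply/rowP => i; rewrite mxE (leq_trans (ltn_ord i)). Qed.

Lemma truncS h (i : 'I_n) : trunc h i.+1 = trunc h i + h 0 i *: delta_mx 0 i.
Proof.
apply/rowP => j; rewrite !mxE eqxx /= ltnS leq_eqVlt -(inj_eq val_inj) /=.
by case: (ltngtP j i) => [||/val_inj ->] /=; rewrite ?mulr0 ?mulr1 ?addr0 ?add0r.
Qed.

(** Along a coordinate path every increment is a mean value of one partial
    derivative, close to its value at [x] by continuity. *)
Lemma C1_increment U f x : open U -> Ck_in 1 U f -> U x -> forall e, 0 < e ->
  exists2 d, 0 < d & forall h, `|h| < d ->
   `|f (x + h) - f x - grad_lin (grad f x) h| <= e * `|h|.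
Proof.
move=> oU fC Ux e e0.
have n1 : 0 < n%:R + 1 :> R by rewrite ltr_wpDl ?ler0n.
have [d d0 Hd] : exists2 d, 0 < d & forall y, `|y - x| < d -> U y /\
    forall i, `|pderivs [:: i] f y - pderivs [:: i] f x| <= e / (n%:R + 1).
  have : \forall y \near x, U y /\ forall i : 'I_n,
      `|pderivs [:: i] f y - pderivs [:: i] f x| <= e / (n%:R + 1).
    apply: filterI; first exact: open_nbhs_nbhs.
    apply: (@filter_forall _ _ _ _ (nbhs_filter x)) => i.
    have [+ _] := fC [:: i] x Ux; move=> /(_ isT)/cvgrPdist_le/(_ (e / (n%:R + 1))).
    by rewrite divr_gt0 // => /(_ isT); apply: filterS => y; rewrite distrC.
  move=> /nbhs_ballP[d /= d0 H]; exists d => // y yx.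
  by apply: H; rewrite -ball_normE /ball_ /= distrC.
exists d => // h hd.
have tr m s (i : 'I_n) : 0 <= s <= 1 -> m = i -> `|trunc h m + s *: (h 0 i *: delta_mx 0 i)| <= `|h|.
  move=> /andP[s0 s1] ->; apply: norm_le_coord => // j; rewrite !mxE eqxx /=.
  case: (ltngtP j i) => [ji|ji|/val_inj ji] /=; rewrite -?(inj_eq val_inj) /=.
  - by rewrite (ltn_eqF ji) !mulr0 addr0 coord_le_norm.
  - by rewrite (gtn_eqF ji) !mulr0 addr0 normr0.
  - rewrite ji eqxx mulr1 add0r normrM (ger0_norm s0).
    by apply: le_trans (coord_le_norm h i); rewrite ler_piMl.
have step (i : 'I_n) : `|f (x + trunc h i.+1) - f (x + trunc h i) - h 0 i * pderivs [:: i] f x| <= e / (n%:R + 1) * `|h|.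
  have dir y : `|y - x| < d -> is_derive y (h 0 i *: delta_mx 0 i) f (h 0 i * pderivs [:: i] f y).
    move=> yd; have [Uy _] := Hd y yd; apply: is_derive_dirZ; apply: derivableP.
    by have [_ /(_ isT i)] := fC [::] y Uy.
  have near_x s : 0 <= s <= 1 ->
      `|(x + trunc h i + s *: (h 0 i *: delta_mx 0 i)) - x| < d.
    move=> s01; rewrite -(addrA x) addrAC subrr add0r.
    by apply: le_lt_trans hd; exact: tr.
  have [s s01|s s01] := @MVT_line _ _ f (x + trunc h i) (h 0 i *: delta_mx 0 i).
    by have [] := dir _ (near_x s s01).
  rewrite truncS addrA => ->.
  have {}s01 : 0 <= s <= 1 by move/andP: s01 => [? ?]; rewrite !ltW.
  rewrite (@derive_val _ _ _ _ _ _ _ (dir _ (near_x s s01))) -mulrBr normrM mulrC.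
  apply: ler_pM => //; last exact: coord_le_norm.
  by have [_] := Hd _ (near_x s s01); apply.
have tele m : (m <= n)%N -> `|f (x + trunc h m) - f x - \sum_(i < n | (i < m)%N) h 0 i * pderivs [:: i] f x|
     <= m%:R * (e / (n%:R + 1) * `|h|).
  elim: m => [|m IH] mn.
    rewrite big_pred0 // mul0r.
    have -> : trunc h 0 = 0 by apply/rowP => j; rewrite !mxE.
    by rewrite addr0 subrr subr0 normr0.
  have := step (Ordinal mn); have := IH (ltnW mn) => /= H1 H2.
  have -> : \sum_(i < n | (i < m.+1)%N) h 0 i * pderivs [:: i] f x =
     \sum_(i < n | (i < m)%N) h 0 i * pderivs [:: i] f x + h 0 (Ordinal mn) * pderivs [:: Ordinal mn] f x.
    rewrite (bigD1 (Ordinal mn)) //= addrC; congr (_ + _); apply: eq_bigl => i.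
    by rewrite ltnS [in RHS]ltn_neqAle andbC -(inj_eq val_inj).
  rewrite -natr1 mulrDl mul1r.
  apply: le_trans (lerD H1 H2); apply: le_trans (ler_normD _ _).
  rewrite le_eqVlt; apply/orP; left; apply/eqP; congr (`|_|).
  set a := f _; set b := f _; set c := f _; set S := \sum_(i < n | _) _; set t := _ * _; ring.
have := tele n (leqnn n); rewrite trunc_ge //.
have -> : \sum_(i < n | (i < n)%N) h 0 i * pderivs [:: i] f x = grad_lin (grad f x) h.
  by apply: eq_big => [i|i _]; rewrite ?ltn_ord // mxE.
move=> H; apply: (le_trans H); rewrite mulrA ler_wpM2r // mulrCA ler_piMr ?(ltW e0) //.
by rewrite ler_pdivrMr // mul1r lerDl.
Qed.

Lemma C1_differentiable U f x : open U -> Ck_in 1 U f -> U x ->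
  differentiable f x /\ 'd f x = grad_lin (grad f x) :> (_ -> _).
Proof.
move=> oU fC Ux.
have lc : continuous (grad_lin (grad f x) : 'rV[R]_n -> R^o).
  move=> h; apply: (@cvg_bigsum _ _ _ (nbhs h) (nbhs_filter h)) => i.
  by apply: cvgMr_tmp; exact: coord_continuous.
have L (e : R) : 0 < e -> \forall h \near (0 : 'rV[R]_n),
    `|f (h + x) - (f x + grad_lin (grad f x) h)| <= e * `|h|.
  move=> e0; have [d d0 Hd] := C1_increment oU fC Ux e0.
  apply/nbhs_norm0P; exists d => // h /= hd.
  by rewrite opprD addrA [h + x]addrC; exact: Hd.
have E : 'd f x = grad_lin (grad f x) :> (_ -> _).
  apply: (@diff_unique _ _ _ f (grad_lin (grad f x)) x lc).
  by apply/eqaddoP => e e0; exact: L.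
split => //; apply/diff_locallyP; split; first by rewrite E.
by apply/eqaddoP => e e0; rewrite E; exact: L.
Qed.

Lemma C1_derive U f x v : open U -> Ck_in 1 U f -> U x ->
  is_derive x v f (\sum_i v 0 i * pderivs [:: i] f x).
Proof.
move=> oU fC Ux; have [df E] := C1_differentiable oU fC Ux.
split; first exact: diff_derivable.
by rewrite deriveE // E; apply: eq_bigr => i _; rewrite mxE.
Qed.

Lemma C1_curve U f (c : R -> 'rV[R]_n) (c' : 'rV[R]_n) t : open U -> Ck_in 1 U f -> U (c t) ->
  (forall i, is_derive t 1 (fun s => c s 0 i) (c' 0 i)) ->
  is_derive t 1 (f \o c) (\sum_i c' 0 i * pderivs [:: i] f (c t)).
Proof.
move=> oU fC Uc dc; have [df E] := C1_differentiable oU fC Uc.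
have cd : derivable c t 1 by apply/derivable_mxP => i j; rewrite ord1; have [] := dc j.
have cD : 'D_1 c t = c'.
  by rewrite derive_mx //; apply/rowP => i; rewrite mxE; have [_ ->] := dc i.
have cdd : differentiable c t by exact/derivable1_diffP.
split; first by apply: diff_derivable; exact: differentiable_comp.
rewrite deriveE; last exact: differentiable_comp.
rewrite diff_comp //= -(deriveE _ cdd) cD E.
by apply: eq_bigr => i _; rewrite mxE.
Qed.

End C1.

(** * Functions of class C^k with limits at boundary points *)

Section CkL.
Variables (R : realType) (n : nat).
Implicit Types (f g : 'rV[R]_n -> R) (x v : 'rV[R]_n) (U S : set 'rV[R]_n) (i : 'I_n) (s : seq 'I_n).
Local Notation e_ i := (delta_mx (0 : 'I_1) (i : 'I_n) : 'rV[R]_n).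

Definition has_limit U x f := exists l : R, f @ within U (nbhs x) --> l.

(** Class [C^k] in [U], with limits from inside [U], at the points of [S], of all
    the derivatives of order at most [k]. For [S = closure U] this is regularity up
    to the boundary, for [S = set0] regularity inside. Existence of limits is
    inherited by sums, products and compositions without handling extensions. *)
Definition CkL k U S f := forall s x,
  [/\ (size s <= k)%N -> U x -> {for x, continuous (pderivs s f)},
      (size s <= k)%N -> S x -> has_limit U x (pderivs s f) &
      (size s < k)%N -> U x -> forall i, derivable (pderivs s f) x (e_ i)].

Lemma CkL_Ck k U S f : CkL k U S f -> Ck_in k U f.
Proof. by move=> H s x Ux; have [h1 _ h2] := H s x; split=> h; [exact: h1|exact: h2]. Qed.

Lemma Ck_CkL k U f : Ck_in k U f -> CkL k U set0 f.
Proof.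
move=> H s x; split=> //; last by move=> sk Ux i; have [_ h2] := H s x Ux; exact: h2.
by move=> sk Ux; have [h1 _] := H s x Ux; exact: h1.
Qed.

Lemma CkLW j k U S f : (j <= k)%N -> CkL k U S f -> CkL j U S f.
Proof.
move=> jk H s x; have [h1 h2 h3] := H s x.
by split=> sj; [apply: h1|apply: h2|apply: h3]; apply: (leq_trans sj jk).
Qed.

Lemma Ck_inW j k U f : (j <= k)%N -> Ck_in k U f -> Ck_in j U f.
Proof. by move=> jk /Ck_CkL/(CkLW jk)/CkL_Ck. Qed.

Lemma Ck_in_sub k U U' f : U' `<=` U -> Ck_in k U f -> Ck_in k U' f.
Proof. by move=> UU H s x /UU; exact: H. Qed.

Lemma CkL0 U S f : (forall x, U x -> {for x, continuous f}) ->
  (forall x, S x -> has_limit U x f) -> CkL 0 U S f.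
Proof. by move=> h1 h2 [|//] x; split => //= _; [exact: h1|exact: h2]. Qed.

Lemma CkLS k U S f : CkL k.+1 U S f <->
  [/\ forall x, U x -> {for x, continuous f},
      forall x, S x -> has_limit U x f,
      forall x, U x -> forall i, derivable f x (e_ i) &
      forall i, CkL k U S ('D_(e_ i) f)].
Proof.
split.
  move=> H; split.
  - by move=> x; have [h _ _] := H [::] x; exact: h.
  - by move=> x; have [_ h _] := H [::] x; exact: h.
  - by move=> x; have [_ _ h] := H [::] x; exact: h.
  - move=> i s x; have [h1 h2 h3] := H (rcons s i) x.
    move: h1 h2 h3; rewrite /pderivs foldr_rcons size_rcons.
    by move=> h1 h2 h3; split.
move=> [h1 h2 h3 h4] s x; case/lastP: s => [|s i].
  by split => /= _; [exact: h1|exact: h2|exact: h3].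
by have := h4 i s x; rewrite /pderivs foldr_rcons size_rcons.
Qed.

Lemma CkL_lim k U S f x : CkL k U S f -> S x -> has_limit U x f.
Proof. by move=> H; have [_ h _] := H [::] x; exact: h. Qed.

Lemma CkL_cont k U S f x : CkL k U S f -> U x -> f y @[y --> x] --> f x.
Proof. by move=> H; have [h _ _] := H [::] x; exact: h. Qed.

Lemma CkL_der k U S f x i : CkL k.+1 U S f -> U x -> derivable f x (e_ i).
Proof. by move=> H Ux; have [_ _ h] := H [::] x; exact: h. Qed.

Lemma CkL_D k U S f i : CkL k.+1 U S f -> CkL k U S ('D_(e_ i) f).
Proof. by move=> /CkLS[]. Qed.

Lemma has_limit_ext U x f g : (forall y, U y -> f y = g y) ->
  has_limit U x f -> has_limit U x g.
Proof.
move=> fg [l fl]; exists l; apply: (cvg_trans _ fl); apply: near_eq_cvg.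
by apply: filterS (withinT U (nbhs_filter x))  => y /= Uy; rewrite fg.
Qed.

Lemma CkL_ext k U S f g : open U -> (forall y, U y -> f y = g y) ->
  CkL k U S f -> CkL k U S g.
Proof.
move=> oU; have near_eq (f1 g1 : 'rV[R]_n -> R) x : (forall y, U y -> f1 y = g1 y) -> U x -> \forall y \near x, f1 y = g1 y.
  by move=> E Ux; apply: filterS (open_nbhs_nbhs (conj oU Ux)) => y; exact: E.
have cont_ext (f1 g1 : 'rV[R]_n -> R) x : (forall y, U y -> f1 y = g1 y) -> U x ->
    {for x, continuous f1} -> {for x, continuous g1}.
  move=> E Ux; rewrite /prop_for /continuous_at -(E x Ux) => H.
  apply: (cvg_trans _ H); apply: (@near_eq_cvg _ _ (nbhs x) (nbhs_filter x) f1 g1).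
  exact: (near_eq _ _ _ E Ux).
elim: k f g => [|k IH] f g fg.
  move=> H; apply: CkL0 => x.
    by move=> Ux; apply: (cont_ext _ _ _ fg Ux); exact: (CkL_cont H Ux).
  by move=> Sx; apply: (has_limit_ext fg _); exact: (CkL_lim H Sx).
move=> /CkLS[h1 h2 h3 h4]; apply/CkLS; split.
- by move=> x Ux; apply: (cont_ext _ _ _ fg Ux); exact: h1.
- by move=> x Sx; apply: (has_limit_ext fg _); exact: h2.
- by move=> x Ux i; exact: (near_eq_derivable (near_eq _ _ _ fg Ux) (h3 x Ux i)).
- move=> i; apply: (IH _ _ _ (h4 i)) => y Uy; apply: near_eq_derive; exact: (near_eq _ _ _ fg Uy).
Qed.

Lemma CkL_cst k U S (c : R) : CkL k U S (fun=> c).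
Proof.
elim: k c => [|k IH] c.
  by apply: CkL0 => x _; [exact: cst_continuous|exists c; exact: cvg_cst].
apply/CkLS; split=> x.
- by move=> _; exact: cst_continuous.
- by move=> _; exists c; exact: cvg_cst.
- by move=> _ i; exact: derivable_cst.
- rewrite (_ : 'D_(e_ x) _ = fun=> 0) //; apply/funext => y; exact: derive_cst.
Qed.

Lemma CkL_add k U S f g : open U -> CkL k U S f -> CkL k U S g ->
  CkL k U S (fun x => f x + g x).
Proof.
move=> oU; elim: k f g => [|k IH] f g Hf Hg.
  apply: CkL0 => x hx; first exact: (cvgD (CkL_cont Hf hx) (CkL_cont Hg hx)).
  have [l fl] := CkL_lim Hf hx; have [m gm] := CkL_lim Hg hx.
  by exists (l + m); apply: cvgD.
apply/CkLS; split=> [x Ux|x Sx|x Ux i|i].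
- exact: (cvgD (CkL_cont Hf Ux) (CkL_cont Hg Ux)).
- have [l fl] := CkL_lim Hf Sx; have [m gm] := CkL_lim Hg Sx.
  by exists (l + m); apply: cvgD.
- by apply: derivableD; [exact: (CkL_der Hf Ux)|exact: (CkL_der Hg Ux)].
- apply: (CkL_ext oU _ (IH _ _ (CkL_D i Hf) (CkL_D i Hg))) => y Uy.
  by rewrite deriveD //; [exact: (CkL_der Hf Uy)|exact: (CkL_der Hg Uy)].
Qed.

Lemma CkL_mul k U S f g : open U -> CkL k U S f -> CkL k U S g ->
  CkL k U S (fun x => f x * g x).
Proof.
move=> oU; elim: k f g => [|k IH] f g Hf Hg.
  apply: CkL0 => x hx; first exact: (cvgM (CkL_cont Hf hx) (CkL_cont Hg hx)).
  have [l fl] := CkL_lim Hf hx; have [m gm] := CkL_lim Hg hx.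
  by exists (l * m); apply: cvgM.
apply/CkLS; split=> [x Ux|x Sx|x Ux i|i].
- exact: (cvgM (CkL_cont Hf Ux) (CkL_cont Hg Ux)).
- have [l fl] := CkL_lim Hf Sx; have [m gm] := CkL_lim Hg Sx.
  by exists (l * m); apply: cvgM.
- by apply: derivableM; [exact: (CkL_der Hf Ux)|exact: (CkL_der Hg Ux)].
- have H1 := IH _ _ (CkLW (leqnSn k) Hf) (CkL_D i Hg).
  have H2 := IH _ _ (CkLW (leqnSn k) Hg) (CkL_D i Hf).
  apply: (CkL_ext oU _ (CkL_add oU H1 H2)) => y Uy.
  by rewrite deriveM //; [exact: (CkL_der Hf Uy)|exact: (CkL_der Hg Uy)].
Qed.

Lemma CkL_scale k U S (c : R) f : open U -> CkL k U S f -> CkL k U S (fun x => c * f x).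
Proof. by move=> oU H; apply: (CkL_mul oU _ H); exact: CkL_cst. Qed.

Lemma CkL_opp k U S f : open U -> CkL k U S f -> CkL k U S (fun x => - f x).
Proof.
move=> oU H; apply: (CkL_ext oU _ (CkL_scale (-1) oU H)) => y _; exact: mulN1r.
Qed.

Lemma CkL_sub k U S f g : open U -> CkL k U S f -> CkL k U S g ->
  CkL k U S (fun x => f x - g x).
Proof. by move=> oU Hf Hg; exact: (CkL_add oU Hf (CkL_opp oU Hg)). Qed.

Lemma CkL_sum k U S (I : Type) (r : seq I) (F : I -> 'rV[R]_n -> R) : open U ->
  (forall j, CkL k U S (F j)) -> CkL k U S (fun x => \sum_(j <- r) F j x).
Proof.
move=> oU H; elim: r => [|j r IH].
  by under eq_fun do rewrite big_nil; exact: CkL_cst.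
by under eq_fun do rewrite big_cons; exact: (CkL_add oU (H j) IH).
Qed.

(** [hs j] is the [j]-th derivative of the outer function. *)
Lemma CkL_comp k U S (hs : nat -> R -> R) f : open U ->
  (forall j (t : R), (j < k)%N -> is_derive t 1 (hs j) (hs j.+1 t)) ->
  continuous (hs k) ->
  CkL k U S f -> CkL k U S (fun x => hs 0 (f x)).
Proof.
move=> oU; elim: k hs f => [|k IH] hs f dh ch Hf.
  apply: CkL0 => x hx.
    by apply: continuous_comp; [exact: (CkL_cont Hf hx)|exact: ch].
  have [l fl] := CkL_lim Hf hx; exists (hs 0 l).
  exact: (cvg_comp _ _ fl (ch l)).
have c0 : continuous (hs 0%N).
  by move=> t; apply/differentiable_continuous/derivable1_diffP; have [] := dh 0 t isT.
have comp_d x v : derivable f x v -> is_derive x v (fun y => hs 0 (f y)) (hs 1 (f x) * 'D_v f x).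
  by move=> fd; apply: is_derive_comp1; [exact: derivableP|exact: dh].
apply/CkLS; split=> [x Ux|x Sx|x Ux i|i].
- by apply: continuous_comp; [exact: (CkL_cont Hf Ux)|exact: c0].
- by have [l fl] := CkL_lim Hf Sx; exists (hs 0 l); exact: (cvg_comp _ _ fl (c0 l)).
- by have [] := comp_d x (e_ i) (CkL_der Hf Ux).
- have H1 : CkL k U S (fun x => hs 1 (f x)).
    apply: (IH (fun j => hs j.+1)) => //; last exact: (CkLW _ Hf).
    by move=> j t jk; exact: dh.
  apply: (CkL_ext oU _ (CkL_mul oU H1 (CkL_D i Hf))) => y Uy.
  by have [_ ->] := comp_d y (e_ i) (CkL_der Hf Uy).
Qed.

Lemma CkL_dirE k U S f v x : open U -> CkL k.+1 U S f -> U x ->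
  is_derive x v f (\sum_i v 0 i * 'D_(e_ i) f x).
Proof.
by move=> oU /(CkLW (ltn0Sn k))/CkL_Ck H Ux; exact: (C1_derive v oU H Ux).
Qed.

Lemma CkL_Dv k U S f v : open U -> CkL k.+1 U S f -> CkL k U S ('D_v f).
Proof.
move=> oU H; have H1 : CkL k U S (fun x => \sum_i v 0 i * 'D_(e_ i) f x).
  by apply: CkL_sum => // i; apply: CkL_scale => //; exact: CkL_D.
by apply: (CkL_ext oU _ H1) => y Uy; have [_ ->] := CkL_dirE v oU H Uy.
Qed.

Lemma CkL_coord k U S (a : R) (i : 'I_n) : open U -> CkL k U S (fun x => x 0 i - a).
Proof.
move=> oU; have c0 x : (fun y : 'rV[R]_n => y 0 i - a) @ x --> x 0 i - a.
  exact: (cvgB (@coord_continuous _ 1 n 0 i x) (cvg_cst a)).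
have l0 x : has_limit U x (fun y : 'rV[R]_n => y 0 i - a).
  exists (x 0 i - a); apply: (cvg_trans _ (c0 x)).
  by apply: cvg_app; exact: cvg_within.
have dd x v : is_derive x v (fun y : 'rV[R]_n => y 0 i - a) (v 0 i).
  suff H : h^-1 *: ((h *: v + x) 0 i - a - (x 0 i - a)) @[h --> (0 : R)^'] --> v 0 i.
    by split; [apply/cvg_ex; exists (v 0 i) | apply: cvg_lim].
  apply: cvg_near_cst; near=> h.
  have h0 : h != 0 by near: h; exact: nbhs_dnbhs_neq.
  rewrite !mxE; have -> : h * v 0 i + x 0 i - a - (x 0 i - a) = h * v 0 i by ring.
  by rewrite [_ *: _]mulrA mulVf // mul1r.
case: k => [|k].
  by apply: CkL0 => x _; [exact: c0|exact: l0].
apply/CkLS; split.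
- by move=> x _; exact: c0.
- by move=> x _; exact: l0.
- by move=> x Ux j; have [] := dd x (e_ j).
- move=> j; apply: (CkL_ext oU _ (@CkL_cst k U S ((j == i)%:R))) => y _.
  by have [_ ->] := dd y (e_ j); rewrite mxE eqxx eq_sym.
Unshelve. all: by end_near. Qed.

End CkL.

(** * Second derivatives *)

Section SecondOrder.
Variables (R : realType) (n : nat).
Implicit Types (f g : 'rV[R]_n -> R) (x v w : 'rV[R]_n) (U S : set 'rV[R]_n) (i : 'I_n) (s : seq 'I_n).

Lemma dist_half (a b c e : R) : `|a - c| <= e / 2 -> `|b - c| <= e / 2 -> `|a - b| <= e.
Proof.
move=> ac bc; rewrite [leRHS]splitr; apply: le_trans (lerD ac bc).
by rewrite (distrC b); apply: le_trans (ler_normD _ _); rewrite addrA subrK.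
Qed.

Lemma near_dist x (P : set 'rV[R]_n) : (\forall y \near x, P y) ->
  exists2 d, 0 < d & forall y, `|y - x| < d -> P y.
Proof.
move=> /nbhs_ballP[d /= d0 H]; exists d => // y yx.
by apply: H; rewrite -ball_normE /ball_ /= distrC.
Qed.

Lemma CkL_derivable k U S f v x : open U -> CkL k.+1 U S f -> U x -> derivable f x v.
Proof. by move=> oU H Ux; have [] := CkL_dirE v oU H Ux. Qed.

Lemma CkL_is_derive k U S f v x : open U -> CkL k.+1 U S f -> U x ->
  is_derive x v f ('D_v f x).
Proof.
move=> oU H Ux; have D := CkL_derivable oU H Ux; split; first exact: D.
by [].
Qed.

Lemma CkL_DvE k U S f v x : open U -> CkL k.+1 U S f -> U x ->
  'D_v f x = \sum_i v 0 i * 'D_(delta_mx 0 i) f x.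
Proof. by move=> oU H Ux; have [_ ->] := CkL_dirE v oU H Ux. Qed.

Lemma CkL_DvZ k U S f v x (c : R) : open U -> CkL k.+1 U S f -> U x ->
  'D_(c *: v) f x = c * 'D_v f x.
Proof.
move=> oU H Ux; have [_ ->] := is_derive_dirZ c (CkL_is_derive v oU H Ux).
by [].
Qed.

(** The mean value theorem applied in one direction, then in the other. *)
Lemma second_difference U S f x v w : open U -> CkL 2 U S f ->
  (forall a b : R, 0 <= a <= 1 -> 0 <= b <= 1 -> U (x + a *: v + b *: w)) ->
  exists a b, [/\ 0 <= a <= 1, 0 <= b <= 1 &
   f (x + v + w) - f (x + v) - f (x + w) + f x = 'D_w ('D_v f) (x + a *: v + b *: w)].
Proof.
move=> oU Hf Uab.
pose phi (a : R) := f (x + w + a *: v) - f (x + a *: v).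
have z01 : 0 <= (0 : R) <= 1 by rewrite lexx ler01.
have o01 : 0 <= (1 : R) <= 1 by rewrite lexx ler01.
have dphi (a : R) : 0 <= a <= 1 -> is_derive a 1 phi ('D_v f (x + w + a *: v) - 'D_v f (x + a *: v)).
  move=> a01; apply: is_deriveB; apply: derive_line.
    by apply: (CkL_derivable oU Hf); have := Uab a 1 a01 o01; rewrite scale1r addrAC.
  by apply: (CkL_derivable oU Hf); have := Uab a 0 a01 z01; rewrite scale0r addr0.
have [a|a|a] := @MVT R phi (fun a => 'D_v f (x + w + a *: v) - 'D_v f (x + a *: v)) 0 1 ltr01.
- by rewrite in_itv /= => /andP[a0 a1]; apply: dphi; rewrite !ltW.
- apply: derivable_within_continuous => b; rewrite in_itv /= => b01.
  by have [] := dphi b b01.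
rewrite in_itv /= => /andP[a0 a1]; rewrite /phi !scale1r !scale0r !addr0 subr0 mulr1 => E.
have a01 : 0 <= a <= 1 by rewrite !ltW.
have [b b01|b b01 E2] := @MVT_line _ _ ('D_v f) (x + a *: v) w.
  apply: (CkL_derivable oU (CkL_Dv v oU Hf)); exact: Uab.
have {}b01 : 0 <= b <= 1 by move/andP: b01 => [? ?]; rewrite !ltW.
exists a, b; split=> //; rewrite -E2 [x + a *: v + w]addrAC -E [x + v + w]addrAC; ring.
Qed.

(** Both mixed derivatives are limits of the same second difference, which is
    symmetric in the two directions. *)
Lemma clairaut U S f x v w : open U -> CkL 2 U S f -> U x ->
  'D_v ('D_w f) x = 'D_w ('D_v f) x.
Proof.
move=> oU Hf Ux.
have cvw : CkL 0 U S ('D_v ('D_w f)) by apply: CkL_Dv => //; exact: CkL_Dv.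
have cwv : CkL 0 U S ('D_w ('D_v f)) by apply: CkL_Dv => //; exact: CkL_Dv.
apply/eqP; rewrite -subr_eq0 -normr_le0; apply/ler_addgt0Pr => e e0; rewrite add0r.
have [d d0 Hd] : exists2 d, 0 < d & forall y, `|y - x| < d -> [/\ U y,
   `|'D_v ('D_w f) x - 'D_v ('D_w f) y| <= e / 2 &
   `|'D_w ('D_v f) x - 'D_w ('D_v f) y| <= e / 2].
  have e2 : 0 < e / 2 by rewrite divr_gt0.
  have [d1 d10 H1] := near_dist (open_nbhs_nbhs (conj oU Ux)).
  have [d2 d20 H2] := near_dist ((cvgrPdist_le _ _).1 (CkL_cont cvw Ux) _ e2).
  have [d3 d30 H3] := near_dist ((cvgrPdist_le _ _).1 (CkL_cont cwv Ux) _ e2).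
  exists (Num.min d1 (Num.min d2 d3)); first by rewrite !lt_min d10 d20 d30.
  by move=> y; rewrite !lt_min => /andP[h1 /andP[h2 h3]]; split; [exact: H1|exact: H2|exact: H3].
pose N := `|v| + `|w| + 1.
have N0 : 0 < N by rewrite ltr_wpDl // addr_ge0.
have [t [t0 tN]] : exists t : R, 0 < t /\ t * N = d / 2.
  exists (d / N / 2); split; first by rewrite !divr_gt0.
  by field; rewrite gt_eqF.
have near_x a b : 0 <= a <= 1 -> 0 <= b <= 1 ->
    `|x + a *: (t *: v) + b *: (t *: w) - x| < d.
  move=> /andP[a0 a1] /andP[b0 b1]; rewrite -(addrA x) addrAC subrr add0r.
  apply: (@le_lt_trans _ _ (t * N)).
    apply: le_trans (ler_normD _ _) _; rewrite (normrZ a) (normrZ b) (normrZ t v) (normrZ t w) (ger0_norm a0) (ger0_norm b0) (gtr0_norm t0).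
    have h1 : a * (t * `|v|) <= t * `|v| by rewrite ler_piMl // mulr_ge0 // ltW.
    have h2 : b * (t * `|w|) <= t * `|w| by rewrite ler_piMl // mulr_ge0 // ltW.
    by apply: (le_trans (lerD h1 h2)); rewrite -mulrDr ler_wpM2l ?(ltW t0) // lerDl ler01.
  by rewrite tN ltr_pdivrMr // ltr_pMr // ltr1n.
have [a [b [a01 b01 E1]]] := @second_difference U S f x (t *: v) (t *: w) oU Hf
   (fun a b ha hb => let: And3 h _ _ := Hd _ (near_x a b ha hb) in h).
have near_x' a' b' : 0 <= a' <= 1 -> 0 <= b' <= 1 ->
    `|x + a' *: (t *: w) + b' *: (t *: v) - x| < d.
  by move=> ha hb; rewrite (addrAC x); apply: near_x.
have [a' [b' [a'01 b'01 E2]]] := @second_difference U S f x (t *: w) (t *: v) oU Hf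
   (fun a b ha hb => let: And3 h _ _ := Hd _ (near_x' a b ha hb) in h).
have E : 'D_(t *: w) ('D_(t *: v) f) (x + a *: (t *: v) + b *: (t *: w)) =
         'D_(t *: v) ('D_(t *: w) f) (x + a' *: (t *: w) + b' *: (t *: v)).
  by rewrite -E1 -E2 [x + t *: v + _]addrAC; ring.
have scl v' w' y : U y -> 'D_(t *: w') ('D_(t *: v') f) y = t * (t * 'D_w' ('D_v' f) y).
  move=> Uy; rewrite (CkL_DvZ w' t oU (CkL_Dv (t *: v') oU Hf) Uy); congr (_ * _).
  have -> : 'D_w' ('D_(t *: v') f) y = 'D_w' (fun z => t * 'D_v' f z) y.
    apply: near_eq_derive; apply: filterS (open_nbhs_nbhs (conj oU Uy)) => z Uz.
    exact: (CkL_DvZ v' t oU Hf Uz).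
  have H := CkL_is_derive w' oU (CkL_Dv v' oU Hf) Uy.
  have [_ ->] := @is_deriveZ _ _ _ ('D_v' f) t y w' _ H.
  by [].
have [Uy _ Hy] := Hd _ (near_x a b a01 b01).
have [Uz Hz _] := Hd _ (near_x' a' b' a'01 b'01).
have tn0 := lt0r_neq0 t0.
have {}E := mulfI tn0 (mulfI tn0 (etrans (etrans (esym (scl _ _ _ Uy)) E) (scl _ _ _ Uz))).
move: Hz; rewrite -E => Hz.
exact: (dist_half Hz Hy).
Qed.

Lemma second_derivative_max1 (phi dphi : R -> R) (a d : R) : 0 < d ->
  (forall t : R, `|t| < d -> is_derive t 1 phi (dphi t)) ->
  is_derive (0 : R) 1 dphi a ->
  (forall t, `|t| < d -> phi t <= phi 0) -> dphi 0 = 0 /\ a <= 0.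
Proof.
move=> d0 dp ddp pm.
have itvE (t : R) : t \in `]-d, d[%R -> `|t| < d by rewrite in_itv /= ltr_norml.
have z0 : dphi 0 = 0.
  have h0 : `|0 : R| < d by rewrite normr0.
  have [_ <-] := dp 0 h0.
  have [_ ->//] := @derive1_at_max R phi (- d) d 0 (ltac:(lra))
    (fun t ht => let: DeriveDef h _ := dp t (itvE t ht) in h)
    (ltac:(by rewrite in_itv /= oppr_lt0 d0)) (fun t ht => pm t (itvE t ht)).
split=> //; rewrite leNgt; apply/negP => a0.
have [dd dE] := ddp.
have : h^-1 *: (dphi (h *: 1 + 0) - dphi 0) @[h --> 0^'] --> a by rewrite -dE; exact: dd.
have a2 : 0 < a / 2 by rewrite divr_gt0.
move=> /cvgrPdist_le/(_ _ a2)[r /= r0 Hr].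
pose t := Num.min r d / 2.
have m0 : 0 < Num.min r d by rewrite lt_min r0 d0.
have t0 : 0 < t by rewrite divr_gt0.
have tm : t < Num.min r d by rewrite /t ltr_pdivrMr // ltr_pMr // ltr1n.
have [tr td] : t < r /\ t < d by move: tm; rewrite lt_min => /andP.
have pos (c : R) : 0 < c -> c <= t -> 0 < dphi c.
  move=> c0 ct; have := Hr c; rewrite /= sub0r normrN (gtr0_norm c0) => /(_ (le_lt_trans ct tr) (lt0r_neq0 c0)).
  rewrite z0 subr0 addr0 [c *: 1]mulr1 ler_distl => /andP[_ h].
  have : 0 < c^-1 * dphi c 
    by apply: (lt_le_trans a2); rewrite -(lerD2r (a / 2)) -splitr; exact: h.
  by rewrite pmulr_rgt0 ?invr_gt0.
have [c|c|c] := @MVT R phi dphi 0 t t0.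
- by rewrite in_itv /= => /andP[c0 ct]; apply: dp; rewrite gtr0_norm // (lt_trans ct td).
- apply: derivable_within_continuous => b; rewrite in_itv /= => /andP[b0 bt].
  by have [] := dp b (ltac:(rewrite ger0_norm //; exact: le_lt_trans bt td)).
rewrite in_itv /= subr0 => /andP[c0 ct] E.
have := pm t; rewrite gtr0_norm // => /(_ td); rewrite -subr_le0 E.
by rewrite leNgt mulr_gt0 // pos // ltW.
Qed.

Lemma second_derivative_max U S f x v : open U -> CkL 2 U S f -> U x ->
  (\forall y \near x, f y <= f x) ->
  'D_v f x = 0 /\ 'D_v ('D_v f) x <= 0.
Proof.
move=> oU Hf Ux mx.
have [d d0 Hd] : exists2 d, 0 < d & forall y, `|y - x| < d -> U y /\ f y <= f x.
  have : \forall y \near x, U y /\ f y <= f x.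
    by apply: filterI => //; exact: open_nbhs_nbhs.
  move=> /nbhs_ballP[d /= d0 H]; exists d => // y yx.
  by apply: H; rewrite -ball_normE /ball_ /= distrC.
have N0 : 0 < `|v| + 1 by rewrite ltr_wpDl.
have Hl (t : R) : `|t| < d / (`|v| + 1) -> `|(x + t *: v) - x| < d.
  rewrite ltr_pdivlMr // => ht; rewrite addrAC subrr add0r normrZ.
  by apply: le_lt_trans ht; rewrite ler_wpM2l // lerDl.
have := @second_derivative_max1 (fun t => f (x + t *: v)) (fun t => 'D_v f (x + t *: v))
  ('D_v ('D_v f) x) (d / (`|v| + 1)).
rewrite scale0r addr0; apply.
- by rewrite divr_gt0.
- move=> t ht; apply: derive_line; apply: (CkL_derivable oU Hf).
  by have [] := Hd _ (Hl t ht).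
- apply: (@is_derive_line _ _ ('D_v f) x v 0); rewrite scale0r addr0.
  exact: (CkL_is_derive v oU (CkL_Dv v oU Hf) Ux).
- by move=> t ht; have [] := Hd _ (Hl t ht).
Qed.

Lemma CkL_near U x P : open U -> U x -> (forall y, U y -> P y) -> \forall y \near (x : 'rV[R]_n), P y.
Proof. by move=> oU Ux H; apply: filterS (open_nbhs_nbhs (conj oU Ux)) => y; exact: H. Qed.

Lemma derive_eq_on U f g x v : open U -> U x -> (forall y, U y -> f y = g y) ->
  'D_v f x = 'D_v g x.
Proof. by move=> oU Ux fg; apply: near_eq_derive; exact: (CkL_near oU Ux fg). Qed.

Lemma derive_addE U S k f g x v : open U -> CkL k.+1 U S f -> CkL k.+1 U S g -> U x ->
  'D_v (fun y => f y + g y) x = 'D_v f x + 'D_v g x.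
Proof.
by move=> oU Hf Hg Ux; rewrite deriveD //; [exact: (CkL_derivable oU Hf)|exact: (CkL_derivable oU Hg)].
Qed.

Lemma derive_mulE U S k f g x v : open U -> CkL k.+1 U S f -> CkL k.+1 U S g -> U x ->
  'D_v (fun y => f y * g y) x = f x * 'D_v g x + g x * 'D_v f x.
Proof.
by move=> oU Hf Hg Ux; rewrite deriveM //; [exact: (CkL_derivable oU Hf)|exact: (CkL_derivable oU Hg)].
Qed.

Lemma derive_sumE U S k (I : Type) (r : seq I) (F : I -> 'rV[R]_n -> R) x v : open U ->
  (forall j, CkL k.+1 U S (F j)) -> U x ->
  'D_v (fun y => \sum_(j <- r) F j y) x = \sum_(j <- r) 'D_v (F j) x.
Proof.
move=> oU HF Ux; elim: r => [|j r IH].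
  by rewrite big_nil; under eq_fun do rewrite big_nil; exact: derive_cst.
rewrite big_cons; under eq_fun do rewrite big_cons.
by rewrite (derive_addE v oU (HF j) (CkL_sum r oU HF) Ux) IH.
Qed.

Lemma derive_compE U S k (h dh : R -> R) f x v : open U -> CkL k.+1 U S f -> U x ->
  is_derive (f x) 1 h (dh (f x)) ->
  'D_v (fun y => h (f y)) x = dh (f x) * 'D_v f x.
Proof.
move=> oU Hf Ux hd.
by have [_ ->] := is_derive_comp1 (CkL_is_derive v oU Hf Ux) hd.
Qed.

Lemma derive_cstmE U S k (c : R) f x v : open U -> CkL k.+1 U S f -> U x ->
  'D_v (fun y => c * f y) x = c * 'D_v f x.
Proof.
move=> oU Hf Ux.
by have [_ ->] := @is_deriveZ _ _ _ f c x v _ (CkL_is_derive v oU Hf Ux).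
Qed.

End SecondOrder.

(** * Derivatives of the symmetric functions of a matrix *)

Section DetDerivative.
Variables (R : realType) (n : nat).
Implicit Types (x v : 'rV[R]_n).

Lemma is_derive_bigsum (I : Type) (r : seq I) (f : I -> 'rV[R]_n -> R) (df : I -> R) x v :
  (forall i, is_derive x v (f i) (df i)) ->
  is_derive x v (fun y => \sum_(i <- r) f i y) (\sum_(i <- r) df i).
Proof.
move=> H; elim: r => [|i r IH].
  by rewrite big_nil; under eq_fun do rewrite big_nil; exact: is_derive_cst.
rewrite big_cons; under eq_fun do rewrite big_cons.
exact: is_deriveD.
Qed.

Lemma is_derive_bigprod (I : eqType) (r : seq I) (f : I -> 'rV[R]_n -> R) (df : I -> R) x v :
  uniq r -> (forall i, is_derive x v (f i) (df i)) ->
  is_derive x v (fun y => \prod_(i <- r) f i y)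
    (\sum_(i <- r) df i * \prod_(j <- r | j != i) f j x).
Proof.
move=> + H; elim: r => [_|i r IH] /=.
  by rewrite big_nil; under eq_fun do rewrite big_nil; exact: is_derive_cst.
move=> /andP[ir ur]; under eq_fun do rewrite big_cons.
have D := is_deriveM (H i) (IH ur).
apply: (is_derive_eq D).
rewrite big_cons /= big_cons eqxx /= addrC; congr (_ + _).
  rewrite [LHS]mulrC; congr (_ * _); rewrite big_seq_cond [RHS]big_seq_cond; apply: eq_bigl => j.
  case jr: (j \in r); rewrite ?andbF //= ?andbT.
  by symmetry; apply: contraNneq ir => ji; rewrite -ji.
rewrite -[LHS]/(f i x * _) mulr_sumr; apply: eq_big_seq => j jr.
rewrite big_cons eq_sym; have -> : j != i.
  by apply: contraNneq ir => <-.
by rewrite mulrCA.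
Qed.

Lemma is_derive_det_diag (N : 'rV[R]_n -> 'M[R]_n) (dN : 'M[R]_n) x v :
  (forall i j, is_derive x v (fun y => N y i j) (dN i j)) ->
  (forall i j, i != j -> N x i j = 0) ->
  is_derive x v (fun y => \det (N y)) (\sum_i dN i i * \prod_(j | j != i) N x j j).
Proof.
move=> dNP diag.
have D : is_derive x v (fun y => \det (N y)) (\sum_(s : 'S_n) (-1) ^+ s *
   (\sum_i dN i (s i) * \prod_(j | j != i) N x j (s j))).
  apply: is_derive_bigsum => s.
  have P : is_derive x v (fun y => \prod_i N y i (s i)) (\sum_i dN i (s i) * \prod_(j | j != i) N x j (s j)).
    by apply: (@is_derive_bigprod _ _ (fun i y => N y i (s i)) _ x v (index_enum_uniq _)) => i; exact: dNP.
  exact: (@is_deriveZ _ _ _ (fun y => \prod_i N y i (s i)) ((-1) ^+ s) x v _ P).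
apply: (is_derive_eq D); rewrite (bigD1 1%g) //= odd_perm1 expr0 mul1r.
rewrite [X in _ + X]big1 ?addr0 => [|s s1].
  apply: eq_bigr => i _; rewrite perm1; congr (_ * _).
  by apply: eq_bigr => j _; rewrite perm1.
rewrite big1 ?mulr0 // => i _.
(* a non-trivial permutation moves at least two points, so that after
   differentiating one factor an off-diagonal entry remains *)
have [j ji sj] : exists2 j, j != i & s j != j.
  case: (eqVneq (s i) i) => [si|si].
    have [j sj] : exists j, s j != j.
      apply/existsP; apply: contraR s1 => /existsPn H; apply/eqP/permP => j.
      by rewrite perm1; apply/eqP; have := H j; rewrite negbK.
    by exists j => //; apply: contraNneq sj => ->; rewrite si.
  by exists (s i) => //; rewrite (inj_eq perm_inj).
by rewrite (bigD1 j ji) /= (diag j (s j)) ?mul0r ?mulr0 // eq_sym.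
Qed.

(** Inversion of a Vandermonde matrix: differentiability of all the values of a
    family of polynomials passes to its coefficients. *)
Lemma coef_from_values (m : nat) : exists a : 'I_m -> 'I_m -> R,
  forall c : 'I_m -> R, forall j, c j = \sum_t a t j * (\sum_(l < m) c l * (t%:R : R) ^+ l).
Proof.
pose V := @Vandermonde R m m (\row_(t < m) (t%:R : R)).
have Vu : V \in unitmx.
  rewrite unitmxE det_Vandermonde unitfE; apply/prodf_neq0 => i _; apply/prodf_neq0 => j ij.
  by rewrite !mxE subr_eq0 eqr_nat gtn_eqF.
exists (fun t j => invmx V t j) => c j.
have := congr1 (fun M : 'rV[R]_m => M 0 j) (mulmxK Vu (\row_l c l)).
rewrite !mxE => {1}<-; apply: eq_bigr => t _; rewrite mulrC; congr (_ * _).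
by rewrite mxE; apply: eq_bigr => l _; rewrite !mxE.
Qed.

Lemma poly_eq_values (p q : {poly R}) : (forall t : R, p.[t] = q.[t]) -> p = q.
Proof.
move=> pq; apply/eqP; rewrite -subr_eq0; apply/negPn/negP => pq0.
pose r := [seq (i%:R : R) | i <- iota 0 (size (p - q)%R)].
have := @max_poly_roots _ (p - q) r pq0.
have -> : all (root (p - q)) r.
  by apply/allP => t _; rewrite rootE hornerD hornerN pq subrr.
have -> : uniq r.
  by rewrite map_inj_uniq ?iota_uniq // => a b /eqP; rewrite eqr_nat => /eqP.
by rewrite /r size_map size_iota ltnn => /(_ isT isT).
Qed.

Variables (U : set 'rV[R]_n) (oU : open U).

(** At a point where [M] is diagonal only the diagonal entries of its derivative
    contribute to the derivative of the determinant; comparing coefficients in [t]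
    gives the derivative of each symmetric function. *)
Lemma is_derive_char_coef m (c : 'I_m.+1 -> 'rV[R]_n -> R) (M : 'rV[R]_n -> 'M[R]_n)
    (dM : 'M[R]_n) (d : 'rV[R]_n) x v : U x -> (n <= m)%N ->
  (forall y, U y -> forall t, \det (1%:M + t *: M y) = \sum_(j < m.+1) c j y * t ^+ j) ->
  (forall i j, is_derive x v (fun y => M y i j) (dM i j)) ->
  M x = diag_mx d ->
  forall j, is_derive x v (c j)
    (\sum_i dM i i * esymp (fun i => d 0 i) ([set: 'I_n] :\ i) j).
Proof.
move=> Ux nm cE dMP Mx.
have dval (t : R) : is_derive x v (fun y => \sum_(j < m.+1) c j y * t ^+ j)
   (\sum_i dM i i * ('X * genpoly (fun i => d 0 i) ([set: 'I_n] :\ i)).[t]).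
  have D : is_derive x v (fun y => \det (1%:M + t *: M y))
     (\sum_i (t * dM i i) * \prod_(j | j != i) (1 + t * d 0 j)).
    have d1 i j : is_derive x v (fun y => (1%:M + t *: M y) i j) ((t *: dM) i j).
      have -> : (fun y => (1%:M + t *: M y) i j) = (fun y => (1%:M : 'M[R]_n) i j + t * M y i j).
        by apply/funext => y; rewrite !mxE.
      have -> : (t *: dM) i j = 0 + t * dM i j by rewrite mxE add0r.
      by apply: is_deriveD.
    have d2 i j : i != j -> (1%:M + t *: M x) i j = 0.
      by move=> ij; rewrite Mx !mxE (negbTE ij) !mulr0n mulr0 addr0.
    apply: (is_derive_eq (is_derive_det_diag d1 d2)).
    apply: eq_bigr => i _; rewrite [(t *: dM) i i]mxE; congr (_ * _); apply: eq_bigr => j _.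
    by rewrite Mx !mxE eqxx !mulr1n.
  have -> : \sum_i dM i i * ('X * genpoly (fun i => d 0 i) ([set: 'I_n] :\ i)).[t] =
      \sum_i (t * dM i i) * \prod_(j | j != i) (1 + t * d 0 j).
    apply: eq_bigr => i _; rewrite hornerM hornerX mulrA [dM i i * t]mulrC; congr (_ * _).
    rewrite /genpoly horner_prod; apply: eq_big => [j|j _]; first by rewrite !inE andbT.
    by rewrite !hornerE mulrC.
  apply: near_eq_is_derive D; apply: CkL_near oU Ux _ => y Uy; exact: cE.
have [a Ha] := coef_from_values m.+1.
have dc j : is_derive x v (c j) (\sum_t a t j * (\sum_i dM i i * ('X * genpoly (fun i => d 0 i) ([set: 'I_n] :\ i)).[(t : nat)%:R])).
  have -> : c j = fun y => \sum_t a t j * (\sum_(l < m.+1) c l y * (t%:R : R) ^+ l).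
    by apply/funext => y; exact: (Ha (fun l => c l y)).
  by apply: is_derive_bigsum.
pose dcv (j : 'I_m.+1) := \sum_t a t j * (\sum_i dM i i * ('X * genpoly (fun i => d 0 i) ([set: 'I_n] :\ i)).[(t : nat)%:R]).
have {}dc j : is_derive x v (c j) (dcv j) by exact: dc.
have E : \poly_(j < m.+1) dcv (inord j) = \sum_i dM i i *: ('X * genpoly (fun i => d 0 i) ([set: 'I_n] :\ i)).
  apply: poly_eq_values => t; rewrite horner_poly horner_sum.
  have D2 : is_derive x v (fun y => \sum_(j < m.+1) c j y * t ^+ j) (\sum_(j < m.+1) dcv j * t ^+ j).
    apply: is_derive_bigsum => j.
    have -> : (fun y => c j y * t ^+ j) = (fun y => t ^+ j * c j y) by apply/funext => y; rewrite mulrC.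
    rewrite [dcv j * _]mulrC.
    exact: (@is_deriveZ _ _ _ (c j) (t ^+ j) x v _ (dc j)).
  transitivity (\sum_(j < m.+1) dcv j * t ^+ j).
    by apply: eq_bigr => j _; rewrite inord_val.
  have [_ <-] := D2; have [_ ->] := dval t.
  by apply: eq_bigr => i _; rewrite hornerZ.
move=> j; have -> : \sum_i dM i i * esymp (fun i => d 0 i) ([set: 'I_n] :\ i) j = dcv j; last exact: dc.
have := congr1 (fun p : {poly R} => p`_j) E.
rewrite /= coef_poly ltn_ord inord_val coef_sum => ->.
by apply: eq_bigr => i _; rewrite coefZ.
Qed.

End DetDerivative.

Section Sigma.
Variable R : realType.

Lemma sigma_esym n j (lam : 'rV[R]_n) : sigma j lam = esymf (fun i => lam 0 i) [set: 'I_n] j.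
Proof.
have E : genpoly (fun i => lam 0 i) [set: 'I_n] =
    \prod_i \sum_(b : bool) (if b then lam 0 i *: 'X else 1 : {poly R}).
  apply: eq_big => [i|i _]; first by rewrite inE.
  by rewrite big_bool addrC.
rewrite /esymf E /sigma bigA_distr_bigA /=.
rewrite (reindex (fun A : {set 'I_n} => [ffun i => i \in A])) /=; last first.
  exists (fun f : {ffun 'I_n -> bool} => finset (fun i => f i)).
    by move=> A _; apply/setP => i; rewrite inE ffunE.
  by move=> f _; apply/ffunP => i; rewrite ffunE inE.
rewrite coef_sum [RHS](eq_bigr (fun A : {set 'I_n} => (\prod_(i in A) lam 0 i) * (j == #|A|)%:R)); last first.
  move=> A _.
  rewrite (_ : \prod_i _ = (\prod_(i in A) lam 0 i) *: 'X^#|A|); first by rewrite coefZ coefXn.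
    rewrite (eq_bigr (fun i => if i \in A then lam 0 i *: 'X else 1)); last first.
      by move=> i _; rewrite ffunE.
  by rewrite -big_mkcond /= scaler_prod prodr_const.
rewrite big_mkcond /=; apply: eq_bigr => A _; rewrite eq_sym.
by case: (_ == _); rewrite ?mulr1 ?mulr0.
Qed.

(** The default value 0 of [eigenvals] has vanishing symmetric functions of
    positive order, so a non-zero value certifies that the eigenvalues exist. *)
Lemma eigenvalsP n (A : 'M[R]_n) (j : nat) : (0 < j)%N -> sigma_mx j A != 0 ->
  char_poly A = \prod_i ('X - (eigenvals A 0 i)%:P).
Proof.
move=> j0; rewrite /sigma_mx /eigenvals; case: xgetP => [lam _ //|_].
rewrite sigma_esym => /negP[]; apply/eqP.
rewrite /esymf /genpoly big1 ?coefC; first by case: j j0.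
by move=> i _; rewrite mxE scale0r addr0.
Qed.

Lemma esym_perm n (a b : 'I_n -> R) j :
  \prod_i ('X - (a i)%:P) = \prod_i ('X - (b i)%:P) ->
  esymf a [set: 'I_n] j = esymf b [set: 'I_n] j.
Proof.
move=> E; have : perm_eq [seq a i | i <- enum 'I_n] [seq b i | i <- enum 'I_n].
  apply: prod_XsubC_eq; rewrite big_map [in RHS]big_map.
  by rewrite !big_enum /=.
have G (c : 'I_n -> R) : genpoly c [set: 'I_n] = \prod_(t <- [seq c i | i <- enum 'I_n]) (1 + t *: 'X).
  by rewrite big_map big_enum /genpoly; apply: eq_bigl => i; rewrite inE.
by rewrite /esymf !G => /(perm_big _) ->.
Qed.

Lemma det_1_eigen n (A : 'M[R]_n) t : char_poly A = \prod_i ('X - (eigenvals A 0 i)%:P) ->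
  \det (1%:M + t *: A) = \sum_(j < n.+1) sigma_mx j A * t ^+ j.
Proof.
move=> E; rewrite (@det_1_scale _ _ _ [seq eigenvals A 0 i | i <- enum 'I_n]).
  rewrite big_map big_enum /=.
  have -> : \prod_i (1 + t * eigenvals A 0 i) = (genpoly (fun i => eigenvals A 0 i) [set: 'I_n]).[t].
    rewrite /genpoly horner_prod; apply: eq_big => [i|i _]; first by rewrite inE.
    by rewrite !hornerE mulrC.
  rewrite (@horner_coef_wide _ n.+1); last first.
    apply/leq_sizeP => j nj; rewrite -/(esymf _ _ j) esym_gt_card // cardsT card_ord.
    exact: nj.
  by apply: eq_bigr => j _; rewrite /sigma_mx sigma_esym.
by rewrite E big_map big_enum.
Qed.

End Sigma.

(** * The linearised equation *)

Section Linearize.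
Variables (R : realType) (n k l : nat) (U : set 'rV[R]_n) (u f : 'rV[R]_n -> R) (x : 'rV[R]_n).
Hypotheses (lk : (l < k)%N) (kn : (k <= n)%N) (oU : open U) (Hu : CkL 3 U set0 u)
  (adm : admissible k U u)
  (eqn : forall y, U y -> sigma_mx k (hess u y) / sigma_mx l (hess u y) = f y) (Ux : U x).

Let Hu2 : CkL 2 U set0 u. Proof. exact: (CkLW _ Hu). Qed.

Lemma hess_sym y : U y -> (hess u y)^T = hess u y.
Proof. by move=> Uy; apply/matrixP => i j; rewrite !mxE /=; exact: (clairaut _ _ oU Hu2 Uy). Qed.

Lemma hess_dir (v w : 'rV[R]_n) y : U y ->
  'D_v ('D_w u) y = \sum_i \sum_j v 0 i * hess u y i j * w 0 j.
Proof.
move=> Uy; rewrite (CkL_DvE v oU (CkL_Dv w oU Hu2) Uy); apply: eq_bigr => i _.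
have H1 j : CkL 1 U set0 ('D_(delta_mx 0 j) u) by exact: CkL_Dv.
have -> : 'D_(delta_mx 0 i) ('D_w u) y = 'D_(delta_mx 0 i) (fun z => \sum_j w 0 j * 'D_(delta_mx 0 j) u z) y.
  by apply: (derive_eq_on _ oU Uy) => z Uz; exact: (CkL_DvE w oU Hu2 Uz).
have H2 j : CkL 1 U set0 (fun z => w 0 j * 'D_(delta_mx 0 j) u z) := CkL_scale _ oU (H1 j).
rewrite (derive_sumE _ _ oU H2 Uy).
rewrite mulr_sumr; apply: eq_bigr => j _.
by rewrite (derive_cstmE _ _ oU (H1 j) Uy) mxE /=; ring.
Qed.

Let k0 : (0 < k)%N. Proof. by apply: leq_ltn_trans lk. Qed.

Let splitU y : U y -> char_poly (hess u y) = \prod_i ('X - (eigenvals (hess u y) 0 i)%:P).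
Proof.
move=> Uy; apply: (eigenvalsP (ltn0Sn 0)); rewrite gt_eqF //.
by apply: (adm Uy); rewrite k0.
Qed.

(** Conjugating by the fixed eigenbasis at [x] diagonalises the Hessian at [x] and
    does not change its symmetric functions at any point; differentiating them at
    [x] only involves the diagonal entries [D_a D_a u]. *)
Lemma linearized_equation : exists (e : 'I_n -> 'rV[R]_n) (d : 'I_n -> R),
  [/\ (forall v : 'rV[R]_n, \sum_a (\sum_i v 0 i * e a 0 i) ^+ 2 = \sum_i v 0 i ^+ 2) /\
      (forall a, \sum_i e a 0 i ^+ 2 = 1),
      forall v, 'D_v ('D_v u) x = \sum_a (\sum_i v 0 i * e a 0 i) ^+ 2 * d a,
      forall a, 'D_(e a) ('D_(e a) u) x = d a,
      gam d [set: 'I_n] k /\ f x = esymf d [set: 'I_n] k / esymf d [set: 'I_n] l &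
      forall z, 'D_z f x = \sum_a lin_coef d k l a * 'D_z ('D_(e a) ('D_(e a) u)) x].
Proof.
have [P [d [PP PP' PD]]] := @sym_diagonalize R n (hess u x)
  [seq eigenvals (hess u x) 0 i | i <- enum 'I_n] (hess_sym Ux)
  (ltac:(by rewrite big_map big_enum /= splitU)).
have cd j : sigma_mx j (hess u x) = esymf (fun i => d 0 i) [set: 'I_n] j.
  rewrite /sigma_mx sigma_esym; apply: esym_perm; rewrite -splitU //.
  rewrite -(char_poly_conj (hess u x) PP) PD char_poly_trig ?diag_mx_is_trig //.
  by apply: eq_bigr => i _; rewrite mxE eqxx mulr1n.
pose e a := row a P.
pose M y := P *m hess u y *m P^T.
have ME y a b : U y -> M y a b = 'D_(e a) ('D_(e b) u) y.
  move=> Uy; rewrite hess_dir // exchange_big /= mxE; apply: eq_bigr => j _.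
  by rewrite !mxE mulr_suml; apply: eq_bigr => i _; rewrite !mxE.
have der z j : (j <= n)%N -> is_derive x z (fun y => sigma_mx j (hess u y))
   (\sum_a 'D_z ('D_(e a) ('D_(e a) u)) x * esymp (fun i => d 0 i) ([set: 'I_n] :\ a) j).
  move=> jn.
  have H := @is_derive_char_coef R n U oU n (fun j y => sigma_mx j (hess u y)) M
    (\matrix_(a, b) 'D_z ('D_(e a) ('D_(e b) u)) x) d x z Ux (leqnn n) _ _ PD.
  have {}H := H _ _ (inord j); rewrite inordK // in H.
  apply: (is_derive_eq (H _ _)).
  - move=> y Uy t; rewrite -(det_1_eigen t (splitU Uy)).
    have -> : 1%:M + t *: M y = P *m (1%:M + t *: hess u y) *m P^T.
      by rewrite mulmxDr mulmx1 mulmxDl PP -scalemxAr -scalemxAl.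
    by rewrite !det_mulmx mulrAC -det_mulmx PP det1 mul1r.
  - move=> a b; rewrite mxE.
    have C1 : CkL 1 U set0 ('D_(e a) ('D_(e b) u)) by exact: (CkL_Dv _ oU (CkL_Dv _ oU Hu)).
    apply: near_eq_is_derive (CkL_is_derive z oU C1 Ux).
    by apply: (CkL_near oU Ux) => y Uy; rewrite ME.
  - by apply: eq_bigr => a _; rewrite mxE.
exists e, (fun a => d 0 a); split.
- split=> [v|a].
    transitivity (((v *m P^T) *m (v *m P^T)^T) 0 0).
      rewrite mxE; apply: eq_bigr => a _; rewrite [X in _ * X]mxE -expr2; congr (_ ^+ 2).
      by rewrite mxE; apply: eq_bigr => i _; rewrite !mxE.
    rewrite trmx_mul trmxK mulmxA -(mulmxA v) PP' mulmx1 mxE.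
    by apply: eq_bigr => i _; rewrite mxE expr2.
  transitivity ((P *m P^T) a a); last by rewrite PP mxE eqxx.
  by rewrite mxE; apply: eq_bigr => i _; rewrite !mxE expr2.
- move=> v; rewrite hess_dir //.
  have -> : hess u x = P^T *m diag_mx d *m P.
    by rewrite -PD !mulmxA PP' mul1mx -mulmxA PP' mulmx1.
  transitivity ((v *m (P^T *m diag_mx d *m P) *m v^T) 0 0).
    rewrite exchange_big /= mxE; apply: eq_bigr => j _; rewrite !mxE mulr_suml.
    by apply: eq_bigr => i _.
  have -> : v *m (P^T *m diag_mx d *m P) *m v^T = (v *m P^T) *m diag_mx d *m (v *m P^T)^T.
    by rewrite trmx_mul trmxK !mulmxA.
  rewrite mul_mx_diag mxE; apply: eq_bigr => a _; rewrite !mxE.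
  have -> : \sum_j v 0 j * P^T j a = \sum_i v 0 i * e a 0 i.
    by apply: eq_bigr => i _; rewrite !mxE.
  by rewrite expr2; ring.
- by move=> a; rewrite -ME // /M PD mxE eqxx mulr1n.
- split; last by rewrite -eqn // !cd.
  move=> j jk; rewrite -cd; case: j jk => [|j] jk.
    by rewrite cd esym0 ltr01.
  by apply: (adm Ux); rewrite /= jk.
- move=> z; have -> : 'D_z f x = 'D_z (fun y => sigma_mx k (hess u y) / sigma_mx l (hess u y)) x.
    by apply: (derive_eq_on _ oU Ux) => y Uy; rewrite eqn.
  have dk := der z k kn; have dl := der z l (ltnW (leq_trans lk kn)).
  have sl0 : sigma_mx l (hess u x) != 0.
    rewrite gt_eqF //; case: (l) lk => [|l'] lk'; first by rewrite cd esym0 ltr01.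
    by apply: (adm Ux); rewrite /= (ltnW lk').
  set A := \sum_a _ in dk; set B := \sum_a _ in dl.
  have dV : is_derive x z (fun y => (sigma_mx l (hess u y))^-1) (- (sigma_mx l (hess u x) ^- 2 * B)).
    have [dl1 dl2] := dl; split; first exact: derivableV.
    by rewrite deriveV // dl2 scaleNr.
  have [_ ->] := is_deriveM dk dV.
  rewrite !cd /GRing.scale /=.
  have s0 : esymf (fun i => d 0 i) [set: 'I_n] l != 0 by rewrite -cd.
  rewrite /lin_coef.
  transitivity ((A * esymf (fun i => d 0 i) [set: 'I_n] l - esymf (fun i => d 0 i) [set: 'I_n] k * B) / esymf (fun i => d 0 i) [set: 'I_n] l ^+ 2).
    by field.
  rewrite /A /B mulr_suml mulr_sumr -sumrB mulr_suml; apply: eq_bigr => a _.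
  by field.
Qed.

End Linearize.

(** * Iterated derivatives and the weighted squared gradient *)

Fact pd_exists (R : realType) (n : nat) :
  {pd : 'rV[R]_n -> ('rV[R]_n -> R) -> 'rV[R]_n -> R | forall v f, pd v f = 'D_v f}.
Proof. by exists (fun v f => 'D_v f). Qed.

(** The directional derivative behind an opaque name, so that a comparison of two
    iterated derivatives never unfolds the limits that define them. *)
Definition pd (R : realType) (n : nat) (v : 'rV[R]_n) (f : 'rV[R]_n -> R) : 'rV[R]_n -> R :=
  sval (pd_exists R n) v f.

Section Products.
Variables (R : realType) (n : nat) (U S : set 'rV[R]_n) (oU : open U).
Implicit Types (f g h w : 'rV[R]_n -> R) (x v a b z : 'rV[R]_n).

Lemma pdE v f : pd v f = 'D_v f.
Proof. exact: (svalP (pd_exists R n)). Qed.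

Lemma gradE g x p : grad g x 0 p = pd (delta_mx 0 p) g x.
Proof. by rewrite mxE pdE. Qed.

Lemma CkL_pd k f v : CkL k.+1 U S f -> CkL k U S (pd v f).
Proof. by rewrite pdE; exact: CkL_Dv. Qed.

Lemma pd_is_derive k f v x : CkL k.+1 U S f -> U x -> is_derive x v f (pd v f x).
Proof. by rewrite pdE; exact: CkL_is_derive. Qed.

Lemma pd_val f v x d : is_derive x v f d -> pd v f x = d.
Proof. by rewrite pdE => -[_ ->]. Qed.

Lemma pd_coord k f v x : CkL k.+1 U S f -> U x ->
  pd v f x = \sum_i v 0 i * pd (delta_mx 0 i) f x.
Proof.
move=> H Ux; rewrite pdE (CkL_DvE v oU H Ux).
by apply: eq_bigr => i _; rewrite pdE.
Qed.

Lemma pd_eq_on f g v x : U x -> (forall y, U y -> f y = g y) -> pd v f x = pd v g x.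
Proof. by rewrite !pdE; exact: derive_eq_on. Qed.

Lemma pd_add k f g v x : CkL k.+1 U S f -> CkL k.+1 U S g -> U x ->
  pd v (fun y => f y + g y) x = pd v f x + pd v g x.
Proof. by rewrite !pdE; exact: derive_addE. Qed.

Lemma pd_mul k f g v x : CkL k.+1 U S f -> CkL k.+1 U S g -> U x ->
  pd v (fun y => f y * g y) x = f x * pd v g x + g x * pd v f x.
Proof. by rewrite !pdE; exact: derive_mulE. Qed.

Lemma pd_scale k (c : R) f v x : CkL k.+1 U S f -> U x ->
  pd v (fun y => c * f y) x = c * pd v f x.
Proof. by rewrite !pdE; exact: derive_cstmE. Qed.

Lemma pd_cst (c : R) v x : pd v (fun=> c) x = 0.
Proof. by rewrite pdE; exact: derive_cst. Qed.

Lemma pd_bigsum k (I : Type) (r : seq I) (F : I -> 'rV[R]_n -> R) v x :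
  (forall j, CkL k.+1 U S (F j)) -> U x ->
  pd v (fun y => \sum_(j <- r) F j y) x = \sum_(j <- r) pd v (F j) x.
Proof.
move=> H Ux; rewrite pdE (derive_sumE r v oU H Ux).
by apply: eq_bigr => j _; rewrite pdE.
Qed.

Lemma pd_comp k (h dh : R -> R) f v x : CkL k.+1 U S f -> U x ->
  is_derive (f x) 1 h (dh (f x)) -> pd v (fun y => h (f y)) x = dh (f x) * pd v f x.
Proof. by rewrite !pdE; exact: derive_compE. Qed.

Lemma pd_comm f v v' x : CkL 2 U S f -> U x -> pd v (pd v' f) x = pd v' (pd v f) x.
Proof. by rewrite !pdE; exact: clairaut. Qed.

Lemma pd_max f v x : CkL 2 U S f -> U x -> (\forall y \near x, f y <= f x) ->
  pd v f x = 0 /\ pd v (pd v f) x <= 0.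
Proof. by rewrite !pdE; exact: second_derivative_max. Qed.

Lemma pd2_mul g h a z x : CkL 2 U S g -> CkL 2 U S h -> U x ->
  pd z (pd a (fun y => g y * h y)) x =
  g x * pd z (pd a h) x + pd z g x * pd a h x + pd a g x * pd z h x + pd z (pd a g) x * h x.
Proof.
move=> Hg Hh Ux.
have Hg1 := CkLW (leqnSn 1) Hg; have Hh1 := CkLW (leqnSn 1) Hh.
have Hga := CkL_pd a Hg; have Hha := CkL_pd a Hh.
have -> : pd z (pd a (fun y => g y * h y)) x = pd z (fun y => g y * pd a h y + h y * pd a g y) x.
  by apply: (pd_eq_on _ Ux) => y Uy; exact: (pd_mul a Hg1 Hh1 Uy).
rewrite (pd_add z (CkL_mul oU Hg1 Hha) (CkL_mul oU Hh1 Hga) Ux).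
rewrite (pd_mul z Hg1 Hha Ux) (pd_mul z Hh1 Hga Ux); ring.
Qed.

Lemma pd3_mul g h a b z x : CkL 3 U S g -> CkL 3 U S h -> U x ->
  pd z (pd b (pd a (fun y => g y * h y))) x =
  g x * pd z (pd b (pd a h)) x + pd z g x * pd b (pd a h) x
  + pd b g x * pd z (pd a h) x + pd a h x * pd z (pd b g) x
  + pd a g x * pd z (pd b h) x + pd b h x * pd z (pd a g) x
  + pd b (pd a g) x * pd z h x + pd z (pd b (pd a g)) x * h x.
Proof.
move=> Hg Hh Ux.
have Hg1 : CkL 1 U S g := CkLW (isT : (1 <= 3)%N) Hg.
have Hh1 : CkL 1 U S h := CkLW (isT : (1 <= 3)%N) Hh.
have Hg2 := CkLW (leqnSn 2) Hg; have Hh2 := CkLW (leqnSn 2) Hh.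
have Dg c : CkL 1 U S (pd c g) := CkL_pd c Hg2.
have Dh c : CkL 1 U S (pd c h) := CkL_pd c Hh2.
have D2g c c' : CkL 1 U S (pd c (pd c' g)) := CkL_pd c (CkL_pd c' Hg).
have D2h c c' : CkL 1 U S (pd c (pd c' h)) := CkL_pd c (CkL_pd c' Hh).
have -> : pd z (pd b (pd a (fun y => g y * h y))) x =
   pd z (fun y => g y * pd b (pd a h) y + pd b g y * pd a h y + pd a g y * pd b h y + pd b (pd a g) y * h y) x.
  by apply: (pd_eq_on _ Ux) => y Uy; exact: (pd2_mul a b Hg2 Hh2 Uy).
have T1 := CkL_mul oU Hg1 (D2h b a); have T2 := CkL_mul oU (Dg b) (Dh a).
have T3 := CkL_mul oU (Dg a) (Dh b); have T4 := CkL_mul oU (D2g b a) Hh1.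
rewrite (pd_add z (CkL_add oU (CkL_add oU T1 T2) T3) T4 Ux).
rewrite (pd_add z (CkL_add oU T1 T2) T3 Ux) (pd_add z T1 T2 Ux).
rewrite (pd_mul z Hg1 (D2h b a) Ux) (pd_mul z (Dg b) (Dh a) Ux).
rewrite (pd_mul z (Dg a) (Dh b) Ux) (pd_mul z (D2g b a) Hh1 Ux); ring.
Qed.

Lemma pd2_add g h a z x : CkL 2 U S g -> CkL 2 U S h -> U x ->
  pd z (pd a (fun y => g y + h y)) x = pd z (pd a g) x + pd z (pd a h) x.
Proof.
move=> Hg Hh Ux.
have Hg1 := CkLW (leqnSn 1) Hg; have Hh1 := CkLW (leqnSn 1) Hh.
have -> : pd z (pd a (fun y => g y + h y)) x = pd z (fun y => pd a g y + pd a h y) x.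
  by apply: (pd_eq_on _ Ux) => y Uy; exact: (pd_add _ Hg1 Hh1 Uy).
exact: (pd_add z (CkL_pd a Hg) (CkL_pd a Hh) Ux).
Qed.

Lemma pd3_add g h a b z x : CkL 3 U S g -> CkL 3 U S h -> U x ->
  pd z (pd b (pd a (fun y => g y + h y))) x = pd z (pd b (pd a g)) x + pd z (pd b (pd a h)) x.
Proof.
move=> Hg Hh Ux.
have Hg2 := CkLW (leqnSn 2) Hg; have Hh2 := CkLW (leqnSn 2) Hh.
have -> : pd z (pd b (pd a (fun y => g y + h y))) x = pd z (fun y => pd b (pd a g) y + pd b (pd a h) y) x.
  by apply: (pd_eq_on _ Ux) => y Uy; exact: (pd2_add _ _ Hg2 Hh2 Uy).
exact: (pd_add z (CkL_pd b (CkL_pd a Hg)) (CkL_pd b (CkL_pd a Hh)) Ux).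
Qed.

Lemma CkL_exp k g : CkL k U S g -> CkL k U S (fun y => expR (g y)).
Proof.
move=> Hg; apply: (@CkL_comp _ _ k U S (fun=> expR) g oU _ _ Hg); exact: continuous_expR.
Qed.

Lemma pd_exp g a x : CkL 1 U S g -> U x -> pd a (fun y => expR (g y)) x = expR (g x) * pd a g x.
Proof. by move=> Hg Ux; apply: (@pd_comp 0 expR expR _ a _ Hg Ux); exact: is_derive_expR. Qed.

Lemma pd2_exp g a z x : CkL 2 U S g -> U x ->
  pd z (pd a (fun y => expR (g y))) x = expR (g x) * (pd z (pd a g) x + pd z g x * pd a g x).
Proof.
move=> Hg Ux; have Hg1 := CkLW (leqnSn 1) Hg.
have -> : pd z (pd a (fun y => expR (g y))) x = pd z (fun y => expR (g y) * pd a g y) x.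
  by apply: (pd_eq_on _ Ux) => y Uy; exact: pd_exp.
rewrite (pd_mul z (CkL_exp Hg1) (CkL_pd a Hg) Ux) (pd_exp z Hg1 Ux); ring.
Qed.

Definition sqgrad g y := \sum_(p < n) pd (delta_mx 0 p) g y * pd (delta_mx 0 p) g y.

Lemma CkL_sqgrad k g : CkL k.+1 U S g -> CkL k U S (sqgrad g).
Proof. by move=> Hg; apply: CkL_sum => // p; apply: CkL_mul => //; exact: CkL_pd. Qed.

Lemma sqgradE g y : sqgrad g y = \sum_p grad g y 0 p ^+ 2.
Proof. by apply: eq_bigr => p _; rewrite gradE expr2. Qed.

Lemma pd_gradE g x : CkL 1 U S g -> U x -> pd (grad g x) g x = sqgrad g x.
Proof.
by move=> Hg Ux; rewrite (pd_coord _ Hg Ux); apply: eq_bigr => p _; rewrite gradE.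
Qed.

Lemma pd_sqgrad g a x : CkL 2 U S g -> U x ->
  pd a (sqgrad g) x = 2 * pd (grad g x) (pd a g) x.
Proof.
move=> Hg Ux; have Dg p : CkL 1 U S (pd (delta_mx 0 p) g) by exact: CkL_pd.
rewrite (pd_bigsum _ a (fun p => CkL_mul oU (Dg p) (Dg p)) Ux).
rewrite (pd_coord _ (CkL_pd a Hg) Ux) mulr_sumr; apply: eq_bigr => p _.
rewrite (pd_mul a (Dg p) (Dg p) Ux) gradE (pd_comm a _ Hg Ux); ring.
Qed.

Lemma pd2_sqgrad g a x : CkL 3 U S g -> U x ->
  pd a (pd a (sqgrad g)) x = 2 * (\sum_p (pd a (pd (delta_mx 0 p) g) x) ^+ 2)
     + 2 * pd (grad g x) (pd a (pd a g)) x.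
Proof.
move=> Hg Ux; have Hg2 := CkLW (leqnSn 2) Hg.
have Dg p : CkL 2 U S (pd (delta_mx 0 p) g) by exact: CkL_pd.
have Dga : CkL 2 U S (pd a g) by exact: CkL_pd.
have E p y : U y -> pd a (fun y => pd (delta_mx 0 p) g y * pd (delta_mx 0 p) g y) y =
   2 * (pd (delta_mx 0 p) g y * pd a (pd (delta_mx 0 p) g) y).
  move=> Uy; have D1 := CkLW (leqnSn 1) (Dg p).
  by rewrite (pd_mul a D1 D1 Uy); ring.
have -> : pd a (pd a (sqgrad g)) x =
    pd a (fun y => \sum_p pd a (fun y => pd (delta_mx 0 p) g y * pd (delta_mx 0 p) g y) y) x.
  apply: (pd_eq_on _ Ux) => y Uy.
  exact: (pd_bigsum _ a (fun p => CkL_mul oU (Dg p) (Dg p)) Uy).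
rewrite (pd_bigsum _ a (fun p => CkL_pd a (CkL_mul oU (Dg p) (Dg p))) Ux).
rewrite (pd_coord (grad g x) (CkL_pd a Dga) Ux) !mulr_sumr -big_split; apply: eq_bigr => p _.
rewrite (pd2_mul _ _ (Dg p) (Dg p) Ux) gradE.
have -> : pd (delta_mx 0 p) (pd a (pd a g)) x = pd a (pd a (pd (delta_mx 0 p) g)) x.
  rewrite (pd_comm _ a Dga Ux).
  by apply: (pd_eq_on _ Ux) => y Uy; rewrite (pd_comm _ a Hg2 Uy).
rewrite /=; ring.
Qed.

Lemma cauchy_schwarz (I : finType) (s t : I -> R) :
  (\sum_i s i * t i) ^+ 2 <= (\sum_i s i ^+ 2) * (\sum_i t i ^+ 2).
Proof.
have : 0 <= \sum_i \sum_j (s i * t j - s j * t i) ^+ 2.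
  by do 2!(apply: sumr_ge0 => ? _); exact: sqr_ge0.
have -> : \sum_i \sum_j (s i * t j - s j * t i) ^+ 2 =
  \sum_i \sum_j s i ^+ 2 * t j ^+ 2 + \sum_i \sum_j t i ^+ 2 * s j ^+ 2
  - \sum_i \sum_j (2 * (s i * t i)) * (s j * t j).
  rewrite -big_split -sumrB; apply: eq_bigr => i _.
  by rewrite -big_split -sumrB; apply: eq_bigr => j _ /=; ring.
by rewrite -!big_distrlr /= -mulr_sumr; nra.
Qed.

Lemma bernstein_aux (q e P T e2 : R) : 0 < q -> (q * e / 2) ^+ 2 <= q * P ->
  2 * P + 2 * T + q * (e2 - e ^+ 2) <= 0 -> 2 * T + q * (e2 - e ^+ 2 / 2) <= 0.
Proof.
move=> q0 CS d2; have : q * e ^+ 2 / 4 <= P by rewrite -(ler_pM2l q0); lra.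
lra.
Qed.

(** The second-order condition contains [2 |D D_a w|^2 - q eta_a^2] for
    [q = |Dw|^2]. The first-order condition is [2 Dw . D D_a w = - q eta_a], so by
    Cauchy-Schwarz the square restores half of the subtracted term. *)
Lemma bernstein_max w eta x : CkL 3 U S w -> CkL 2 U S eta -> U x -> 0 < sqgrad w x ->
  (\forall y \near x, sqgrad w y * expR (eta y) <= sqgrad w x * expR (eta x)) ->
  forall a, 2 * pd (grad w x) (pd a w) x = - (sqgrad w x * pd a eta x) /\
    2 * pd (grad w x) (pd a (pd a w)) x
     + sqgrad w x * (pd a (pd a eta) x - (pd a eta x) ^+ 2 / 2) <= 0.
Proof.
move=> Hw He Ux q0 mx a.
have Hq := CkL_sqgrad Hw; have He1 := CkLW (leqnSn 1) He; have Hq1 := CkLW (leqnSn 1) Hq.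
have [d1 d2] := pd_max a (CkL_mul oU Hq (CkL_exp He)) Ux mx.
have E0 := expR_gt0 (eta x).
have F : 2 * pd (grad w x) (pd a w) x = - (sqgrad w x * pd a eta x).
  move: d1; rewrite (pd_mul a Hq1 (CkL_exp He1) Ux) (pd_exp a He1 Ux).
  rewrite (pd_sqgrad a (CkLW (leqnSn 2) Hw) Ux) => d1.
  apply: (mulfI (lt0r_neq0 E0)); rewrite [RHS]mulrN; apply/eqP; rewrite -subr_eq0 opprK addrC; apply/eqP.
  by rewrite -[RHS]d1; ring.
split=> //.
move: d2; rewrite (pd2_mul _ _ Hq (CkL_exp He) Ux) (pd2_exp _ _ He Ux) (pd_exp a He1 Ux).
rewrite (pd2_sqgrad _ Hw Ux) (pd_sqgrad a (CkLW (leqnSn 2) Hw) Ux) F.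
set q := sqgrad w x in q0 F *; set ea := pd a eta x in F *; set P := \sum_p _; set T := pd (grad w x) _ x.
move=> d2.
have {}d2 : 2 * P + 2 * T + q * (pd a (pd a eta) x - ea ^+ 2) <= 0.
  rewrite -(pmulr_rle0 _ E0); apply: le_trans d2; rewrite le_eqVlt; apply/orP; left; apply/eqP; ring.
have CS : (q * ea / 2) ^+ 2 <= q * P.
  have := cauchy_schwarz (fun p => grad w x 0 p) (fun p => pd a (pd (delta_mx 0 p) w) x).
  rewrite -sqgradE -/q -/P; apply: le_trans; rewrite le_eqVlt; apply/orP; left; apply/eqP.
  have -> : \sum_i grad w x 0 i * pd a (pd (delta_mx 0 i) w) x = pd (grad w x) (pd a w) x.
    rewrite (pd_coord _ (CkL_pd a (CkLW (leqnSn 2) Hw)) Ux); apply: eq_bigr => p _.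
    by rewrite (pd_comm a _ (CkLW (leqnSn 2) Hw) Ux).
  have -> : pd (grad w x) (pd a w) x = - (q * ea) / 2 by rewrite -F; field.
  by rewrite mulNr sqrrN.
exact: (bernstein_aux q0 CS d2).
Qed.

End Products.

(** * The interior estimate *)

Section DirectionalBounds.
Variables (R : realType) (n : nat) (U S : set 'rV[R]_n) (oU : open U) (x : 'rV[R]_n) (Ux : U x).
Implicit Types (g : 'rV[R]_n -> R) (a z : 'rV[R]_n).
Local Notation e_ i := (delta_mx (0 : 'I_1) (i : 'I_n) : 'rV[R]_n).

Lemma pd_bound g a (r c : R) : CkL 1 U S g -> (forall i, `|a 0 i| <= r) ->
  (forall i, `|pd (e_ i) g x| <= c) -> `|pd a g x| <= n%:R * (r * c).
Proof.
move=> Hg ar gc; rewrite (pd_coord oU _ Hg Ux).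
apply: le_trans (ler_norm_sum _ _ _) _.
have -> : n%:R * (r * c) = \sum_(i < n) r * c by rewrite sumr_const card_ord mulr_natl.
by apply: ler_sum => i _; apply: normM_le.
Qed.

Lemma pd2_bound g a z (r s c : R) : CkL 2 U S g -> (forall i, `|a 0 i| <= r) ->
  (forall i, `|z 0 i| <= s) -> (forall i j, `|pd (e_ i) (pd (e_ j) g) x| <= c) ->
  `|pd z (pd a g) x| <= n%:R * (s * (n%:R * (r * c))).
Proof.
move=> Hg ar zs gc; apply: (pd_bound (CkL_pd oU a Hg) zs) => i.
rewrite (pd_comm oU _ _ Hg Ux); apply: (pd_bound (CkL_pd oU _ Hg) ar) => j; exact: gc.
Qed.

Lemma pd3_bound g a z (r s c : R) : CkL 3 U S g -> (forall i, `|a 0 i| <= r) ->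
  (forall i, `|z 0 i| <= s) -> (forall i j k, `|pd (e_ i) (pd (e_ j) (pd (e_ k) g)) x| <= c) ->
  `|pd z (pd a (pd a g)) x| <= n%:R * (s * (n%:R * (r * (n%:R * (r * c))))).
Proof.
move=> Hg ar zs gc; have Hg2 := CkLW (leqnSn 2) Hg.
apply: (pd_bound (CkL_pd oU a (CkL_pd oU a Hg)) zs) => i.
rewrite (pd_comm oU _ _ (CkL_pd oU a Hg) Ux).
have -> : pd a (pd (e_ i) (pd a g)) x = pd a (pd a (pd (e_ i) g)) x.
  by apply: (pd_eq_on oU _ Ux) => y Uy; exact: (pd_comm oU _ _ Hg2 Uy).
by apply: (pd2_bound (CkL_pd oU _ Hg) ar ar) => j k.
Qed.

End DirectionalBounds.

Section Interior.
Variables (R : realType) (n k l : nat) (U : set 'rV[R]_n) (oU : open U).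
Variables (u f v psi D : 'rV[R]_n -> R) (x : 'rV[R]_n).
Variables (K' A M0 sF DF : R).
Hypotheses (lk : (l < k)%N) (kn : (k <= n)%N).
Hypotheses (Hu : CkL 3 U set0 u) (Hf : CkL 1 U set0 f) (Hv : CkL 3 U set0 v) (Hpsi : CkL 3 U set0 psi) (HD : CkL 3 U set0 D).
Hypotheses (adm : admissible k U u)
  (eqn : forall y, U y -> sigma_mx k (hess u y) / sigma_mx l (hess u y) = f y) (Ux : U x).
Hypotheses (A0 : 0 <= A) (M00 : 0 <= M0) (f0 : 0 < f x) (fs : f x <= sF) (gf : enorm (grad f x) <= DF)
  (uM : `|u x| <= M0) (M0K : M0 <= K') (v9 : 9/10 <= v x <= 1)
  (gK : forall g s, g = v \/ g = psi \/ g = D -> (size s <= 3)%N -> `|pderivs s g x| <= K').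

(** For this [b] the function [h(t) = b (t + M + 1)^2] satisfies [h'^2 <= h''] and
    [0 <= h' <= 1] when [|t| <= M]: half of its convexity survives the subtraction
    of half of the squared derivative. *)
Definition bern_coef (M : R) : R := (2 * (2 * M + 1) ^+ 2)^-1.
Local Notation b := (bern_coef M0).
Local Notation e_ i := (delta_mx (0 : 'I_1) (i : 'I_n) : 'rV[R]_n).

Definition bern_w (v u psi : 'rV[R]_n -> R) y := v y * u y + psi y.
Definition bern_eta (M A : R) (u D : 'rV[R]_n -> R) y :=
  bern_coef M * ((u y + (M + 1)) * (u y + (M + 1))) + A * D y.
Local Notation w := (bern_w v u psi).
Local Notation eta := (bern_eta M0 A u D).

Definition interior_const (n : nat) (K' A M0 sF DF : R) : R :=
  let K := n%:R ^+ 3 * K' + 1 in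
  let b := bern_coef M0 in
  1 + (bnd9 K A + 1) / b + 2 * n%:R ^+ 2 * (bnd7 K A + n%:R * (2 * DF + 2 * K * n%:R * sF)) / b.

Let m1 : 1 <= 2 * M0 + 1. Proof. by rewrite lerDr mulr_ge0. Qed.
Let b0 : 0 < b.
Proof. by rewrite /bern_coef invr_gt0 mulr_gt0 ?exprn_gt0 // (lt_le_trans ltr01 m1). Qed.
Let bm : 2 * b * (2 * M0 + 1) ^+ 2 = 1.
Proof. by rewrite /bern_coef; field; rewrite gt_eqF // (lt_le_trans ltr01 m1). Qed.
Let b1 : b <= 1.
Proof.
have h := bm; have h0 := b0; have : 1 <= (2 * M0 + 1) ^+ 2 by rewrite exprn_ege1.
by nra.
Qed.

Let H_w : CkL 3 U set0 w. Proof. exact: (CkL_add oU (CkL_mul oU Hv Hu) Hpsi). Qed.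
Let Huc k' : CkL k' U set0 u -> CkL k' U set0 (fun y => u y + (M0 + 1)).
Proof. by move=> H; apply: (CkL_add oU H); exact: CkL_cst. Qed.
Let HU2 : CkL 2 U set0 u := CkLW (leqnSn 2) Hu.
Let HU1 : CkL 1 U set0 u := CkLW (isT : (1 <= 3)%N) Hu.
Let HD2 : CkL 2 U set0 D := CkLW (leqnSn 2) HD.
Let HD1 : CkL 1 U set0 D := CkLW (isT : (1 <= 3)%N) HD.
Let H_eta : CkL 2 U set0 eta.
Proof.
exact: (CkL_add oU (CkL_scale b oU (CkL_mul oU (Huc HU2) (Huc HU2))) (CkL_scale A oU HD2)).
Qed.

Let pd_uc a y : U y -> pd a (fun y => u y + (M0 + 1)) y = pd a u y.
Proof.
move=> Uy; rewrite (pd_add oU a HU1 (CkL_cst _ U set0 _) Uy) pd_cst addr0.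
by [].
Qed.

Lemma pd_eta a y : U y -> pd a eta y = 2 * b * (u y + (M0 + 1)) * pd a u y + A * pd a D y.
Proof.
move=> Uy; have H1 := Huc HU1.
rewrite (pd_add oU a (CkL_scale b oU (CkL_mul oU H1 H1)) (CkL_scale A oU HD1) Uy).
rewrite (pd_scale oU b a (CkL_mul oU H1 H1) Uy) (pd_scale oU A a HD1 Uy).
rewrite (pd_mul oU a H1 H1 Uy) pd_uc //; ring.
Qed.

Lemma pd2_eta a y : U y -> pd a (pd a eta) y =
  2 * b * (u y + (M0 + 1)) * pd a (pd a u) y + 2 * b * pd a u y ^+ 2 + A * pd a (pd a D) y.
Proof.
move=> Uy; have Hc : CkL 1 U set0 (fun y => 2 * b * (u y + (M0 + 1))) by exact: (CkL_scale _ oU (Huc HU1)).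
have -> : pd a (pd a eta) y = pd a (fun y => 2 * b * (u y + (M0 + 1)) * pd a u y + A * pd a D y) y.
  by apply: (pd_eq_on oU _ Uy) => y' Uy'; exact: pd_eta.
have Hua := CkL_pd oU a HU2; have HDa := CkL_pd oU a HD2.
rewrite (pd_add oU a (CkL_mul oU Hc Hua) (CkL_scale A oU HDa) Uy).
rewrite (pd_mul oU a Hc Hua Uy) (pd_scale oU A a HDa Uy) (pd_scale oU (2 * b) a (Huc HU1) Uy) pd_uc //; ring.
Qed.

Let uc1 : 1 <= u x + (M0 + 1).
Proof. by move: uM; rewrite ler_norml => /andP[h _]; lra. Qed.
Let uc2 : u x + (M0 + 1) <= 2 * M0 + 1.
Proof. by move: uM; rewrite ler_norml => /andP[_ h]; lra. Qed.

(** The second-order conditions in the eigendirections of [D^2 u] are summed with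
    the coefficients of the linearised equation. The third derivatives of [u] then
    become derivatives of [f], and by [curvature_bound] the gradient direction has
    curvature at most -1, so that [lin_coef_mean_trace] turns the good squares into
    a term of order [|Dw|^4] times the trace. *)
Lemma interior_estimate : 0 <= K' -> 0 <= sF -> 0 <= DF ->
  (\forall y \near x, sqgrad w y * expR (eta y) <= sqgrad w x * expR (eta x)) ->
  sqgrad w x <= interior_const n K' A M0 sF DF ^+ 2.
Proof.
move=> K'0 sF0 DF0 mx.
have n0 : (0 < n)%N by apply: leq_trans kn; apply: leq_ltn_trans lk.
have n1 : 1 <= n%:R :> R by rewrite ler1n.
set q := sqgrad w x in mx *.
have q0 : 0 <= q by apply: sumr_ge0 => p _; rewrite -expr2 sqr_ge0.
set K := n%:R ^+ 3 * K' + 1; set h1 := 2 * b * (u x + (M0 + 1)).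
have n31 : 1 <= n%:R ^+ 3 :> R by rewrite exprn_ege1.
have KK : K' <= K.
  by rewrite /K; apply: (le_trans (_ : K' <= n%:R ^+ 3 * K')); rewrite ?lerDl // ler_peMl.
have K1 : 1 <= K by rewrite /K lerDr mulr_ge0 ?exprn_ge0.
have K0 : 0 <= K by lra.
have bnd70 : 0 <= bnd7 K A.
  have AK : 0 <= A * K by exact: mulr_ge0.
  by rewrite /bnd7 /bnd4 /bnd5 /bnd3 /bnd2 /bnd1 !(addr_ge0, mulr_ge0, exprn_ge0).
have bnd90 : 0 <= bnd9 K A.
  have AK : 0 <= A * K by exact: mulr_ge0.
  by rewrite /bnd9 /bnd1 !(addr_ge0, mulr_ge0, exprn_ge0).
set S1 := 2 * DF + 2 * K * n%:R * sF.
have S10 : 0 <= S1 by rewrite /S1 !(addr_ge0, mulr_ge0).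
set T9 := (bnd9 K A + 1) / b; set T7 := 2 * n%:R ^+ 2 * (bnd7 K A + n%:R * S1) / b.
have T90 : 0 <= T9 by apply: divr_ge0; [exact: addr_ge0|exact: ltW].
have T70 : 0 <= T7.
  apply: divr_ge0; last exact: ltW.
  by rewrite !(addr_ge0, mulr_ge0, exprn_ge0).
have -> : interior_const n K' A M0 sF DF = 1 + T9 + T7 by [].
set W := Num.sqrt q.
have Wq : W ^+ 2 = q by rewrite sqr_sqrtr.
have W0 : 0 <= W by exact: sqrtr_ge0.
rewrite -Wq ler_pXn2r ?nnegrE ?addr_ge0 //.
have [W1|W1] := leP W 1; first by lra.
have [W9|W9] := leP W T9; first by lra.
suff : W <= T7 by lra.
have {}W1 := ltW W1.
have qp : 0 < q by rewrite -Wq exprn_gt0 // (lt_le_trans ltr01).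
have {}W9 : bnd9 K A + 1 <= b * W by rewrite mulrC -ler_pdivrMr // ltW.
set z := grad w x.
have zz : \sum_i z 0 i ^+ 2 = W ^+ 2 by rewrite Wq /q sqgradE.
have sqle (t : 'rV[R]_n) i : t 0 i ^+ 2 <= \sum_j t 0 j ^+ 2.
  by rewrite (bigD1 i) //= lerDl sumr_ge0 // => j _; exact: sqr_ge0.
have absle (t r : R) : 0 <= r -> t ^+ 2 <= r ^+ 2 -> `|t| <= r.
  by move=> r0 h; rewrite -(@ler_pXn2r _ 2) ?nnegrE // real_normK ?num_real.
have zW i : `|z 0 i| <= W by apply: absle => //; rewrite -zz sqle.
have [e [d [[parseval unit_e] quad diag [gam_d fE] lin]]] :=
  linearized_equation lk kn oU Hu adm eqn Ux.
have e1 a i : `|e a 0 i| <= 1.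
  by apply: absle => //; rewrite expr1n -(unit_e a) sqle.
have n2 : n%:R * n%:R <= n%:R ^+ 3 :> R.
  by rewrite !exprS expr0 mulr1 ler_wpM2l // ler_peMl.
have n3 : n%:R <= n%:R ^+ 3 :> R by apply: le_trans n2; rewrite ler_peMl.
have KN3 (r : R) : 0 <= r -> n%:R * (n%:R * (n%:R * (r * K'))) <= K * r.
  move=> r0; rewrite /K mulrDl mul1r; have -> : n%:R * (n%:R * (n%:R * (r * K'))) = n%:R ^+ 3 * K' * r by ring.
  by rewrite lerDl.
have KN2 (r : R) : 0 <= r -> n%:R * (n%:R * (r * K')) <= K * r.
  move=> r0; apply: le_trans (KN3 r r0); apply: ler_wpM2l => //; apply: ler_wpM2l => //.
  by rewrite ler_peMl // mulr_ge0.
have KN1 (r : R) : 0 <= r -> n%:R * (r * K') <= K * r.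
  move=> r0; apply: le_trans (KN2 r r0); apply: ler_wpM2l => //.
  by rewrite ler_peMl // mulr_ge0.
have B0 g s : g = v \/ g = psi \/ g = D -> (size s <= 3)%N -> `|pderivs s g x| <= K' := @gK g s.
have C3 g : g = v \/ g = psi \/ g = D -> CkL 3 U set0 g by case=> [->|[->|->]].
have pE s g : pderivs s g = foldr (fun i h => pd (e_ i) h) g s.
  by elim: s => [//|i s IH] /=; rewrite -/(pderivs s g) IH pdE.
have B1 g (a : 'rV[R]_n) (r : R) : g = v \/ g = psi \/ g = D -> 0 <= r -> (forall i, `|a 0 i| <= r) -> `|pd a g x| <= K * r.
  move=> gg r0 ar; apply: le_trans (KN1 r r0).
  apply: (pd_bound oU Ux (CkLW (isT : (1 <= 3)%N) (C3 g gg)) ar) => i.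
  by have := B0 g [:: i] gg isT; rewrite pE.
have B2 g (t a : 'rV[R]_n) (r r' : R) : g = v \/ g = psi \/ g = D -> 0 <= r -> 0 <= r' -> (forall i, `|a 0 i| <= r') -> (forall i, `|t 0 i| <= r) ->
    `|pd t (pd a g) x| <= K * (r * r').
  move=> gg r0 r'0 ar tr; apply: le_trans (KN2 (r * r') (mulr_ge0 r0 r'0)).
  have := pd2_bound oU Ux (CkLW (isT : (2 <= 3)%N) (C3 g gg)) ar tr (fun i j => _).
  have -> : n%:R * (n%:R * (r * r' * K')) = n%:R * (r * (n%:R * (r' * K'))) by ring.
  by apply=> i j; have := B0 g [:: i; j] gg isT; rewrite pE.
have B3 g (a : 'rV[R]_n) : g = v \/ g = psi \/ g = D -> (forall i, `|a 0 i| <= 1) ->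
    `|pd z (pd a (pd a g)) x| <= K * W.
  move=> gg ar; apply: le_trans (KN3 W W0).
  have := pd3_bound oU Ux (C3 g gg) ar zW (fun i j k => _).
  have -> : n%:R * (n%:R * (n%:R * (W * K'))) = n%:R * (W * (n%:R * (1 * (n%:R * (1 * K'))))) by ring.
  by apply=> i j k'; have := B0 g [:: i; j; k'] gg isT; rewrite pE.
have gv : v = v \/ v = psi \/ v = D by left.
have gp : psi = v \/ psi = psi \/ psi = D by right; left.
have gD : D = v \/ D = psi \/ D = D by right; right.
have h2b : 2 * b <= h1 by rewrite /h1 ler_peMr // mulr_ge0 // ltW.
have h0 : 0 <= h1 by apply: le_trans h2b; rewrite mulr_ge0 // ltW.
have hb : h1 ^+ 2 <= 2 * b.
  have -> : 2 * b = 2 * b * (2 * b * (2 * M0 + 1) ^+ 2) by rewrite bm mulr1.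
  have -> : h1 ^+ 2 = 2 * b * (2 * b * (u x + (M0 + 1)) ^+ 2) by rewrite /h1; ring.
  rewrite !ler_wpM2l ?mulr_ge0 ?(ltW b0) // ler_pXn2r ?nnegrE //.
    exact: le_trans ler01 uc1.
  exact: le_trans ler01 m1.
have h11 : h1 <= 1.
  have h : h1 * (2 * M0 + 1) <= 1.
    rewrite -[leRHS]bm /h1 expr2 mulrA; apply: ler_wpM2r; first exact: le_trans ler01 m1.
    by rewrite ler_wpM2l // mulr_ge0 // ltW.
  by apply: le_trans h; rewrite ler_peMr.
have uK : `|u x| <= K by exact: le_trans uM (le_trans M0K KK).
have /andP[v9' v1] := v9.
have HvH := CkL_mul oU Hv Hu.
have wa a : pd a w x = v x * pd a u x + pd a v x * u x + pd a psi x.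
  rewrite (pd_add oU a (CkLW (isT : (1 <= 3)%N) HvH) (CkLW (isT : (1 <= 3)%N) Hpsi) Ux).
  rewrite (pd_mul oU a (CkLW (isT : (1 <= 3)%N) Hv) HU1 Ux); ring.
have w2 a a' : pd a' (pd a w) x = v x * pd a' (pd a u) x + pd a' v x * pd a u x + pd a v x * pd a' u x + pd a' (pd a v) x * u x + pd a' (pd a psi) x.
  rewrite (pd2_add oU _ _ (CkLW (leqnSn 2) HvH) (CkLW (leqnSn 2) Hpsi) Ux).
  by rewrite (pd2_mul oU _ _ (CkLW (leqnSn 2) Hv) HU2 Ux).
have w3 a := etrans (pd3_add oU a a z HvH Hpsi Ux) (congr1 (fun t => t + pd z (pd a (pd a psi)) x) (pd3_mul oU a a z Hv Hu Ux)).
have wz : pd z w x = W ^+ 2 by rewrite Wq /q -(pd_gradE oU (CkLW (isT : (1 <= 3)%N) H_w) Ux).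
have wzE : v x * pd z u x + pd z v x * u x + pd z psi x = W ^+ 2 by rewrite -wa.
have BM a := bernstein_max oU H_w H_eta Ux qp mx a.
have Wq' : sqgrad w x = W ^+ 2 by rewrite Wq.
have FO a : 2 * (v x * pd z (pd a u) x + pd z v x * pd a u x + pd a v x * pd z u x + pd z (pd a v) x * u x + pd z (pd a psi) x)
    = - (W ^+ 2 * (h1 * pd a u x + A * pd a D x)).
  by rewrite -w2 Wq; have [-> _] := BM a; rewrite pd_eta.
have SO a : 2 * (v x * pd z (pd a (pd a u)) x + pd z v x * pd a (pd a u) x + pd a v x * pd z (pd a u) x + pd a u x * pd z (pd a v) x
      + pd a v x * pd z (pd a u) x + pd a u x * pd z (pd a v) x + pd a (pd a v) x * pd z u x + pd z (pd a (pd a v)) x * u x + pd z (pd a (pd a psi)) x)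
    + W ^+ 2 * ((h1 * pd a (pd a u) x + 2 * b * pd a u x ^+ 2 + A * pd a (pd a D) x) - (h1 * pd a u x + A * pd a D x) ^+ 2 / 2) <= 0.
  by have [_] := BM a; rewrite w3 [sqgrad w x]Wq' pd2_eta // pd_eta.
have vz := B1 v z W gv W0 zW; have pz := B1 psi z W gp W0 zW; have Dz := B1 D z W gD W0 zW.
have uzz : pd z (pd z u) x <= - W ^+ 2.
  apply: (curvature_bound K1 A0 b0 b1 W1 v9' v1 uK h0 h11 hb vz pz wzE h2b _ _ Dz (FO z) W9).
    by have := B2 v z z W W gv W0 W0 zW zW; rewrite -expr2.
  by have := B2 psi z z W W gp W0 W0 zW zW; rewrite -expr2.
pose mu a := lin_coef d k l a.
have mu0 a : 0 <= mu a by exact: lin_coef_ge0.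
pose om a := (\sum_i z 0 i * e a 0 i) ^+ 2 / W ^+ 2.
have Wp : 0 < W ^+ 2 by rewrite Wq.
have om0 a : 0 <= om a by rewrite divr_ge0 ?sqr_ge0 // ltW.
have om1 : \sum_a om a = 1.
  by rewrite -mulr_suml parseval zz divff // gt_eqF.
have oml : \sum_a om a * d a <= -1.
  have -> : \sum_a om a * d a = pd z (pd z u) x / W ^+ 2.
    rewrite pdE pdE quad mulr_suml; apply: eq_bigr => a _; rewrite /om; ring.
  by rewrite ler_pdivrMr // mulN1r.
have tr_ge := lin_coef_trace_ge lk kn gam_d om0 om1 oml.
have mean := lin_coef_mean_trace lk kn gam_d om0 om1 oml.
have homog := lin_coef_homog lk kn gam_d.
set M := \sum_a lin_coef d k l a in tr_ge mean.
have wea a : pd (e a) w x = \sum_i z 0 i * e a 0 i.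
  rewrite (pd_coord oU _ (CkLW (isT : (1 <= 3)%N) H_w) Ux); apply: eq_bigr => i _.
  by rewrite mulrC /z gradE.
have DB a : 2 * v x * pd z (pd (e a) (pd (e a) u)) x + (2 * pd z v x + W ^+ 2 * h1) * pd (e a) (pd (e a) u) x
     + W ^+ 2 * (b / 2) * (\sum_i z 0 i * e a 0 i) ^+ 2 <= bnd7 K A * W ^+ 3.
  have b1e g : g = v \/ g = psi \/ g = D -> `|pd (e a) g x| <= K.
    by move=> gg; have := B1 g (e a) 1 gg ler01 (e1 a); rewrite mulr1.
  have b2e g : g = v \/ g = psi \/ g = D -> `|pd (e a) (pd (e a) g) x| <= K.
    by move=> gg; have := B2 g (e a) (e a) 1 1 gg ler01 ler01 (e1 a) (e1 a); rewrite !mulr1.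
  have bz g : g = v \/ g = psi \/ g = D -> `|pd z (pd (e a) g) x| <= K * W.
    by move=> gg; have := B2 g z (e a) W 1 gg W0 ler01 (e1 a) zW; rewrite mulr1.
  have waW : `|\sum_i z 0 i * e a 0 i| <= W.
    apply: absle => //; apply: le_trans (cauchy_schwarz _ _) _.
    by rewrite zz unit_e mulr1.
  apply: (direction_bound K1 A0 b0 b1 W1 v9' v1 uK h0 h11 hb vz pz wzE (b1e v gv) (b2e v gv) (bz v gv) (B3 v (e a) gv (e1 a))
     (b1e psi gp) (bz psi gp) (B3 psi (e a) gp (e1 a)) (b1e D gD) (b2e D gD) waW _ (FO (e a)) (SO (e a))).
  by rewrite -wa wea.
have SB : 2 * v x * pd z f x + (2 * pd z v x + W ^+ 2 * h1) * ((k%:R - l%:R) * f x)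
     + W ^+ 2 * (b / 2) * (\sum_a mu a * (\sum_i z 0 i * e a 0 i) ^+ 2) <= bnd7 K A * W ^+ 3 * M.
  have -> : pd z f x = \sum_a mu a * pd z (pd (e a) (pd (e a) u)) x.
    by rewrite pdE lin; apply: eq_bigr => a _; rewrite !pdE.
  have -> : (k%:R - l%:R) * f x = \sum_a mu a * pd (e a) (pd (e a) u) x.
    by rewrite fE -homog; apply: eq_bigr => a _; rewrite !pdE diag.
  rewrite !mulr_sumr -!big_split /=; apply: ler_sum => a _.
  have := ler_wpM2l (mu0 a) (DB a); rewrite [mu a * (_ * _ ^+ 3)]mulrC; apply: le_trans.
  by rewrite le_eqVlt; apply/orP; left; apply/eqP; rewrite /mu; ring.
have kl0 : 0 <= k%:R - l%:R :> R by rewrite subr_ge0 ler_nat ltnW.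
have kln : k%:R - l%:R <= n%:R :> R.
  by rewrite lerBlDr -natrD ler_nat; apply: leq_trans kn _; exact: leq_addr.
have klf0 : 0 <= (k%:R - l%:R) * f x by rewrite mulr_ge0 // ltW.
have fz : `|pd z f x| <= DF * W.
  rewrite (pd_coord oU _ Hf Ux); apply: absle; first exact: mulr_ge0.
  apply: le_trans (cauchy_schwarz _ _) _; rewrite zz exprMn mulrC ler_wpM2r ?exprn_ge0 //.
  have -> : \sum_i pd (e_ i) f x ^+ 2 = enorm (grad f x) ^+ 2.
    rewrite /enorm sqr_sqrtr; last by apply: sumr_ge0 => i _; exact: sqr_ge0.
    by apply: eq_bigr => i _; rewrite gradE.
  by rewrite ler_pXn2r ?nnegrE ?sqrtr_ge0.
have MQ : \sum_a mu a * (\sum_i z 0 i * e a 0 i) ^+ 2 = W ^+ 2 * \sum_a om a * lin_coef d k l a.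
  by rewrite mulr_sumr; apply: eq_bigr => a _; rewrite /om /mu; field; rewrite gt_eqF // (lt_le_trans ltr01).
apply: (bernstein_conclusion n0 b0 W1 S10 bnd70 tr_ge).
have P1 : W ^+ 2 * (b / 2) * (n%:R^-1 ^+ 2 * W ^+ 2 * M) <= W ^+ 2 * (b / 2) * (W ^+ 2 * \sum_a om a * lin_coef d k l a).
  rewrite ler_wpM2l //; first by rewrite mulr_ge0 ?exprn_ge0 // divr_ge0 // ltW.
  have -> : n%:R^-1 ^+ 2 * W ^+ 2 * M = W ^+ 2 * (n%:R^-1 ^+ 2 * M) by rewrite mulrAC mulrC.
  by apply: ler_wpM2l; [exact: exprn_ge0|exact: mean].
apply: (le_trans P1); rewrite -MQ.
have P2 : `|v x * pd z f x| <= DF * W.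
  rewrite normrM; apply: le_trans fz; rewrite ler_piMl ?normr_ge0 //.
  by rewrite ger0_norm //; apply: le_trans v9'; rewrite divr_ge0.
have P3 : `|pd z v x * ((k%:R - l%:R) * f x)| <= K * W * (n%:R * sF).
  apply: normM_le => //; rewrite ger0_norm //; apply: ler_pM => //; exact: ltW.
have P4 : 0 <= W ^+ 2 * h1 * ((k%:R - l%:R) * f x) by apply: mulr_ge0 => //; apply: mulr_ge0 => //; exact: exprn_ge0.
move: P2 P3 SB; rewrite !ler_norml => /andP[P2 _] /andP[P3 _] SB.
have -> : S1 * W = 2 * (DF * W + K * W * (n%:R * sF)) by rewrite /S1; ring.
exact: (combine_terms P2 P3 P4 SB).
Qed.

End Interior.

(** * Boundary charts and tangential derivatives *)

Section Chart.
Variables (R : realType) (n : nat) (Om : set 'rV[R]_n) (oOm : open Om) (x0 : 'rV[R]_n).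
Variables (i : 'I_n) (s : bool) (g : 'rV[R]_n.-1 -> R).
Hypotheses (bx0 : bdry Om x0) (chart : graph_chart 1 Om x0 i s g).
Implicit Types (x y v tau : 'rV[R]_n) (z : 'rV[R]_n.-1) (r : R).

Lemma within_dist (f : 'rV[R]_n -> R) (b : 'rV[R]_n) (l : R) : f y @[y --> within Om (nbhs b)] --> l ->
  forall e : R, 0 < e -> exists2 d : R, 0 < d & forall y, Om y -> `|y - b| < d -> `|f y - l| <= e.
Proof.
move=> /cvgrPdist_le H e e0; have := H e e0; rewrite near_withinE => K.
have [d d0 Hd] := near_dist K; exists d => // y Oy yb.
by rewrite distrC; exact: Hd.
Qed.

Lemma near_dist_intro (P : set 'rV[R]_n) (b : 'rV[R]_n) (d : R) : 0 < d -> (forall y, `|y - b| < d -> P y) ->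
  \forall y \near b, P y.
Proof.
move=> d0 H; apply/nbhs_ballP; exists d => //= y; rewrite -ball_normE /ball_ /= distrC.
exact: H.
Qed.

Let sg : R := (-1) ^+ s.
Let sgsg : sg * sg = 1. Proof. by rewrite /sg -expr2 sqrr_sign. Qed.
Let sgn1 : `|sg| = 1. Proof. by rewrite /sg normr_sign. Qed.

Definition chart_pt z r : 'rV[R]_n :=
  \row_j if unlift i j is Some j' then z 0 j' else sg * (g z + r).

Lemma chart_pt_col z r : col' i (chart_pt z r) = z.
Proof. by apply/rowP => j; rewrite !mxE liftK. Qed.

Lemma chart_pt_height z r : sg * chart_pt z r 0 i = g z + r.
Proof. by rewrite mxE unlift_none mulrA sgsg mul1r. Qed.

Lemma chart_ptK y : chart_pt (col' i y) (sg * y 0 i - g (col' i y)) = y.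
Proof.
apply/rowP => j; rewrite mxE; case: unliftP => [j' ->|->]; first by rewrite mxE.
by rewrite addrC subrK mulrA sgsg mul1r.
Qed.

Lemma chart_pt_shift z r r' : `|chart_pt z r - chart_pt z r'| <= `|r - r'|.
Proof.
apply: norm_le_coord => // j; rewrite !mxE; case: unliftP => [j' _|_].
  by rewrite subrr normr0.
have -> : sg * (g z + r) - sg * (g z + r') = sg * (r - r') by ring.
by rewrite normrM sgn1 mul1r.
Qed.

Let g_C1 : CkL 1 [set: 'rV[R]_n.-1] set0 g.
Proof. by apply: Ck_CkL; case: chart. Qed.

Lemma chart_iff : exists2 d, 0 < d & forall y, `|y - x0| < d ->
  (Om y <-> g (col' i y) < sg * y 0 i).
Proof. by case: chart => _ /near_dist. Qed.

Lemma chart_pt_near (d : R) : 0 < d -> exists2 e, 0 < e & forall z r r0,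
  r0 = sg * x0 0 i - g (col' i x0) ->
  `|z - col' i x0| < e -> `|r - r0| < e -> `|chart_pt z r - x0| < d.
Proof.
move=> d0; have d20 : 0 < d / 2 by rewrite divr_gt0.
have d40 : 0 < d / 2 / 2 by rewrite divr_gt0.
have [e e0 He] := near_dist ((cvgrPdist_le _ _).1 (CkL_cont g_C1 (I : setT (col' i x0))) _ d40).
exists (Num.min e (d / 2 / 2)); first by rewrite lt_min e0 d40.
move=> z r r0 r0E; rewrite !lt_min => /andP[z1 z2] /andP[_ r2].
apply: (@le_lt_trans _ _ (d / 2)); last by rewrite ltr_pdivrMr // ltr_pMr // ltr1n.
rewrite -[X in _ - X]chart_ptK -r0E; apply: norm_le_coord; first exact: ltW.
move=> j; rewrite !mxE; case: unliftP => [j' _|_].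
  have := coord_le_norm (z - col' i x0) j'; rewrite !mxE => h.
  by apply: (le_trans h); apply: ltW; apply: lt_trans z2 _; rewrite ltr_pdivrMr // ltr_pMr // ltr1n.
have -> : sg * (g z + r) - sg * (g (col' i x0) + r0) = sg * ((r - r0) - (g (col' i x0) - g z)) by ring.
rewrite normrM sgn1 mul1r [leRHS]splitr; apply: normB_le; first exact: ltW.
exact: He.
Qed.

Lemma col'_cont (y0 : 'rV[R]_n) : col' i y @[y --> y0] --> col' i y0.
Proof.
apply/(@cvgrPdist_le _ _ _ (nbhs y0) (nbhs_filter y0)) => e e0.
apply: (near_dist_intro e0) => y yx.
apply: norm_le_coord => [|j]; first exact: ltW.
rewrite !mxE; have := coord_le_norm (y - y0) (lift i j); rewrite !mxE distrC => h'.
by apply: le_trans h' _; apply: ltW.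
Qed.

Lemma bdry_notin b : bdry Om b -> ~ Om b.
Proof. by move=> [_ nb] Ob; apply: nb; rewrite /interior; exact: open_nbhs_nbhs. Qed.

Lemma bdry_height0 : sg * x0 0 i = g (col' i x0).
Proof.
have [d d0 Hd] := chart_iff; apply/eqP; rewrite eq_le; apply/andP; split; rewrite leNgt; apply/negP => h.
  by apply: (bdry_notin bx0); apply/Hd => //; rewrite subrr normr0.
have [clx _] := bx0.
have r0 : 0 < g (col' i x0) - sg * x0 0 i by rewrite subr_gt0.
have cont : (fun y : 'rV[R]_n => g (col' i y) - sg * y 0 i) y @[y --> x0] --> g (col' i x0) - sg * x0 0 i.
  have ci : y 0 i @[y --> x0] --> x0 0 i by exact: (@coord_continuous _ 1 n 0 i x0).
  exact: (cvgB (cvg_comp _ _ (@col'_cont x0) (CkL_cont g_C1 I)) (cvgM (cvg_cst sg) ci)).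
have [d1 d10 H1] := near_dist ((cvgrPdist_lt _ _).1 cont _ r0).
have : nbhs x0 (fun y => `|y - x0| < Num.min d d1) by apply: (@near_dist_intro _ x0 (Num.min d d1)); rewrite ?lt_min ?d0.
move=> /clx[y [Oy]]; rewrite lt_min => /andP[y1 y2].
have := H1 y y2; rewrite ltr_distl => /andP[_].
have := (Hd y y1).1 Oy; lra.
Qed.

Lemma chart_pt_near0 (d : R) : 0 < d -> exists2 e, 0 < e & forall z r,
  `|z - col' i x0| < e -> `|r| < e -> `|chart_pt z r - x0| < d.
Proof.
move=> d0; have [e e0 H] := chart_pt_near d0; exists e => // z r zr re.
by apply: (H z r 0) => //; rewrite ?bdry_height0 ?subrr ?subr0.
Qed.

Lemma chart_pt_in : exists2 e, 0 < e & forall z r, `|z - col' i x0| < e -> `|r| < e ->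
  (0 < r -> Om (chart_pt z r)) /\ bdry Om (chart_pt z 0).
Proof.
have [d d0 Hd] := chart_iff; have [e e0 He] := chart_pt_near0 d0.
have inOm z r : `|z - col' i x0| < e -> `|r| < e -> (Om (chart_pt z r) <-> 0 < r).
  move=> ze re; have := Hd _ (He z r ze re); rewrite chart_pt_col chart_pt_height.
  by rewrite ltrDl.
exists e => // z r ze re; split; first by move=> r0; apply/inOm.
split.
  move=> A /near_dist[a a0 Ha].
  pose r' := Num.min a e / 2.
  have m0 : 0 < Num.min a e by rewrite lt_min a0 e0.
  have r'0 : 0 < r' by rewrite divr_gt0.
  have : r' < Num.min a e by rewrite ltr_pdivrMr // ltr_pMr // ltr1n.
  rewrite lt_min => /andP[ra re'].
  exists (chart_pt z r'); split.
    by apply/inOm => //; rewrite gtr0_norm.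
  apply: Ha; apply: le_lt_trans (chart_pt_shift _ _ _) _.
  by rewrite subr0 gtr0_norm.
move=> h; have : Om (chart_pt z 0) by exact: nbhs_singleton h.
by move/(inOm z 0 ze _).1; rewrite normr0 ltxx => /(_ e0).
Qed.

(** The direction [tau] is tangent to the boundary at [x0] when its slope equals
    its vertical component. *)
Definition slope (tau : 'rV[R]_n) z : R := \sum_j tau 0 (lift i j) * pd (delta_mx 0 j) g z.

Lemma slope_dir tau z : slope tau z = 'D_(col' i tau) g z.
Proof.
rewrite (CkL_DvE (col' i tau) openT g_C1 I); apply: eq_bigr => j _.
by rewrite mxE pdE.
Qed.

Lemma chart_curve (U1 : set 'rV[R]_n) (p : 'rV[R]_n -> R) tau r t : open U1 -> CkL 1 U1 set0 p ->
  U1 (chart_pt (col' i x0 + t *: col' i tau) r) ->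
  is_derive t 1 (fun t => p (chart_pt (col' i x0 + t *: col' i tau) r))
    (\sum_j (if unlift i j is Some j' then tau 0 (lift i j') else sg * slope tau (col' i x0 + t *: col' i tau))
      * pd (delta_mx 0 j) p (chart_pt (col' i x0 + t *: col' i tau) r)).
Proof.
move=> oU1 Hp Up.
pose c t := chart_pt (col' i x0 + t *: col' i tau) r.
pose c' : 'rV[R]_n := \row_j (if unlift i j is Some j' then tau 0 (lift i j') else sg * slope tau (col' i x0 + t *: col' i tau)).
have dc j : is_derive t 1 (fun s => c s 0 j) (c' 0 j).
  rewrite mxE; case: unliftP => [j' ->|->].
    have -> : (fun s => c s 0 (lift i j')) = (fun a => x0 0 (lift i j') + tau 0 (lift i j') *: a).
      by apply/funext => a; rewrite /c !mxE liftK !mxE [_ *: a]mulrC.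
    have H : is_derive t 1 (fun a => x0 0 (lift i j') + tau 0 (lift i j') *: a) (0 + tau 0 (lift i j') *: 1).
      by apply: is_deriveD.
    by rewrite add0r [_ *: 1]mulr1 in H.
  have -> : (fun s => c s 0 i) = (fun a => sg * (g (col' i x0 + a *: col' i tau) + r)).
    by apply/funext => a; rewrite /c !mxE unlift_none.
  have dg : is_derive t 1 (fun a => g (col' i x0 + a *: col' i tau)) (slope tau (col' i x0 + t *: col' i tau)).
    by rewrite slope_dir; apply: derive_line; exact: (CkL_derivable openT g_C1).
  have dg2 : is_derive t 1 (fun a => g (col' i x0 + a *: col' i tau) + r) (slope tau (col' i x0 + t *: col' i tau) + 0).
    by apply: is_deriveD.
  rewrite addr0 in dg2.
  exact: (@is_deriveZ _ _ _ (fun a : R => g (col' i x0 + a *: col' i tau) + r) sg t 1 _ dg2).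
apply: (is_derive_eq (@C1_curve _ _ U1 p c c' t oU1 (CkL_Ck Hp) Up dc)); apply: eq_bigr => j _.
by rewrite mxE pdE.
Qed.

(** The increment of [p] along a curve at height [r] over the boundary tends to 0
    with [r], because [p] tends to 0 at the boundary; by the mean value theorem it
    is the length of the curve times a number close to [\sum_j tau_j P_j]. *)
Lemma tangential_derivative (U1 : set 'rV[R]_n) (p : 'rV[R]_n -> R) (P : 'I_n -> R) tau :
  open U1 -> CkL 1 U1 set0 p -> (\forall y \near x0, Om y -> U1 y) ->
  (forall j, pd (delta_mx 0 j) p y @[y --> within Om (nbhs x0)] --> P j) ->
  (\forall b \near x0, bdry Om b -> p y @[y --> within Om (nbhs b)] --> (0 : R)) ->
  slope tau (col' i x0) = sg * tau 0 i ->
  \sum_j tau 0 j * P j = 0.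
Proof.
move=> oU1 Hp nU1 limP lim0 tang.
pose T := 1 + \sum_j `|tau 0 j|; pose Q := 1 + \sum_j `|P j|.
have T0 : 0 < T by rewrite ltr_pwDl // sumr_ge0.
have Q0 : 0 < Q by rewrite ltr_pwDl // sumr_ge0.
have tT j : `|tau 0 j| <= T.
  by rewrite /T (bigD1 j) //= addrCA lerDl addr_ge0 // sumr_ge0.
have PQ j : `|P j| <= Q.
  by rewrite /Q (bigD1 j) //= addrCA lerDl addr_ge0 // sumr_ge0.
suff main e : 0 < e -> e <= 1 -> `|\sum_j tau 0 j * P j| <= e * (n%:R * (T + 1 + Q) + 2).
  apply/eqP; rewrite -normr_le0; apply/ler_addgt0Pr => a a0; rewrite add0r.
  have C0 : 0 < n%:R * (T + 1 + Q) + 2 by have TQ : 0 <= T + 1 + Q; [lra | rewrite ltr_wpDl // mulr_ge0].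
  have := main (Num.min 1 (a / (n%:R * (T + 1 + Q) + 2))).
  rewrite lt_min ltr01 divr_gt0 // ge_min lexx => /(_ isT isT) h; apply: (le_trans h).
  by rewrite -ler_pdivlMr // ge_min lexx orbT.
move=> e0 e1.
have [d1 d10 H1] := near_dist nU1.
have [d2 d20 H2] := near_dist lim0.
have [d3 d30 H3] : exists2 d, 0 < d & forall y, Om y -> `|y - x0| < d -> forall j, `|pd (delta_mx 0 j) p y - P j| <= e.
  have H : \forall y \near x0, forall j, Om y -> `|pd (delta_mx 0 j) p y - P j| <= e.
    apply: (@filter_forall _ _ _ _ (nbhs_filter x0)) => j.
    by have [d d0 Hd] := within_dist (limP j) e0; apply: (near_dist_intro d0) => y yx Oy; exact: Hd.
  by have [d d0 Hd] := near_dist H; exists d => // y Oy yx j; exact: Hd.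
have slope_cont : slope tau z @[z --> col' i x0] --> slope tau (col' i x0).
  apply: (@cvg_bigsum _ _ _ (nbhs (col' i x0)) (nbhs_filter (col' i x0))) => j; apply: cvgMl_tmp; exact: (CkL_cont (CkL_pd openT (delta_mx 0 j) g_C1) I).
have [d4 d40 H4] := near_dist ((cvgrPdist_le _ _).1 slope_cont _ e0).
have [d5 d50 H5] := chart_pt_in.
have d123 : 0 < Num.min d1 (Num.min d2 d3) by rewrite !lt_min d10 d20 d30.
have [d6 d60 H6] := chart_pt_near0 d123.
pose d := Num.min d4 (Num.min d5 d6).
have d0 : 0 < d by rewrite !lt_min d40 d50 d60.
pose t := d / 2 / (n%:R * T + 1).
have nT : 0 < n%:R * T + 1 by rewrite ltr_wpDl // mulr_ge0 // ltW.
have t0 : 0 < t by rewrite !divr_gt0.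
have near_z a : 0 <= a <= t -> `|(col' i x0 + a *: col' i tau) - col' i x0| < d.
  move=> /andP[a0 at_]; rewrite addrAC subrr add0r normrZ ger0_norm //.
  apply: (@le_lt_trans _ _ (t * (n%:R * T + 1))); last first.
    by rewrite /t divfK ?gt_eqF // ltr_pdivrMr // ltr_pMr // ltr1n.
  apply: ler_pM => //; apply: norm_le_coord => [|j]; first exact: ltW.
  rewrite mxE; apply: (le_trans (tT _)); apply: (@le_trans _ _ (n%:R * T)); last by rewrite lerDl.
  by rewrite ler_peMl ?(ltW T0) // ler1n (leq_ltn_trans _ (ltn_ord i)).
have dmin y : `|y| < d -> [/\ `|y| < d4, `|y| < d5 & `|y| < d6] by rewrite !lt_min => /andP[-> /andP[-> ->]].
have dmin' (y : 'rV[R]_n.-1) : `|y| < d -> [/\ `|y| < d4, `|y| < d5 & `|y| < d6] by rewrite !lt_min => /andP[-> /andP[-> ->]].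
have pt_ok a r : 0 <= a <= t -> 0 < r -> r < d -> let y := chart_pt (col' i x0 + a *: col' i tau) r in
   [/\ Om y, U1 y & forall j, `|pd (delta_mx 0 j) p y - P j| <= e].
  move=> at_ r0 rd y; have [z4 z5 z6] := dmin' _ (near_z a at_).
  have rn : `|r| < d by rewrite gtr0_norm.
  have [r4 r5 r6] : [/\ `|r| < d4, `|r| < d5 & `|r| < d6] by move: rn; rewrite !lt_min => /andP[-> /andP[-> ->]].
  have Oy : Om y by exact: (H5 _ _ z5 r5).1.
  have := H6 _ _ z6 r6; rewrite !lt_min => /andP[y1 /andP[y2 y3]].
  split=> //; [exact: (H1 _ y1 Oy)|exact: H3].
have bd_ok a : 0 <= a <= t -> forall e', 0 < e' -> exists2 c, 0 < c & forall r, 0 < r -> r < c -> r < d -> `|p (chart_pt (col' i x0 + a *: col' i tau) r)| <= e'.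
  move=> at_ e' e'0; have [z4 z5 z6] := dmin' _ (near_z a at_).
  have n0 (c : R) : 0 < c -> `|0 : R| < c by rewrite normr0.
  have := H6 _ 0 z6 (n0 _ d60); rewrite !lt_min => /andP[y1 /andP[y2 y3]].
  have [c c0 Hc] := within_dist (H2 _ y2 (H5 _ _ z5 (n0 _ d50)).2) e'0.
  exists c => // r r0 rc rd; rewrite -[X in `|X|]subr0; apply: Hc.
    by have [] := pt_ok a r at_ r0 rd.
  by apply: le_lt_trans (chart_pt_shift _ _ _) _; rewrite subr0 gtr0_norm.
have te0 : 0 < t * e by rewrite mulr_gt0.
have t00 : 0 <= (0 : R) <= t by rewrite lexx ltW.
have tt0 : 0 <= t <= t by rewrite lexx ltW.
have [c1 c10 Hc1] := bd_ok 0 t00 _ te0; have [c2 c20 Hc2] := bd_ok t tt0 _ te0.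
pose r := Num.min d (Num.min c1 c2) / 2.
have m0 : 0 < Num.min d (Num.min c1 c2) by rewrite lt_min d0 lt_min c10.
have r0 : 0 < r by rewrite divr_gt0.
have : r < Num.min d (Num.min c1 c2) by rewrite ltr_pdivrMr // ltr_pMr // ltr1n.
rewrite lt_min => /andP[rd]; rewrite lt_min => /andP[rc1 rc2].
pose phi a := p (chart_pt (col' i x0 + a *: col' i tau) r).
pose dphi a := \sum_j (if unlift i j is Some j' then tau 0 (lift i j') else sg * slope tau (col' i x0 + a *: col' i tau))
      * pd (delta_mx 0 j) p (chart_pt (col' i x0 + a *: col' i tau) r).
have dphiP a : 0 <= a <= t -> is_derive a 1 phi (dphi a).
  by move=> at_; have [_ Uy _] := pt_ok a r at_ r0 rd; exact: (chart_curve oU1 Hp Uy).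
have [a|a|a] := @MVT R phi dphi 0 t t0.
- by rewrite in_itv /= => /andP[a0 a1]; apply: dphiP; rewrite !ltW.
- apply: derivable_within_continuous => b; rewrite in_itv /= => bt.
  by have [] := dphiP b bt.
rewrite in_itv /= subr0 => /andP[a0 a1] E.
have at_ : 0 <= a <= t by rewrite !ltW.
have [Oy Uy Py] := pt_ok a r at_ r0 rd.
have [z4 _ _] := dmin' _ (near_z a at_).
have sl := H4 _ z4.
have S1 : `|dphi a - \sum_j tau 0 j * P j| <= e * (n%:R * (T + 1 + Q)).
  rewrite /dphi -sumrB; apply: le_trans (ler_norm_sum _ _ _) _.
  have -> : e * (n%:R * (T + 1 + Q)) = \sum_(j < n) e * (T + 1 + Q).
    by rewrite sumr_const card_ord -mulr_natl; ring.
  apply: ler_sum => j _; have pj := Py j.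
  set c := (if _ is Some _ then _ else _); set y := chart_pt _ _ in pj *.
  have cj : `|c - tau 0 j| <= e.
    rewrite /c; case: unliftP => [j' ->|->]; first by rewrite subrr normr0 ltW.
    have -> : sg * slope tau (col' i x0 + a *: col' i tau) - tau 0 i
      = - (sg * (slope tau (col' i x0) - slope tau (col' i x0 + a *: col' i tau))).
      by rewrite tang mulrBr mulrA sgsg mul1r opprB.
    by rewrite normrN normrM sgn1 mul1r.
  have -> : c * pd (delta_mx 0 j) p y - tau 0 j * P j =
     (c - tau 0 j) * P j + (c - tau 0 j) * (pd (delta_mx 0 j) p y - P j) + tau 0 j * (pd (delta_mx 0 j) p y - P j).
    by ring.
  have -> : e * (T + 1 + Q) = e * Q + e * 1 + T * e by ring.
  apply: normD_le; last exact: normM_le.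
  apply: normD_le; apply: normM_le => //; exact: le_trans pj e1.
have S2 : `|dphi a| <= 2 * e.
  rewrite -(ler_pM2r t0) -[X in _ * X <= _](gtr0_norm t0) -normrM -E.
  have -> : 2 * e * t = t * e + t * e by ring.
  apply: normB_le; [exact: Hc2|exact: Hc1].
have -> : \sum_j tau 0 j * P j = dphi a - (dphi a - \sum_j tau 0 j * P j) by ring.
have -> : e * (n%:R * (T + 1 + Q) + 2) = 2 * e + e * (n%:R * (T + 1 + Q)) by ring.
exact: normB_le.
Qed.

End Chart.

(** * Euclidean norm and regularity up to the closure *)

Section Enorm.
Variables (R : realType) (n : nat).
Implicit Types (x y z : 'rV[R]_n).

Lemma enorm_ge0 x : 0 <= enorm x. Proof. exact: sqrtr_ge0. Qed.

Lemma enorm_sq x : enorm x ^+ 2 = \sum_i x 0 i ^+ 2.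
Proof. by rewrite sqr_sqrtr // sumr_ge0 // => i _; exact: sqr_ge0. Qed.

Lemma sqr_le_le (a b : R) : 0 <= b -> a ^+ 2 <= b ^+ 2 -> a <= b.
Proof.
by move=> b0 h; apply: le_trans (ler_norm a) _; rewrite -(@ler_pXn2r _ 2) ?nnegrE // real_normK ?num_real.
Qed.

Lemma dot_le_enorm x y : \sum_i x 0 i * y 0 i <= enorm x * enorm y.
Proof.
apply: sqr_le_le; first by rewrite mulr_ge0 ?enorm_ge0.
by rewrite exprMn !enorm_sq cauchy_schwarz.
Qed.

Lemma coord_le_enorm x i : `|x 0 i| <= enorm x.
Proof.
apply: sqr_le_le; first exact: enorm_ge0.
by rewrite real_normK ?num_real // enorm_sq (bigD1 i) //= lerDl sumr_ge0 // => j _; exact: sqr_ge0.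
Qed.

Lemma norm_le_enorm x : `|x| <= enorm x.
Proof. by apply: norm_le_coord; [exact: enorm_ge0|exact: coord_le_enorm]. Qed.

Lemma enorm_le_norm x : enorm x <= n%:R * `|x|.
Proof.
apply: sqr_le_le; first by rewrite mulr_ge0.
rewrite enorm_sq exprMn.
apply: (@le_trans _ _ (\sum_(i < n) `|x| ^+ 2)).
  apply: ler_sum => i _; rewrite -[leLHS]real_normK ?num_real // ler_pXn2r ?nnegrE //.
  exact: coord_le_norm.
rewrite sumr_const card_ord -[leLHS]mulr_natl ler_wpM2r ?sqr_ge0 //.
by rewrite -natrX ler_nat; case: (n) => // m; rewrite leq_pmulr.
Qed.

Lemma enormD x y : enorm (x + y) <= enorm x + enorm y.
Proof.
apply: sqr_le_le; first by rewrite addr_ge0 ?enorm_ge0.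
have := dot_le_enorm x y; rewrite sqrrD !enorm_sq.
have -> : \sum_i (x + y) 0 i ^+ 2 = \sum_i x 0 i ^+ 2 + 2 * (\sum_i x 0 i * y 0 i) + \sum_i y 0 i ^+ 2.
  by rewrite mulr_sumr -!big_split; apply: eq_bigr => i _; rewrite mxE /=; ring.
by rewrite mulr2n => h; lra.
Qed.

Lemma enormN x : enorm (- x) = enorm x.
Proof. by rewrite /enorm; congr Num.sqrt; apply: eq_bigr => i _; rewrite mxE sqrrN. Qed.

Lemma enormZ (c : R) x : enorm (c *: x) = `|c| * enorm x.
Proof.
rewrite /enorm -[`|c|]sqrtr_sqr -sqrtrM ?sqr_ge0 //; congr Num.sqrt.
by rewrite mulr_sumr; apply: eq_bigr => i _; rewrite mxE exprMn.
Qed.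

Lemma enorm_near x (e : R) : 0 < e ->
  exists2 d : R, 0 < d & forall y, `|y - x| < d -> enorm (y - x) <= e.
Proof.
move=> e0; exists (e / n.+1%:R); first by rewrite divr_gt0.
move=> y yx; apply: (le_trans (enorm_le_norm _)).
apply: (@le_trans _ _ (n.+1%:R * `|y - x|)); first by rewrite ler_wpM2r // ler_nat.
by rewrite mulrC -ler_pdivlMr // ltW.
Qed.

Lemma enorm_gt0 x : x != 0 -> 0 < enorm x.
Proof. by move=> x0; apply: lt_le_trans (norm_le_enorm x); rewrite normr_gt0. Qed.

End Enorm.

Section Extension.
Variables (R : realType) (n : nat).
Implicit Types (f g : 'rV[R]_n -> R) (x y : 'rV[R]_n) (U S : set 'rV[R]_n).

Lemma closure_dist U x d : closure U x -> 0 < d -> exists2 y, U y & `|y - x| < d.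
Proof.
move=> cx d0; have := cx [set y | `|y - x| < d] (near_dist_intro d0 (fun y h => h)).
by move=> [y [Uy yd]]; exists y.
Qed.

Lemma within_proper U x : closure U x -> ProperFilter (within U (nbhs x)).
Proof.
move=> cx; apply: Build_ProperFilter.
rewrite /within /= => /near_dist[d d0 H]; have [y Uy yd] := closure_dist cx d0.
exact: (H y yd Uy).
Qed.

Lemma dist_within (f : 'rV[R]_n -> R) U x (l : R) :
  (forall e : R, 0 < e -> exists2 d : R, 0 < d & forall y, U y -> `|y - x| < d -> `|f y - l| <= e) ->
  f y @[y --> within U (nbhs x)] --> l.
Proof.
move=> H; apply/cvgrPdist_le => e e0; rewrite near_withinE.
have [d d0 Hd] := H e e0; apply: (near_dist_intro d0) => y yx Uy.
by rewrite distrC; exact: Hd.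
Qed.

Lemma closure_extension U f : open U -> (forall x, U x -> f y @[y --> x] --> f x) ->
  (forall x, closure U x -> has_limit U x f) ->
  exists F : 'rV[R]_n -> R, [/\ {within closure U, continuous F},
    forall x, U x -> F x = f x & forall x, closure U x -> f y @[y --> within U (nbhs x)] --> F x].
Proof.
move=> oU fc fl.
have ex x : exists l : R, closure U x -> f y @[y --> within U (nbhs x)] --> l.
  by have [cx|ncx] := pselect (closure U x); [have [l] := fl x cx; exists l|exists 0].
have [F HF] := choice ex; exists F; split; last exact: HF.
  apply/subspace_continuousP => x cx; apply: dist_within => e e0.
  have e2 : 0 < e / 2 by rewrite divr_gt0.
  have [d d0 Hd] := within_dist (HF x cx) e2.
  have d20 : 0 < d / 2 by rewrite divr_gt0.
  exists (d / 2) => // x' cx' x'x.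
  have [d' d'0 Hd'] := within_dist (HF x' cx') e2.
  have m0 : 0 < Num.min d' (d / 2) by rewrite lt_min d'0.
  have [y Uy] := closure_dist cx' m0; rewrite lt_min => /andP[y1 y2].
  have h1 := Hd' y Uy y1.
  have h2 : `|f y - F x| <= e / 2.
    apply: Hd => //; rewrite [d]splitr.
    have -> : y - x = (y - x') + (x' - x) by rewrite addrA subrK.
    by apply: le_lt_trans (ler_normD _ _) (ltrD y2 x'x).
  by apply: (@dist_half _ _ _ (f y)); rewrite distrC.
move=> x Ux; have cx : closure U x := subset_closure Ux.
have PF := within_proper cx.
have L : f y @[y --> within U (nbhs x)] --> f x.
  by apply: cvg_trans (fc x Ux); apply: cvg_app; exact: cvg_within.
exact: (cvg_unique _ (HF x cx) L).
Qed.

Lemma Ck_upto_CkL k U f : Ck_upto k U f -> CkL k U (closure U) f.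
Proof.
move=> [H1 _ H3] s x; split=> sk.
- by move=> Ux; have [h _] := H1 s x Ux; exact: h.
- move=> cx; have [g [/subspace_continuousP gc gE]] := H3 s sk.
  exists (g x); apply: dist_within => e e0.
  have [d d0 Hd] := within_dist (gc x cx) e0.
  exists d => // y Uy yx; change (`|pderivs s f y - g x| <= e); rewrite -(gE y Uy); apply: Hd => //; exact: subset_closure.
- by move=> Ux i; have [_ h] := H1 s x Ux; exact: h.
Qed.

Lemma CkL_Ck_upto k f U : CkL k [set: 'rV[R]_n] set0 f -> Ck_upto k U f.
Proof.
move=> H; have c s : (size s <= k)%N -> {within closure U, continuous (pderivs s f)}.
  by move=> sk; apply: continuous_subspaceT => x; have [h _ _] := H s x; exact: h.
split; first by apply: Ck_in_sub (CkL_Ck H).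
  exact: (c [::]).
by move=> s sk; exists (pderivs s f); split=> //; exact: c.
Qed.

Lemma bounded_closure U : bounded_set U -> bounded_set (closure U).
Proof.
move=> [M [Mr HM]]; exists M; split=> // r Mr' x cx.
apply/ler_addgt0Pr => e e0; have [y Uy yx] := closure_dist cx e0.
have -> : x = y - (y - x) by rewrite opprB addrC subrK.
apply: le_trans (ler_normB _ _) _; apply: lerD; first exact: HM.
exact: ltW.
Qed.

Lemma closure_compact U : bounded_set U -> compact (closure U).
Proof.
move=> bU; apply: bounded_closed_compact; [exact: bounded_closure|exact: closed_closure].
Qed.

Lemma CkL_bounded k U f s : open U -> bounded_set U -> CkL k U (closure U) f -> (size s <= k)%N ->
  exists C : R, forall x, U x -> `|pderivs s f x| <= C.
Proof.
move=> oU bU H sk.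
have [F [Fc FE _]] := closure_extension oU (fun x Ux => let: And3 h _ _ := H s x in h sk Ux)
  (fun x cx => let: And3 _ h _ := H s x in h sk cx).
have [M [Mr HM]] := compact_bounded (continuous_compact Fc (closure_compact bU)).
exists (M + 1) => x Ux; rewrite -FE //.
apply: (HM (M + 1)); first by rewrite ltrDl.
by exists x => //; exact: subset_closure.
Qed.

Lemma Ck_norm_bound k U f s x : open U -> bounded_set U -> CkL k U (closure U) f -> (size s <= k)%N ->
  U x -> `|pderivs s f x| <= Ck_norm k U f.
Proof.
move=> oU bU H sk Ux.
pose V (j : nat) := [set r : R | exists (s0 : seq 'I_n) (x0 : 'rV[R]_n),
  [/\ size s0 = j, U x0 & r = `|pderivs s0 f x0| ] ].
have ub j : (j <= k)%N -> has_ubound (V j).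
  move=> jk; have ex (t : j.-tuple 'I_n) : exists C : R, forall x, U x -> `|pderivs t f x| <= C.
    by apply: (CkL_bounded oU bU H); rewrite size_tuple.
  have [C HC] := choice ex.
  exists (\sum_(t : j.-tuple 'I_n) `|C t|) => _ [s0 [y [sj Uy ->]]].
  pose t : j.-tuple 'I_n := @Tuple _ _ s0 (introT eqP sj).
  apply: (le_trans (HC t y Uy)); apply: (le_trans (ler_norm _)).
  by rewrite (bigD1 t) //= lerDl sumr_ge0.
have supV (j : 'I_k.+1) : 0 <= sup (V j).
  have [->|/set0P[r hr]] := eqVneq (V j) set0; first by rewrite sup0.
  apply: le_trans (ub_le_sup (ub j (ltn_ord j)) hr).
  by have [s0 [y [_ _ ->]]] := hr.
apply: (@le_trans _ _ (sup (V (size s)))); first by apply: (ub_le_sup (ub _ sk)); exists s, x.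
rewrite /Ck_norm (bigD1 (inord (size s))) //= inordK //.
by rewrite lerDl; apply: sumr_ge0 => j _; exact: supV.
Qed.

End Extension.

(** * The normal direction *)

Lemma is_derive_neg (R : realType) (h : R -> R) (l : R) : is_derive (0 : R) 1 h l -> l < 0 ->
  exists2 t0 : R, 0 < t0 & forall t : R, 0 < t -> t < t0 -> h t < h 0.
Proof.
move=> [dh hE] l0.
have H : (fun k : R => k^-1 *: (h (k *: 1 + 0) - h 0)) @ 0^' --> l by rewrite -hE; exact: dh.
have lN : 0 < - l by rewrite oppr_gt0.
move: H => /cvgrPdist_lt/(_ _ lN)[t0 /= t00 Ht].
exists t0 => // t tp tt.
have := Ht t; rewrite /= sub0r normrN gtr0_norm // => /(_ tt (lt0r_neq0 tp)).
rewrite addr0 [t *: _]mulr1 => h1.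
have : t^-1 *: (h t - h 0) < 0.
  by have := ler_norm (t^-1 *: (h t - h 0) - l); rewrite distrC => h2; have := le_lt_trans h2 h1; lra.
by rewrite [_ *: _]/(_ * _) pmulr_rlt0 ?invr_gt0 // subr_lt0.
Qed.

Section Normal.
Variables (R : realType) (n : nat) (Om : set 'rV[R]_n) (oOm : open Om) (x0 : 'rV[R]_n).
Hypotheses (bx0 : bdry Om x0).
Implicit Types (x y v tau nu : 'rV[R]_n) (r : R) (p H : 'rV[R]_n -> R).

Lemma sum_lift (i : 'I_n) (F : 'I_n -> R) : \sum_j F j = F i + \sum_(j < n.-1) F (lift i j).
Proof. by case: n i F => [[]//|m] i F; rewrite (bigD1_ord i). Qed.

Lemma chart_rho_derive (i : 'I_n) (s : bool) (g : 'rV[R]_n.-1 -> R) x v :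
  CkL 1 [set: 'rV[R]_n.-1] set0 g ->
  is_derive (0 : R) 1 (fun t => g (col' i (x + t *: v)) - (-1) ^+ s * (x + t *: v) 0 i)
   (slope i g v (col' i x) - (-1) ^+ s * v 0 i).
Proof.
move=> Hg.
have A j : is_derive (0 : R) 1 (fun t : R => (x + t *: v) 0 j) (v 0 j).
  rewrite (_ : (fun t : R => _) = (fun t : R => x 0 j + v 0 j *: t)); last by apply/funext => t; rewrite !mxE mulrC.
  have dj : is_derive (0 : R) 1 (fun t : R => x 0 j + v 0 j *: t) (0 + v 0 j *: 1) by apply: is_deriveD.
  by rewrite add0r [_ *: 1]mulr1 in dj.
have B : is_derive (0 : R) 1 (g \o (fun t : R => col' i (x + t *: v))) (\sum_j (col' i v) 0 j * pderivs [:: j] g (col' i (x + (0:R) *: v))).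
  apply: (C1_curve openT (CkL_Ck Hg)) => // j.
  rewrite (_ : (fun t : R => _) = (fun t : R => (x + t *: v) 0 (lift i j))); last by apply/funext => t; rewrite !mxE.
  by rewrite mxE.
have C := is_deriveB B (is_deriveZ ((-1) ^+ s) (A i)).
apply: (is_derive_eq C); rewrite scale0r addr0; congr (_ - _).
by apply: eq_bigr => j _; rewrite mxE pdE.
Qed.

(** [N] is the length of the gradient of the defining function of the chart. *)
Lemma normal_chart nu : outer_unit_normal Om x0 nu -> exists i s g (N : R),
  [/\ graph_chart 1 Om x0 i s g, 0 < N, \sum_j nu 0 j ^+ 2 = 1 &
   forall tau, N * \sum_j tau 0 j * nu 0 j = slope i g tau (col' i x0) - (-1) ^+ s * tau 0 i].
Proof.
move=> [i [s [g [ch]]]]; cbv zeta; set rho := (X in grad X) => nuE.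
have Hg : CkL 1 [set: 'rV[R]_n.-1] set0 g by apply: Ck_CkL; case: ch.
exists i, s, g, (enorm (grad rho x0)).
have gr j : grad rho x0 0 j = slope i g (delta_mx 0 j) (col' i x0) - (-1) ^+ s * (delta_mx 0 j : 'rV[R]_n) 0 i.
  rewrite gradE; apply: pd_val; apply: is_derive_line0.
  exact: (chart_rho_derive i s x0 (delta_mx 0 j) Hg).
have S tau : \sum_j tau 0 j * grad rho x0 0 j = slope i g tau (col' i x0) - (-1) ^+ s * tau 0 i.
  rewrite (sum_lift i) gr mxE !eqxx /= mulr1 /slope big1 => [|j _]; last first.
    by rewrite mxE eq_sym (negPf (neq_lift _ _)) andbF mul0r.
  rewrite sub0r mulrN mulrC addrC; congr (_ - _); apply: eq_bigr => j _.
  rewrite gr mxE (negPf (neq_lift _ _)) andbF mulr0 subr0 /slope (bigD1 j) //= big1 => [|j' jj'].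
    by rewrite mxE !eqxx mul1r addr0.
  by rewrite mxE (inj_eq lift_inj) (negPf jj') andbF mul0r.
have r0 : grad rho x0 != 0.
  apply/eqP => E; have := S (delta_mx 0 i); rewrite E big1 => [|j _]; last by rewrite [X in _ * X]mxE mulr0.
  rewrite /slope big1 => [|j _]; last by rewrite mxE eq_sym (negPf (neq_lift _ _)) andbF mul0r.
  by rewrite mxE !eqxx mulr1 sub0r => /eqP; rewrite eq_sym oppr_eq0 signr_eq0.
have N0 := enorm_gt0 r0; have N1 := lt0r_neq0 N0.
have nuj j : nu 0 j = (enorm (grad rho x0))^-1 * grad rho x0 0 j by rewrite nuE mxE.
split=> //.
  rewrite (eq_bigr (fun j => (enorm (grad rho x0))^-1 ^+ 2 * grad rho x0 0 j ^+ 2)) => [|j _]; last by rewrite nuj exprMn.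
  by rewrite -mulr_sumr -enorm_sq -exprMn mulVf // expr1n.
move=> tau; rewrite -S mulr_sumr; apply: eq_bigr => j _.
by rewrite nuj mulrCA [enorm _ * _]mulrA mulfV // mul1r.
Qed.

Lemma inner_ray nu : outer_unit_normal Om x0 nu ->
  exists2 t0 : R, 0 < t0 & forall t : R, 0 < t -> t < t0 -> Om (x0 - t *: nu).
Proof.
move=> /normal_chart[i [s [g [N [ch N0 nu1 S]]]]].
have Hg : CkL 1 [set: 'rV[R]_n.-1] set0 g by apply: Ck_CkL; case: ch.
have D := chart_rho_derive i s x0 (- nu) Hg.
have neg : slope i g (- nu) (col' i x0) - (-1) ^+ s * (- nu) 0 i < 0.
  rewrite -S (eq_bigr (fun j => - (nu 0 j ^+ 2))) => [|j _]; last by rewrite mxE mulNr expr2.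
  by rewrite sumrN nu1 mulrN1 oppr_lt0.
have [t1 t10 H1] := is_derive_neg D neg.
have [d d0 Hd] := chart_iff ch.
have d1 : 0 < d / (1 + `|nu|) by rewrite divr_gt0 // ltr_pwDl.
exists (Num.min t1 (d / (1 + `|nu|))); first by rewrite lt_min t10.
move=> t tp; rewrite lt_min => /andP[tt1 ttd].
have := H1 t tp tt1; rewrite scale0r addr0 (bdry_height0 oOm bx0 ch) subrr subr_lt0 scalerN => h.
apply/Hd => //; rewrite addrAC subrr sub0r normrN normrZ gtr0_norm //.
apply: (@le_lt_trans _ _ (t * (1 + `|nu|))); first by rewrite ler_pM2l // lerDr.
by rewrite -ltr_pdivlMr // ltr_pwDl.
Qed.

Lemma normal_tangential nu (U1 : set 'rV[R]_n) p (P : 'I_n -> R) : outer_unit_normal Om x0 nu ->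
  open U1 -> CkL 1 U1 set0 p -> (\forall y \near x0, Om y -> U1 y) ->
  (forall j, pd (delta_mx 0 j) p y @[y --> within Om (nbhs x0)] --> P j) ->
  (\forall b \near x0, bdry Om b -> p y @[y --> within Om (nbhs b)] --> (0 : R)) ->
  forall tau, \sum_j tau 0 j * nu 0 j = 0 -> \sum_j tau 0 j * P j = 0.
Proof.
move=> /normal_chart[i [s [g [N [ch N0 nu1 S]]]]] oU1 Hp OU HP p0 tau tn.
apply: (tangential_derivative oOm bx0 ch oU1 Hp OU HP p0).
by apply/eqP; rewrite -subr_eq0 -S tn mulr0.
Qed.

(** Test with the tangential parts [e_j - nu_j nu] of the basis vectors. *)
Lemma normal_parallel nu (P : 'I_n -> R) : \sum_j nu 0 j ^+ 2 = 1 ->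
  (forall tau, \sum_j tau 0 j * nu 0 j = 0 -> \sum_j tau 0 j * P j = 0) ->
  forall j, P j = (\sum_k P k * nu 0 k) * nu 0 j.
Proof.
move=> nu1 H j.
have dsum (Q : 'I_n -> R) : \sum_k (delta_mx 0 j : 'rV[R]_n) 0 k * Q k = Q j.
  rewrite (bigD1 j) //= big1 => [|k kj]; first by rewrite mxE !eqxx mul1r addr0.
  by rewrite mxE (negPf kj) andbF mul0r.
have split_ (Q : 'I_n -> R) : \sum_k (delta_mx 0 j - nu 0 j *: nu) 0 k * Q k = Q j - nu 0 j * \sum_k Q k * nu 0 k.
  rewrite mulr_sumr -[Q j]dsum -sumrB; apply: eq_bigr => k _.
  by rewrite !mxE; ring.
have /H : \sum_k (delta_mx 0 j - nu 0 j *: nu) 0 k * nu 0 k = 0.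
  by rewrite split_ (eq_bigr (fun k => nu 0 k ^+ 2)) // nu1 mulr1 subrr.
by rewrite split_ => /eqP; rewrite subr_eq0 mulrC => /eqP.
Qed.

(** Along the inner normal the derivative stays above half of its limit, so [H]
    increases from its boundary value. *)
Lemma boundary_increase nu (U1 : set 'rV[R]_n) H (H0 : R) (P : 'I_n -> R) : outer_unit_normal Om x0 nu ->
  open U1 -> CkL 1 U1 set0 H -> (\forall y \near x0, Om y -> U1 y) ->
  H y @[y --> within Om (nbhs x0)] --> H0 ->
  (forall j, pd (delta_mx 0 j) H y @[y --> within Om (nbhs x0)] --> P j) ->
  \sum_j P j * nu 0 j < 0 -> exists2 y, Om y & H0 < H y.
Proof.
move=> on oU1 HH OU HL HP neg.
have [t0 t00 ray] := inner_ray on.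
pose K := - \sum_j P j * nu 0 j; have K0 : 0 < K by rewrite oppr_gt0.
have [d1 d10 Hd1] := near_dist OU.
have dl : pd (- nu) H y @[y --> within Om (nbhs x0)] --> K.
  have c : \sum_j (- nu) 0 j * pd (delta_mx 0 j) H y @[y --> within Om (nbhs x0)] --> \sum_j (- nu) 0 j * P j.
    by apply: (@cvg_bigsum _ _ _ (within Om (nbhs x0)) _) => j; exact: (cvgM (cvg_cst _) (HP j)).
  have -> : K = \sum_j (- nu) 0 j * P j.
    by rewrite /K -sumrN; apply: eq_bigr => j _; rewrite mxE mulNr mulrC.
  apply: dist_within => e e0; have [d d0 Hd] := within_dist c e0.
  exists (Num.min d d1); first by rewrite lt_min d0.
  move=> y Oy; rewrite lt_min => /andP[yd yd1].
  by rewrite (pd_coord oU1 (- nu) HH (Hd1 y yd1 Oy)); exact: Hd.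
have [d2 d20 Hd2] := within_dist dl (divr_gt0 K0 (ltr0n _ 2)).
have nu0 : 0 < 1 + `|nu| by rewrite ltr_pwDl.
have [t [tp tt0 td1 td2]] : exists t : R, [/\ 0 < t, t < t0, t * (1 + `|nu|) < d1 & t * (1 + `|nu|) < d2].
  have m0 : 0 < Num.min t0 (Num.min (d1 / (1 + `|nu|)) (d2 / (1 + `|nu|))).
    by rewrite !lt_min t00 !divr_gt0.
  exists (Num.min t0 (Num.min (d1 / (1 + `|nu|)) (d2 / (1 + `|nu|))) / 2).
  have : Num.min t0 (Num.min (d1 / (1 + `|nu|)) (d2 / (1 + `|nu|))) / 2 < Num.min t0 (Num.min (d1 / (1 + `|nu|)) (d2 / (1 + `|nu|))).
    by rewrite ltr_pdivrMr // ltr_pMr // ltr1n.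
  rewrite !lt_min => /and3P[h1 h2 h3]; split=> //.
  - by rewrite divr_gt0.
  - by rewrite -ltr_pdivlMr.
  - by rewrite -ltr_pdivlMr.
have close r : 0 < r -> r <= t -> [/\ Om (x0 - r *: nu), `|x0 - r *: nu - x0| < d1 & `|x0 - r *: nu - x0| < d2].
  move=> r0 rt; have b : `|x0 - r *: nu - x0| <= t * (1 + `|nu|).
    rewrite addrAC subrr sub0r normrN normrZ gtr0_norm //.
    by apply: ler_pM => //; [exact: ltW|rewrite lerDr].
  split; first by apply: ray => //; exact: le_lt_trans rt tt0.
  - exact: le_lt_trans b td1.
  - exact: le_lt_trans b td2.
have e0 : 0 < t * K / 8 by rewrite !mulr_gt0 // invr_gt0 ltr0n.
have [d3 d30 Hd3] := within_dist HL e0.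
have [r [r0 rt rd3]] : exists r : R, [/\ 0 < r, r <= t / 2 & r * (1 + `|nu|) < d3].
  have m0 : 0 < Num.min t (d3 / (1 + `|nu|)) by rewrite lt_min tp divr_gt0.
  exists (Num.min t (d3 / (1 + `|nu|)) / 2); split; first by rewrite divr_gt0.
  - by rewrite ler_pM2r ?invr_gt0 // ge_min lexx.
  - rewrite -ltr_pdivlMr //; apply: (@lt_le_trans _ _ (Num.min t (d3 / (1 + `|nu|)))).
      by rewrite ltr_pdivrMr // ltr_pMr // ltr1n.
    by rewrite ge_min lexx orbT.
exists (x0 - t *: nu); first by have [] := close t tp (lexx _).
have rt' : r <= t by apply: (le_trans rt); rewrite ler_pdivrMr // ler_pMr // ler1n.
have seg (s : R) : 0 <= s <= 1 -> exists2 q : R, x0 - r *: nu + s *: ((t - r) *: (- nu)) = x0 - q *: nu & 0 < q <= t.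
  move=> /andP[s0 s1]; exists (r + s * (t - r)).
    by rewrite scalerA scalerN -addrA -opprD -scalerDl.
  have h : 0 <= s * (t - r) <= t - r by rewrite mulr_ge0 ?subr_ge0 //= ler_piMl ?subr_ge0.
  by move: h => /andP[h1 h2]; apply/andP; split; lra.
have mvt : exists2 s : R, 0 < s < 1 & H (x0 - r *: nu + (t - r) *: (- nu)) - H (x0 - r *: nu)
   = 'D_((t - r) *: (- nu)) H (x0 - r *: nu + s *: ((t - r) *: (- nu))).
  apply: MVT_line => s /seg[q -> /andP[q0 qt]].
  have [Oq q1 _] := close q q0 qt.
  by apply: (CkL_derivable oU1 HH); exact: Hd1.
have [s /andP[s0 s1]] := mvt.
have [|q qE /andP[q0 qt]] := seg s; first by rewrite !ltW.
have [Oq q1 q2] := close q q0 qt.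
have -> : 'D_((t - r) *: - nu) H (x0 - r *: nu + s *: ((t - r) *: - nu)) = (t - r) * pd (- nu) H (x0 - q *: nu).
  by rewrite qE pdE; apply: (CkL_DvZ _ _ oU1 HH); exact: Hd1.
have -> : x0 - r *: nu + (t - r) *: - nu = x0 - t *: nu.
  by rewrite scalerN -addrA -opprD -scalerDl [r + _]addrC subrK.
move=> hE.
have := Hd2 _ Oq q2; rewrite ler_norml => /andP[k1 k2].
have [Or _ _] := close r r0 rt'.
have r3 : `|x0 - r *: nu - x0| < d3.
  rewrite addrAC subrr sub0r normrN normrZ gtr0_norm //; apply: le_lt_trans rd3.
  by rewrite ler_pM2l // lerDr.
have := Hd3 _ Or r3; rewrite ler_norml => /andP[m1 m2].
have : (t / 2) * (K / 2) <= (t - r) * pd (- nu) H (x0 - q *: nu).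
  apply: ler_pM; [|by rewrite divr_ge0 // ltW| |lra].
    by rewrite divr_ge0 // ltW.
  lra.
have e0' : 0 < t * K / 8 := e0.
by rewrite -hE => h; nra.
Qed.

End Normal.

(** * Truncated powers and the distance to the boundary *)

Section PosPow.
Variable R : realType.

(** The power [t_+^m], of class [C^(m-1)], from which all cut-off functions are
    built. *)
Definition pospow (m : nat) (t : R) : R := Num.max t 0 ^+ m.

Lemma pospow_ge0 m t : 0 <= pospow m t.
Proof. by rewrite exprn_ge0 // le_max lexx orbT. Qed.

Lemma pospow_neg m (t : R) : t <= 0 -> pospow m.+1 t = 0.
Proof. by move=> t0; rewrite /pospow max_r // exprS mul0r. Qed.

Lemma pospow_pos m (t : R) : 0 <= t -> pospow m t = t ^+ m.
Proof. by move=> t0; rewrite /pospow max_l. Qed.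

Lemma pospow_cont m : continuous (pospow m).
Proof.
elim: m => [|m IH] t.
  rewrite (_ : pospow 0 = fun=> 1); first exact: cvg_cst.
  by apply/funext => s; rewrite /pospow expr0.
rewrite (_ : pospow m.+1 = (fun s : R => Num.max s 0 * pospow m s)); last by apply/funext => s; rewrite /pospow exprS.
apply: (cvgM _ (IH t)); apply: continuous_max; [exact: cvg_id|exact: cvg_cst].
Qed.

Lemma pospow_derive m (t : R) : is_derive t 1 (pospow m.+2) (m.+2%:R * pospow m.+1 t).
Proof.
have X (s : R) : is_derive s 1 (fun s : R => s ^+ m.+2) (m.+2%:R * s ^+ m.+1).
  split; first exact: exprn_derivable.
  by rewrite exp_derive -[LHS]/(m.+2%:R * s ^+ m.+1 * 1) mulr1.
have [tn|tp|->] := ltgtP t 0.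
- rewrite pospow_neg ?ltW // mulr0; apply: (near_eq_is_derive (f := fun=> 0)).
  + by apply: filterS (lt_nbhsl tn) => s s0; rewrite pospow_neg // ltW.
- rewrite pospow_pos ?ltW //; apply: (near_eq_is_derive (f := fun s : R => s ^+ m.+2)).
  + by apply: filterS (lt_nbhsr tp) => s s0; rewrite pospow_pos // ltW.
rewrite pospow_neg // mulr0.
suff H : (fun k : R => k^-1 *: (pospow m.+2 (k *: 1 + 0) - pospow m.+2 0)) @ 0^' --> (0 : R).
  by split; [apply/cvg_ex; exists 0|exact: cvg_lim].
have C : pospow m.+1 k @[k --> 0^'] --> (0 : R).
  have := @pospow_cont m.+1 0; rewrite /continuous_at pospow_neg // => c.
  by apply: cvg_trans c; apply: cvg_app; exact: cvg_within.
move/cvgrPdist_le: C => C; apply/cvgrPdist_le => e e0.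
apply: filterS (C e e0) => k; rewrite !sub0r !normrN addr0 [k *: 1]mulr1.
rewrite [pospow _ 0]pospow_neg // subr0 => h; change (`|k^-1 * pospow m.+2 k| <= e).
have [kn|kp] := leP k 0; first by rewrite pospow_neg // mulr0 normr0 ltW.
rewrite (pospow_pos _ (ltW kp)) exprS mulrA mulVf ?lt0r_neq0 // mul1r.
by move: h; rewrite (pospow_pos _ (ltW kp)).
Qed.

End PosPow.

Section Glue.
Variables (R : realType) (n : nat).
Implicit Types (f g : 'rV[R]_n -> R) (x y : 'rV[R]_n) (U S : set 'rV[R]_n).

(** Regularity is local: derivatives at a point and limits at a boundary point can
    be computed in any neighbourhood. *)
Lemma CkL_local k U S f :
  (forall x, U x -> exists U' S', U' x /\ CkL k U' S' f) ->
  (forall x, S x -> exists U' S', [/\ S' x, \forall y \near x, U y -> U' y & CkL k U' S' f]) ->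
  CkL k U S f.
Proof.
move=> H1 H2 s x; split.
- by move=> sk /H1[U' [S' [Ux H]]]; have [h _ _] := H s x; exact: h.
- move=> sk /H2[U' [S' [Sx nU H]]]; have [_ h _] := H s x; have [l hl] := h sk Sx.
  exists l; apply: dist_within => e e0; have [d d0 Hd] := within_dist hl e0.
  have [d1 d10 Hd1] := near_dist nU.
  exists (Num.min d d1); first by rewrite lt_min d0.
  by move=> y Uy; rewrite lt_min => /andP[yd yd1]; apply: Hd => //; exact: Hd1.
- by move=> sk /H1[U' [S' [Ux H]]]; have [_ _ h] := H s x; exact: h.
Qed.

Lemma CkL_pospow k m U S f : open U -> (k < m)%N -> CkL k U S f -> CkL k U S (fun x => pospow m (f x)).
Proof.
move=> oU km Hf.
rewrite (_ : (fun x => _) = (fun x => (fun j t => (m ^_ j)%:R * pospow (m - j) t) 0%N (f x))); last first.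
  by apply/funext => x; rewrite ffactn0 mul1r subn0.
apply: (@CkL_comp R n k U S (fun j t => (m ^_ j)%:R * pospow (m - j) t) f oU _ _ Hf).
  move=> j t jk; have [p mE] : exists p, (m - j = p.+2)%N by exists (m - j - 2)%N; lia.
  have mE' : (m - j.+1 = p.+1)%N by lia.
  rewrite mE mE' ffactnSr mE.
  have H := @is_deriveZ _ _ _ (pospow p.+2) (m ^_ j)%:R t 1 _ (pospow_derive p t).
  apply: (is_derive_eq H); rewrite -[_ *: _]/(_ * _) natrM; ring.
by move=> t; apply: (cvgM (cvg_cst _)); exact: pospow_cont.
Qed.

End Glue.

Section Dist.
Variables (R : realType) (n : nat) (Om : set 'rV[R]_n).
Hypotheses (oOm : open Om) (bOm : bounded_set Om).
Implicit Types (x y v : 'rV[R]_n).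
Let d := dist_bdry Om.

Lemma bdry_compact : compact (bdry Om).
Proof.
apply: (subclosed_compact _ (closure_compact bOm)); last by move=> x [].
rewrite /bdry setDE; apply: closedI; first exact: closed_closure.
by apply: open_closedC; exact: open_interior.
Qed.

Lemma dist_le x y : bdry Om y -> d x <= enorm (x - y).
Proof.
move=> yb; apply: ge_inf; last by exists y.
by exists 0 => _ [z _ <-]; exact: enorm_ge0.
Qed.

Lemma dist_ge0 x : 0 <= d x.
Proof.
rewrite /d /dist_bdry; have [->|/set0P ne] := eqVneq [set enorm (x - y) | y in bdry Om] set0.
  by rewrite inf0.
by apply: lb_le_inf => // _ [z _ <-]; exact: enorm_ge0.
Qed.

Lemma dist_lip x y : d x <= d y + enorm (x - y).
Proof.
have [b0|/set0P ne] := eqVneq (bdry Om) set0.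
  by rewrite /d /dist_bdry b0 !image_set0 inf0 add0r enorm_ge0.
rewrite -lerBlDr; apply: lb_le_inf; first by case: ne => z bz; exists (enorm (y - z)), z.
move=> _ [z bz <-]; rewrite lerBlDr; apply: (le_trans (dist_le x bz)).
by rewrite [leRHS]addrC; apply: le_trans (enormD _ _); rewrite addrA subrK.
Qed.

Lemma dist_bdry0 x : bdry Om x -> d x = 0.
Proof.
move=> bx; apply/eqP; rewrite eq_le dist_ge0 andbT; apply: (le_trans (dist_le x bx)).
by rewrite subrr /enorm big1 ?sqrtr0 // => i _; rewrite mxE expr0n.
Qed.

Lemma dist_cont x : d y @[y --> x] --> d x.
Proof.
apply/(@cvgrPdist_le _ _ _ (nbhs x) (nbhs_filter x)) => e e0.
have [r r0 Hr] := enorm_near x e0; apply: (near_dist_intro r0) => y /Hr h'.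
have h : enorm (x - y) <= e by rewrite -enormN opprB.
have := dist_lip x y; have := dist_lip y x; rewrite ler_distl => k1 k2.
by apply/andP; split; lra.
Qed.

Lemma nearest_point x : bdry Om !=set0 -> exists2 y, bdry Om y & d x = enorm (x - y).
Proof.
move=> ne; have c : {within bdry Om, continuous (fun y => enorm (x - y))}.
  apply: continuous_subspaceT => y0.
  apply/(@cvgrPdist_le _ _ _ (nbhs y0) (nbhs_filter y0)) => e e0.
  have [r r0 Hr] := enorm_near y0 e0; apply: (near_dist_intro r0) => y /Hr h.
  have h1 : enorm (x - y0) <= enorm (x - y) + enorm (y - y0).
    by apply: le_trans (enormD _ _); rewrite addrA subrK.
  have h2 : enorm (x - y) <= enorm (x - y0) + enorm (y - y0).
    by rewrite -[enorm (y - y0)]enormN opprB; apply: le_trans (enormD _ _); rewrite addrA subrK.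
  by rewrite ler_distl; apply/andP; split; lra.
have [y] := EVT_min_rV ne bdry_compact c; move=> /set_mem yb Hy.
exists y => //; apply/eqP; rewrite eq_le dist_le //=; apply: lb_le_inf; first by exists (enorm (x - y)), y.
by move=> _ [z bz <-]; apply: Hy; exact: mem_set.
Qed.

(** The eikonal equation: the distance is 1-Lipschitz, and it decreases at unit
    rate towards a nearest point. *)
Lemma dist_eikonal (U : set 'rV[R]_n) x : bdry Om !=set0 -> open U -> CkL 1 U set0 d -> U x -> Om x ->
  \sum_j pd (delta_mx 0 j) d x ^+ 2 = 1.
Proof.
move=> ne oU Hd Ux Ox; have [y yb dE] := nearest_point x ne.
have xy : x - y != 0 by rewrite subr_eq0; apply: contra_notN (bdry_notin oOm yb) => /eqP <-.
have d0 : 0 < d x by rewrite dE; exact: enorm_gt0.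
have dline v : is_derive (0 : R) 1 (fun t => d (x + t *: v)) (pd v d x).
  have := @derive_line _ _ d x v 0; rewrite scale0r addr0 pdE; apply.
  exact: (CkL_derivable oU Hd Ux).
have lin (c : R) v : is_derive (0 : R) 1 (fun t => d (x + t *: v) + c *: t) (pd v d x + c *: 1).
  by apply: is_deriveD.
have low v : - enorm v <= pd v d x.
  rewrite leNgt; apply/negP => h.
  have D := lin (enorm v) v; have neg : pd v d x + enorm v *: 1 < 0 by rewrite [_ *: 1]mulr1; lra.
  have [t0 t00 Ht] := is_derive_neg D neg.
  have t2 : 0 < t0 / 2 by rewrite divr_gt0.
  have := Ht (t0 / 2) t2; rewrite scale0r addr0 [_ *: 0]mulr0 addr0 => /(_ ltac:(lra)) H.
  have := dist_lip x (x + (t0 / 2) *: v); rewrite opprD addrA subrr sub0r enormN enormZ gtr0_norm //.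
  by move: H; rewrite [_ *: (t0 / 2)]mulrC => H H'; lra.
pose e := (d x)^-1 *: (y - x).
have e1 : enorm e = 1.
  by rewrite /e enormZ -enormN opprB -dE gtr0_norm ?invr_gt0 // mulVf // lt0r_neq0.
have up : pd e d x <= -1.
  rewrite leNgt; apply/negP => h.
  have D := is_deriveN (lin 1 e); have neg : - (pd e d x + 1 *: 1) < 0 by rewrite [1 *: 1]mulr1; lra.
  have [t0 t00 Ht] := is_derive_neg D neg.
  pose t := Num.min (t0 / 2) (d x).
  have [tp tt td] : [/\ 0 < t, t < t0 & t <= d x].
    rewrite /t; split; first by rewrite lt_min divr_gt0.
      by rewrite gt_min ltr_pdivrMr // ltr_pMr // ltr1n.
    by rewrite ge_min lexx orbT.
  clearbody t.
  have := Ht t tp tt; rewrite !fctE scale0r addr0 [_ *: 0]mulr0 addr0 scale1r => H.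
  have := dist_le (x + t *: e) yb.
  have -> : x + t *: e - y = (1 - t / d x) *: (x - y).
    by apply/rowP => j; rewrite /e !mxE; ring.
  rewrite enormZ -dE ger0_norm; last by rewrite subr_ge0 ler_pdivrMr // mul1r.
  rewrite mulrBl mul1r -mulrA mulVf ?lt0r_neq0 // mulr1 => H'; lra.
pose G := grad d x.
have pdG v : pd v d x = \sum_j v 0 j * G 0 j.
  by rewrite (pd_coord oU v Hd Ux); apply: eq_bigr => j _; rewrite gradE.
have -> : \sum_j pd (delta_mx 0 j) d x ^+ 2 = enorm G ^+ 2.
  by rewrite enorm_sq; apply: eq_bigr => j _; rewrite gradE.
have g1 : 1 <= enorm G.
  have := dot_le_enorm (- e) G; rewrite enormN e1 mul1r; apply: le_trans.
  rewrite (eq_bigr (fun j => - (e 0 j * G 0 j))) => [|j _]; last by rewrite [(- e) 0 j]mxE mulNr.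
  by rewrite sumrN -pdG; lra.
have g2 : enorm G ^+ 2 <= enorm G.
  have := low (- G); rewrite enormN pdG (eq_bigr (fun j => - (G 0 j ^+ 2))) => [|j _]; last first.
    by rewrite [(- G) 0 j]mxE mulNr expr2.
  by rewrite sumrN -enorm_sq lerN2.
have := enorm_ge0 G => g0; have : enorm G = 1 by nra.
by move=> ->; rewrite expr1n.
Qed.

Section Limit.
Variable mu : R.
Hypotheses (mu0 : 0 < mu) (Hd : CkL 3 (collar Om mu) (closure (collar Om mu)) d).

Lemma collar_open : open (collar Om mu).
Proof.
apply: openI => //; rewrite openE => x /= dx; exact: (@dist_cont x _ (open_nbhs_nbhs (conj (@open_lt R mu) dx))).
Qed.

Lemma collar_near x : bdry Om x -> \forall y \near x, Om y -> collar Om mu y.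
Proof.
move=> bx; have : \forall y \near x, d y < mu.
  apply: (@dist_cont x [set t | t < mu]); apply: (open_nbhs_nbhs (conj (@open_lt R mu) _)).
  by rewrite /= dist_bdry0.
by apply: filterS => y dy Oy.
Qed.

Lemma collar_closure x : bdry Om x -> closure (collar Om mu) x.
Proof.
move=> bx B nB; have [cx _] := bx.
have := cx _ (filterI nB (collar_near bx)) => -[y [Oy [By H]]].
by exists y; split=> //; exact: H.
Qed.

Lemma within_collar x f : bdry Om x -> has_limit (collar Om mu) x f -> has_limit Om x f.
Proof.
move=> bx [l hl]; exists l; apply: dist_within => e e0; have [r r0 Hr] := within_dist hl e0.
have [r1 r10 Hr1] := near_dist (collar_near bx).
exists (Num.min r r1); first by rewrite lt_min r0.
by move=> y Oy; rewrite lt_min => /andP[yr yr1]; apply: Hr => //; exact: Hr1.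
Qed.

Lemma dist_lim0 b : bdry Om b -> d y @[y --> within Om (nbhs b)] --> (0 : R).
Proof.
move=> bb; rewrite -(dist_bdry0 bb).
by apply: cvg_trans (@dist_cont b); apply: cvg_app; exact: cvg_within.
Qed.

(** The limit of the gradient has length 1 by the eikonal equation and is parallel
    to the normal because the distance vanishes on the boundary; it points inside,
    for otherwise the distance would take negative values. *)
Lemma dist_grad_normal x0 nu : bdry Om x0 -> outer_unit_normal Om x0 nu -> forall j,
  pd (delta_mx 0 j) d y @[y --> within Om (nbhs x0)] --> - nu 0 j.
Proof.
move=> bx on; have oC := collar_open.
have Hd1 : CkL 1 (collar Om mu) set0 d by move=> s x; have [h1 _ h3] := CkLW (isT : (1 <= 3)%N) Hd s x; split.
have ex j : exists l : R, pd (delta_mx 0 j) d y @[y --> within Om (nbhs x0)] --> l.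
  apply: (within_collar bx); have H := CkL_pd oC (delta_mx 0 j) Hd.
  by apply: (CkL_lim H); exact: collar_closure.
have [G HG] := choice ex.
have [_ [_ [_ [_ [_ _ nu1 _]]]]] := normal_chart on.
have dl : \forall b \near x0, bdry Om b -> d y @[y --> within Om (nbhs b)] --> (0 : R).
  by apply: (near_dist_intro (@ltr01 R)) => b _; exact: dist_lim0.
have tan := normal_tangential oOm bx on oC Hd1 (collar_near bx) HG dl.
have GE := normal_parallel nu1 tan.
set c := \sum_k G k * nu 0 k in GE.
have PF := within_proper (proj1 bx).
have G1 : \sum_j G j ^+ 2 = 1.
  have L1 : \sum_j pd (delta_mx 0 j) d y ^+ 2 @[y --> within Om (nbhs x0)] --> \sum_j G j ^+ 2.
    by apply: (@cvg_bigsum _ _ _ (within Om (nbhs x0)) _) => j; exact: (cvgM (HG j) (HG j)).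
  have L2 : \sum_j pd (delta_mx 0 j) d y ^+ 2 @[y --> within Om (nbhs x0)] --> (1 : R).
    apply: dist_within => e e0; have [r r0 Hr] := near_dist (collar_near bx).
    exists r => // y Oy yr; rewrite (dist_eikonal _ oC Hd1 (Hr y yr Oy) Oy) ?subrr ?normr0 ?ltW //.
    by exists x0.
  exact: (cvg_unique _ L1 L2).
have c1 : c ^+ 2 = 1.
  by rewrite -G1 (eq_bigr (fun j => c ^+ 2 * nu 0 j ^+ 2)) => [|j _]; [rewrite -mulr_sumr nu1 mulr1|rewrite GE exprMn].
have [cE|cE] : c = 1 \/ c = -1.
  by have /eqP := c1; rewrite sqrf_eq1 => /orP[/eqP|/eqP]; [left|right].
- have HN : CkL 1 (collar Om mu) set0 (fun x => - d x) by apply: CkL_opp.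
  have LN : (fun x => - d x) y @[y --> within Om (nbhs x0)] --> (- 0 : R) by apply: cvgN; exact: dist_lim0.
  have PN j : pd (delta_mx 0 j) (fun x => - d x) y @[y --> within Om (nbhs x0)] --> - G j.
    have L : (fun y => - pd (delta_mx 0 j) d y) y @[y --> within Om (nbhs x0)] --> - G j by exact: (cvgN (HG j)).
    apply: dist_within => e e0.
    have [r r0 Hr] := within_dist L e0; have [r1 r10 Hr1] := near_dist (collar_near bx).
    exists (Num.min r r1); first by rewrite lt_min r0.
    move=> y Oy; rewrite lt_min => /andP[yr yr1].
    rewrite (pd_val (is_deriveN (pd_is_derive oC _ Hd1 (Hr1 y yr1 Oy)))); exact: Hr.
  have [|y Oy] := boundary_increase oOm bx on oC HN (collar_near bx) LN PN.
    by rewrite (eq_bigr (fun j => - (G j * nu 0 j))) => [|j _]; rewrite ?mulNr // sumrN -/c cE oppr_lt0.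
  by rewrite oppr0 oppr_gt0 ltNge dist_ge0.
- by move=> j; have := HG j; rewrite GE cE mulN1r.
Qed.

End Limit.
End Dist.

(** * Flattened distance and extension of the boundary data *)

Section Defining.
Variables (R : realType) (n : nat) (Om : set 'rV[R]_n) (mu : R).
Hypotheses (oOm : open Om) (bOm : bounded_set Om) (mu0 : 0 < mu).
Let d := dist_bdry Om.
Hypothesis Hd : CkL 3 (collar Om mu) (closure (collar Om mu)) d.
Implicit Types (x y v : 'rV[R]_n).

(** Slope 1 at 0, and constant from [a] on: composed with the distance, which is
    smooth only near the boundary, it gives a [C^3] function in the whole domain
    with the same gradient at the boundary. *)
Definition flatten_at (a t : R) : R := a / 4 * (1 - pospow 4 (1 - a^-1 * t)).

Definition cut_dist x : R := flatten_at (mu / 2) (dist_bdry Om x).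

Let a0 : 0 < mu / 2. Proof. by rewrite divr_gt0. Qed.

Lemma flatten_at_flat (a t : R) : 0 < a -> a <= t -> flatten_at a t = a / 4.
Proof.
move=> ap ta; rewrite /flatten_at pospow_neg ?subr0 ?mulr1 // subr_le0.
by rewrite mulrC ler_pdivlMr // mul1r.
Qed.

Lemma flatten_at_bound (a t : R) : 0 < a -> 0 <= t -> 0 <= flatten_at a t <= a / 4.
Proof.
move=> ap t0; have a4 : 0 < a / 4 by rewrite divr_gt0.
have p1 : pospow 4 (1 - a^-1 * t) <= 1.
  rewrite /pospow exprn_ile1 //; first by rewrite le_max lexx orbT.
  by rewrite ge_max ler01 andbT lerBlDr lerDl mulr_ge0 // invr_ge0 ltW.
apply/andP; split; first by rewrite /flatten_at mulr_ge0 ?subr_ge0 // ltW.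
by apply: ler_piMr; [exact: ltW|rewrite gerBl pospow_ge0].
Qed.

Lemma flatten_at_derive (a t : R) : a != 0 -> is_derive t 1 (flatten_at a) (pospow 3 (1 - a^-1 * t)).
Proof.
move=> an.
have D1 : is_derive t 1 (fun s : R => 1 - a^-1 * s) (- a^-1).
  have H : is_derive t 1 (fun s : R => 1 - a^-1 *: s) (0 - a^-1 *: 1) by apply: is_deriveB.
  by rewrite sub0r [_ *: 1]mulr1 in H.
have D2 := @is_derive1_comp R (pospow 4) (fun s : R => 1 - a^-1 * s) t _ _ (pospow_derive 2 (1 - a^-1 * t)) D1.
have D3 : is_derive t 1 (fun s : R => a / 4 *: (1 - pospow 4 (1 - a^-1 * s)))
   (a / 4 *: (0 - (4%:R * pospow 3 (1 - a^-1 * t)) * (- a^-1))).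
  by apply: is_deriveZ; apply: is_deriveB.
apply: (is_derive_eq D3).
change (a / 4 * (0 - (4%:R * pospow 3 (1 - a^-1 * t)) * (- a^-1)) = pospow 3 (1 - a^-1 * t)).
by field.
Qed.

Lemma cut_dist_CkL_collar : CkL 3 (collar Om mu) (closure (collar Om mu)) cut_dist.
Proof.
have oC := collar_open oOm (mu := mu).
apply: (CkL_scale _ oC); apply: (CkL_sub oC (CkL_cst _ _ _ _)).
apply: (CkL_pospow oC (isT : (3 < 4)%N)).
exact: (CkL_sub oC (CkL_cst _ _ _ _) (CkL_scale _ oC Hd)).
Qed.

Lemma cut_dist_CkL : CkL 3 Om (closure Om) cut_dist.
Proof.
have far x : mu <= d x -> exists U' S', [/\ U' x, S' x, \forall y \near x, U' y & CkL 3 U' S' cut_dist].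
  move=> dx; exists [set y | mu / 2 < d y], setT.
  have o : open [set y | mu / 2 < d y].
    rewrite openE => y /= dy; exact: (@dist_cont _ _ Om y _ (open_nbhs_nbhs (conj (@open_gt R (mu / 2)) dy))).
  have dx' : mu / 2 < d x by apply: lt_le_trans dx; rewrite ltr_pdivrMr // ltr_pMr // ltr1n.
  split=> //; first exact: (open_nbhs_nbhs (conj o dx')).
  apply: (@CkL_ext _ _ _ _ _ (fun=> mu / 2 / 4)) => //; last exact: CkL_cst.
  by move=> y /= /ltW dy; rewrite /cut_dist flatten_at_flat.
apply: CkL_local => x Ox.
  have [dx|/far[U' [S' [? ? ? ?]]]] := ltP (d x) mu; last by exists U', S'.
  by exists (collar Om mu), (closure (collar Om mu)); split; [split|exact: cut_dist_CkL_collar].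
have [dx|/far[U' [S' [? ? nU ?]]]] := ltP (d x) mu; last first.
  by exists U', S'; split=> //; apply: filterS nU => y Uy _.
have nC : \forall y \near x, Om y -> collar Om mu y.
  have nd : \forall y \near x, d y < mu.
    exact: (@dist_cont _ _ Om x _ (open_nbhs_nbhs (conj (@open_lt R mu) dx))).
  by apply: filterS nd => y dy Oy.
exists (collar Om mu), (closure (collar Om mu)); split; [|exact: nC|exact: cut_dist_CkL_collar].
move=> B nB; have [y [Oy [By H]]] := Ox _ (filterI nB nC).
by exists y; split=> //; exact: H.
Qed.

Lemma cut_dist_bound x : 0 <= cut_dist x <= mu / 8.
Proof.
have := flatten_at_bound a0 (dist_ge0 Om x).
by rewrite -/(cut_dist x) (_ : mu / 2 / 4 = mu / 8) //; field.
Qed.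

Lemma cut_dist_lim0 b : bdry Om b -> cut_dist y @[y --> within Om (nbhs b)] --> (0 : R).
Proof.
move=> bb; have f0 : flatten_at (mu / 2) 0 = 0.
  by rewrite /flatten_at mulr0 subr0 pospow_pos ?ler01 // expr1n subrr mulr0.
have [df _] := flatten_at_derive 0 (lt0r_neq0 a0).
have c : flatten_at (mu / 2) t @[t --> (0 : R)] --> flatten_at (mu / 2) 0.
  by have /derivable1_diffP/differentiable_continuous := df.
rewrite f0 in c.
exact: (cvg_comp _ _ (dist_lim0 bb) c).
Qed.

Lemma cut_dist_grad x0 nu j : bdry Om x0 -> outer_unit_normal Om x0 nu ->
  pd (delta_mx 0 j) cut_dist y @[y --> within Om (nbhs x0)] --> - nu 0 j.
Proof.
move=> bx on; have oC := collar_open oOm (mu := mu).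
have L : pd (delta_mx 0 j) d y @[y --> within Om (nbhs x0)] --> - nu 0 j by exact: (dist_grad_normal oOm bOm mu0 Hd bx on).
have c : pospow 3 (1 - (mu / 2)^-1 * t) @[t --> (0 : R)] --> (1 : R).
  have := @pospow_cont R 3 (1 - (mu / 2)^-1 * 0).
  rewrite /continuous_at {2}mulr0 subr0 {2}/pospow max_l ?ler01 // expr1n => c1.
  apply: (cvg_comp _ _ _ c1).
  apply: (cvgB (cvg_cst _)); apply: (cvgM (cvg_cst _)); exact: cvg_id.
have c2 := cvg_comp _ _ (dist_lim0 bx) c.
have L2 : pospow 3 (1 - (mu / 2)^-1 * d y) * pd (delta_mx 0 j) d y @[y --> within Om (nbhs x0)] --> - nu 0 j.
  by rewrite -[- nu 0 j]mul1r; exact: (cvgM c2 L).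
apply: dist_within => e e0; have [r r0 Hr] := within_dist L2 e0.
have [r1 r10 Hr1] := near_dist (collar_near mu0 bx).
exists (Num.min r r1); first by rewrite lt_min r0.
move=> y Oy; rewrite lt_min => /andP[yr yr1].
have fd := flatten_at_derive (d y) (lt0r_neq0 a0).
rewrite (pd_comp (dh := fun t => pospow 3 (1 - (mu / 2)^-1 * t)) oC _ Hd (Hr1 y yr1 Oy) fd); exact: Hr.
Qed.

End Defining.

Section BoundaryData.
Variables (R : realType) (n : nat).
Implicit Types (x y v : 'rV[R]_n) (U : set 'rV[R]_n).

Lemma open_lt_cont (f : 'rV[R]_n -> R) (c : R) : (forall x, f y @[y --> x] --> f x) -> open [set y | f y < c].
Proof. by move=> fc; rewrite openE => y /= fy; exact: (fc y _ (open_nbhs_nbhs (conj (@open_lt R c) fy))). Qed.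

Lemma open_gt_cont (f : 'rV[R]_n -> R) (c : R) : (forall x, f y @[y --> x] --> f x) -> open [set y | c < f y].
Proof. by move=> fc; rewrite openE => y /= fy; exact: (fc y _ (open_nbhs_nbhs (conj (@open_gt R c) fy))). Qed.

Lemma CkL_col k (i : 'I_n) (V : set 'rV[R]_n.-1) (h : 'rV[R]_n.-1 -> R) : open V -> CkL k V set0 h ->
  open [set y : 'rV[R]_n | V (col' i y)] /\ CkL k [set y : 'rV[R]_n | V (col' i y)] set0 (fun y => h (col' i y)).
Proof.
move=> oV; have oU : open [set y : 'rV[R]_n | V (col' i y)].
  by rewrite openE => y /= Vy; apply: (@col'_cont R n i y V); exact: (open_nbhs_nbhs (conj oV Vy)).
move=> Hh; split=> //; elim: k h Hh => [|k IH] h Hh.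
  by apply: CkL0 => // x Vx; exact: (cvg_comp _ _ (@col'_cont R n i x) (CkL_cont Hh Vx)).
have D x v : V (col' i x) -> is_derive x v (fun y => h (col' i y)) ('D_(col' i v) h (col' i x)).
  move=> Vx; apply: is_derive_line0.
  rewrite (_ : (fun s : R => _) = (fun s : R => h (col' i x + s *: col' i v))); last first.
    by apply/funext => s; congr h; apply/rowP => j; rewrite !mxE.
  have := @derive_line _ _ h (col' i x) (col' i v) 0; rewrite scale0r addr0; apply.
  exact: (CkL_derivable oV Hh Vx).
apply/CkLS; split=> //.
- by move=> x Vx; exact: (cvg_comp _ _ (@col'_cont R n i x) (CkL_cont Hh Vx)).
- by move=> x Vx j; have [] := D x (delta_mx 0 j) Vx.
- move=> j; apply: (CkL_ext oU _ (IH _ (CkL_Dv (col' i (delta_mx 0 j)) oV Hh))) => y Vy.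
  by have [_ ->] := D y (delta_mx 0 j) Vy.
Qed.

Definition sqdist (b y : 'rV[R]_n) : R := \sum_j (y 0 j - b 0 j) * (y 0 j - b 0 j).

Lemma CkL_sqdist k U S b : open U -> CkL k U S (sqdist b).
Proof. by move=> oU; apply: CkL_sum => // j; apply: CkL_mul => //; exact: CkL_coord. Qed.

Lemma sqdist_cont b x : sqdist b y @[y --> x] --> sqdist b x.
Proof. exact: (@CkL_cont _ _ 0 _ set0 _ x (CkL_sqdist _ _ _ openT) I). Qed.

Lemma sqdist_norm b y : `|y - b| ^+ 2 <= sqdist b y.
Proof.
have -> : sqdist b y = enorm (y - b) ^+ 2.
  by rewrite enorm_sq; apply: eq_bigr => j _; rewrite !mxE expr2.
by rewrite ler_pXn2r ?nnegrE ?enorm_ge0 // norm_le_enorm.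
Qed.

(** A plateau of class [C^3]: it is 1 on the ball of radius [r] about [b] and 0
    outside the ball of radius [sqrt 2 * r]. *)
Definition plateau (b : 'rV[R]_n) (r : R) (y : 'rV[R]_n) : R :=
  pospow 4 (1 - pospow 4 ((r ^+ 2)^-1 * sqdist b y - 1)).

Lemma CkL_plateau b r U S : open U -> CkL 3 U S (plateau b r).
Proof.
move=> oU; apply: CkL_pospow => //; apply: (CkL_sub oU (CkL_cst _ _ _ _)).
apply: CkL_pospow => //; apply: (CkL_sub oU _ (CkL_cst _ _ _ _)).
by apply: (CkL_scale _ oU); exact: CkL_sqdist.
Qed.

Lemma plateau1 b r y : 0 < r -> sqdist b y < r ^+ 2 -> plateau b r y = 1.
Proof.
move=> r0 h; rewrite /plateau [pospow 4 (_ * _ - 1)]pospow_neg ?subr0.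
  by rewrite pospow_pos ?ler01 // expr1n.
by rewrite subr_le0 mulrC ler_pdivrMr ?exprn_gt0 // mul1r ltW.
Qed.

Lemma plateau0 b r y : 0 < r -> 2 * r ^+ 2 <= sqdist b y -> plateau b r y = 0.
Proof.
move=> r0 h; rewrite /plateau pospow_neg // subr_le0.
have h1 : 1 <= (r ^+ 2)^-1 * sqdist b y - 1.
  by rewrite lerBrDr mulrC ler_pdivlMr ?exprn_gt0.
rewrite pospow_pos; last by apply: le_trans h1.
exact: exprn_ege1.
Qed.

Variables (Om : set 'rV[R]_n) (phi : 'rV[R]_n -> R).
Hypotheses (oOm : open Om) (bOm : bounded_set Om) (Hphi : Ck_bdry 3 Om phi).

(** The witness is the datum in a chart, continued as a constant in the vertical
    direction. *)
Lemma local_extension x0 : bdry Om x0 -> exists (r : R) (Psi : 'rV[R]_n -> R),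
  [/\ 0 < r, CkL 3 [set y | `|y - x0| < r] set0 Psi &
   forall y, bdry Om y -> `|y - x0| < r -> Psi y = phi y].
Proof.
move=> bx; have [i [s [g [[Hg nch] [V [oV Vx HV]]]]]] := Hphi bx.
have [oU HP] := CkL_col i oV (Ck_CkL HV).
have [r1 r10 Hr1] := near_dist nch.
have [r2 r20 Hr2] := near_dist (open_nbhs_nbhs (conj oU (Vx : [set y : 'rV[R]_n | V (col' i y)] x0))).
exists (Num.min r1 r2), (fun y => (phi \o graph_pt i s g) (col' i y)); split.
- by rewrite lt_min r10.
- have H := CkL_Ck HP; apply: Ck_CkL; apply: (Ck_in_sub _ H).
  by move=> y /=; rewrite lt_min => /andP[_ yr]; exact: Hr2.
move=> y yb; rewrite lt_min => /andP[yr1 yr2] /=; congr phi.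
have chy : graph_chart 1 Om y i s g.
  split; first exact: Ck_inW Hg.
  have e0 : 0 < r1 - `|y - x0| by rewrite subr_gt0.
  apply: (near_dist_intro e0) => z zy; apply: Hr1.
  have -> : z - x0 = (z - y) + (y - x0) by rewrite addrA subrK.
  by apply: (le_lt_trans (ler_normD _ _)); rewrite -ltrBrDr.
have h := bdry_height0 oOm yb chy.
apply/rowP => j; rewrite mxE; case: unliftP => [j' ->|->]; first by rewrite mxE.
by rewrite -h mulrA -expr2 sqrr_sign mul1r.
Qed.

(** The local extension multiplied by a plateau becomes a global [C^3] function. *)
Lemma local_patch x0 : bdry Om x0 -> exists (chi Theta : 'rV[R]_n -> R) (W : set 'rV[R]_n),
  [/\ open W, W x0, CkL 3 setT set0 chi, CkL 3 setT set0 Theta & 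
   (forall y, W y -> chi y = 1) /\ forall y, bdry Om y -> Theta y = chi y * phi y].
Proof.
move=> bx; have [r [Psi [r0 HP PE]]] := local_extension bx.
pose q := r / 2; have q0 : 0 < q by rewrite divr_gt0.
have near_or y : sqdist x0 y <= 2 * q ^+ 2 -> `|y - x0| < r.
  move=> h; rewrite -(@ltr_pXn2r _ 2) ?nnegrE ?normr_ge0 ?(ltW r0) //.
  apply: (le_lt_trans (sqdist_norm _ _)); apply: (le_lt_trans h).
  have -> : 2 * q ^+ 2 = r ^+ 2 / 2 by rewrite /q; field.
  by rewrite ltr_pdivrMr // ltr_pMr ?exprn_gt0 // ltr1n.
exists (plateau x0 q).
exists (fun y => plateau x0 q y * Psi y).
exists [set y | sqdist x0 y < q ^+ 2].
split.
- by apply: open_lt_cont => z; exact: sqdist_cont.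
- by rewrite /= /sqdist big1 ?exprn_gt0 // => j _; rewrite subrr mul0r.
- exact: CkL_plateau openT.
- apply: CkL_local => // y _; have [h|h] := leP (sqdist x0 y) (2 * q ^+ 2).
    have oB : open [set y | `|y - x0| < r].
      rewrite openE => z /= zr; have e0 : 0 < r - `|z - x0| by rewrite subr_gt0.
      apply: (near_dist_intro e0) => w wz /=.
      have -> : w - x0 = (w - z) + (z - x0) by rewrite addrA subrK.
      by apply: (le_lt_trans (ler_normD _ _)); rewrite -ltrBrDr.
    exists [set y | `|y - x0| < r], set0; split; first exact: near_or.
    by apply: (CkL_mul oB _ HP); exact: CkL_plateau.
  have oF : open [set y | 2 * q ^+ 2 < sqdist x0 y] by apply: open_gt_cont => z; exact: sqdist_cont.
  exists [set y | 2 * q ^+ 2 < sqdist x0 y], set0; split=> //.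
  apply: (@CkL_ext _ _ _ _ _ (fun=> 0)) => //; last exact: CkL_cst.
  by move=> z /= /ltW hz; rewrite (plateau0 q0 hz) mul0r.
split=> [y /= h|y yb]; first exact: plateau1.
have [h|/ltW h] := leP (sqdist x0 y) (2 * q ^+ 2); first by rewrite PE // near_or.
by rewrite (plateau0 q0 h) !mul0r.
Qed.

(** Local extensions are glued one after the other, replacing [Phi] by
    [(1 - chi) Phi + Theta]: the error on the boundary is multiplied by [1 - chi],
    so it vanishes wherever some [chi] is 1. *)
Lemma bdry_extension : exists2 Phi : 'rV[R]_n -> R, CkL 3 setT set0 Phi &
  forall y, bdry Om y -> Phi y = phi y.
Proof.
have ex (x : 'rV[R]_n) : exists p : ('rV[R]_n -> R) * ('rV[R]_n -> R) * set 'rV[R]_n, bdry Om x ->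
  [/\ open p.2, p.2 x, CkL 3 setT set0 p.1.1, CkL 3 setT set0 p.1.2 &
   (forall y, p.2 y -> p.1.1 y = 1) /\ forall y, bdry Om y -> p.1.2 y = p.1.1 y * phi y].
  have [bx|nb] := pselect (bdry Om x); last by exists ((fun=> 0), (fun=> 0), set0).
  by have [c [T [W H]]] := local_patch bx; exists (c, T, W).
have [p Hp] := choice ex.
have := bdry_compact bOm; rewrite compact_cover => /(_ _ (bdry Om) (fun x => (p x).2)) [].
- by move=> x bx; have [] := Hp x bx.
- by move=> x bx; exists x => //; have [] := Hp x bx.
move=> F FO cov.
suff [Phi HPhi PhiE] : exists2 Phi : 'rV[R]_n -> R, CkL 3 setT set0 Phi &
   forall y, bdry Om y -> (exists2 x, x \in (finmap.enum_fset F) & (p x).2 y) -> Phi y = phi y.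
  exists Phi => // y yb; apply: PhiE => //.
  by have [x xF Wy] := cov y yb; exists x.
have sub x : x \in (finmap.enum_fset F) -> bdry Om x by move=> xF; exact: (set_mem (FO x xF)).
elim: (finmap.enum_fset F) sub => [|x l IH] sub.
  by exists (fun=> 0); [exact: CkL_cst|move=> y _ [x]].
have [|Phi HPhi PhiE] := IH; first by move=> z zl; apply: sub; rewrite inE zl orbT.
have [oW Wx Hc HT [c1 TE]] := Hp x (sub x (mem_head _ _)).
exists (fun y => (1 - (p x).1.1 y) * Phi y + (p x).1.2 y).
  by apply: (CkL_add openT _ HT); apply: (CkL_mul openT _ HPhi); apply: (CkL_sub openT (CkL_cst _ _ _ _) Hc).
move=> y yb [z]; rewrite inE (TE y yb) => /orP[/eqP->|zl] Wy.
  by rewrite (c1 y Wy) subrr mul0r add0r mul1r.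
by rewrite (PhiE y yb) ?mulrBl ?mul1r ?subrK //; exists z.
Qed.

Lemma bdry_norm_extension : exists2 Phi : 'rV[R]_n -> R, Ck_upto 3 Om Phi /\ (forall y, bdry Om y -> Phi y = phi y) &
  Ck_norm 3 Om Phi <= Ck_bdry_norm 3 Om phi + 1.
Proof.
have [Phi HPhi PhiE] := bdry_extension.
have hi : has_inf [set Ck_norm 3 Om Phi | Phi in [set Phi : 'rV[R]_n -> R |
          Ck_upto 3 Om Phi /\ forall x, bdry Om x -> Phi x = phi x]].
  split; first by exists (Ck_norm 3 Om Phi), Phi => //; split=> //; exact: CkL_Ck_upto.
  exists 0 => _ [Psi _ <-]; apply: sumr_ge0 => j _.
  have [/eqP->|/set0P[r hr]] := boolP ([set r : R | exists (s0 : seq 'I_n) (x0 : 'rV[R]_n), [/\ size s0 = j, Om x0 & r = `|pderivs s0 Psi x0| ] ] == set0).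
    by rewrite sup0.
  have [hs|ns] := pselect (has_sup [set r : R | exists (s0 : seq 'I_n) (x0 : 'rV[R]_n), [/\ size s0 = j, Om x0 & r = `|pderivs s0 Psi x0| ] ]); last by rewrite sup_out.
  apply: le_trans (ub_le_sup hs.2 hr).
  by have [s0 [y [_ _ ->]]] := hr.
have [_ [Psi HPsi <-] h] := inf_adherent (@ltr01 R) hi.
by exists Psi => //; exact: ltW.
Qed.

End BoundaryData.

(** * Leibniz' rule and the exclusion of boundary maxima *)

Section Leibniz.
Variables (R : realType) (n : nat) (U : set 'rV[R]_n) (oU : open U).
Implicit Types (f g : 'rV[R]_n -> R) (x y : 'rV[R]_n).

Lemma pderivs_rcons s (i : 'I_n) f : pderivs (rcons s i) f = pderivs s ('D_(delta_mx 0 i) f).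
Proof. by rewrite /pderivs foldr_rcons. Qed.

Lemma pderivs_eq_on s f g y : (forall z, U z -> f z = g z) -> U y -> pderivs s f y = pderivs s g y.
Proof.
move=> fg; elim: s y => [|i s IH] y Uy /=; first exact: fg.
exact: (derive_eq_on _ oU Uy IH).
Qed.

Lemma pderivs_add s f g S y : CkL (size s) U S f -> CkL (size s) U S g -> U y ->
  pderivs s (fun z => f z + g z) y = pderivs s f y + pderivs s g y.
Proof.
elim/last_ind: s f g y => [//|s i IH] f g y; rewrite size_rcons !pderivs_rcons => Hf Hg Uy.
rewrite -(IH _ _ _ (CkL_D i Hf) (CkL_D i Hg) Uy); apply: pderivs_eq_on => // z Uz.
exact: (derive_addE _ oU Hf Hg Uz).
Qed.

Lemma pderivs_cst (s : seq 'I_n) (c : R) : pderivs s (fun=> c) = fun=> (if s is [::] then c else 0).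
Proof.
elim: s => [//|i s IH]; rewrite -[LHS]/('D_(delta_mx 0 i) (pderivs s (fun=> c))) IH.
by apply/funext => z; exact: derive_cst.
Qed.

Lemma pderivs_opp s f S y : CkL (size s) U S f -> U y -> pderivs s (fun z => - f z) y = - pderivs s f y.
Proof.
elim/last_ind: s f y => [//|s i IH] f y; rewrite size_rcons !pderivs_rcons => Hf Uy.
rewrite -(IH _ _ (CkL_D i Hf) Uy); apply: pderivs_eq_on => // z Uz.
by apply: deriveN; exact: (CkL_der Hf Uz).
Qed.

(** Leibniz' rule, doubling the number of terms at each order. *)
Lemma pderivs_mul_bound s f g S y (A B : R) : CkL (size s) U S f -> CkL (size s) U S g -> U y -> 0 <= A -> 0 <= B ->
  (forall t, (size t <= size s)%N -> `|pderivs t f y| <= A) ->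
  (forall t, (size t <= size s)%N -> `|pderivs t g y| <= B) ->
  `|pderivs s (fun z => f z * g z) y| <= 2 ^+ size s * (A * B).
Proof.
move=> + + Uy A0 B0; elim/last_ind: s f g => [|s i IH] f g Hf Hg fA gB.
  by rewrite expr0 mul1r /= normrM; apply: ler_pM => //; [exact: (fA [::])|exact: (gB [::])].
rewrite size_rcons in Hf Hg fA gB *; rewrite pderivs_rcons.
have E : forall z, U z -> 'D_(delta_mx 0 i) (fun z => f z * g z) z =
    (fun z => f z * 'D_(delta_mx 0 i) g z + g z * 'D_(delta_mx 0 i) f z) z.
  by move=> z Uz; exact: (derive_mulE _ oU Hf Hg Uz).
rewrite (pderivs_eq_on s E Uy).
have Hf' := CkLW (leqnSn _) Hf; have Hg' := CkLW (leqnSn _) Hg.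
have Df := CkL_D i Hf; have Dg := CkL_D i Hg.
rewrite (pderivs_add (CkL_mul oU Hf' Dg) (CkL_mul oU Hg' Df) Uy).
have h1 := IH _ _ Hf' Dg; have h2 := IH _ _ Df Hg'.
rewrite exprS -mulrA mulr_natl mulr2n; apply: (le_trans (ler_normD _ _)); apply: lerD.
  apply: h1 => t ts; first by apply: fA; exact: leqW.
  by rewrite -pderivs_rcons; apply: gB; rewrite size_rcons.
have -> : (fun z => g z * 'D_(delta_mx 0 i) f z) = (fun z => 'D_(delta_mx 0 i) f z * g z) by apply/funext => z; rewrite mulrC.
apply: h2 => t ts; last by apply: gB; exact: leqW.
by rewrite -pderivs_rcons; apply: fA; rewrite size_rcons.
Qed.

End Leibniz.

Section Within.
Variables (R : realType) (n : nat) (Om : set 'rV[R]_n).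
Implicit Types (f g : 'rV[R]_n -> R) (x y b : 'rV[R]_n).

Lemma within_ext f g b (l : R) : (forall y, Om y -> f y = g y) ->
  f y @[y --> within Om (nbhs b)] --> l -> g y @[y --> within Om (nbhs b)] --> l.
Proof.
move=> fg fl; apply: dist_within => e e0; have [d d0 Hd] := within_dist fl e0.
by exists d => // y Oy yd; rewrite -fg //; exact: Hd.
Qed.

Lemma within_bound f b (l C : R) : closure Om b -> (forall y, Om y -> `|f y| <= C) ->
  f y @[y --> within Om (nbhs b)] --> l -> `|l| <= C.
Proof.
move=> cb fC fl; apply/ler_addgt0Pr => e e0; have [d d0 Hd] := within_dist fl e0.
have [y Oy yb] := closure_dist cb d0; have h := Hd y Oy yb; have h' := fC y Oy.
have -> : l = f y - (f y - l) by rewrite opprB addrC subrK.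
by apply: (le_trans (ler_normB _ _)); exact: lerD.
Qed.

End Within.

Section BoundaryMax.
Variables (R : realType) (n : nat) (Om : set 'rV[R]_n) (oOm : open Om).
Variables (u Phi D : 'rV[R]_n -> R) (nu : 'rV[R]_n -> 'rV[R]_n) (M0 A CD CP : R).
Local Notation e_ j := (delta_mx 0 j : 'rV[R]_n).
Let cl := closure Om.
Hypotheses (Hu : CkL 2 Om cl u) (Hu3 : CkL 3 Om set0 u) (HD : CkL 3 Om cl D) (HP : CkL 3 Om cl Phi).
Hypothesis on : forall b, bdry Om b -> outer_unit_normal Om b (nu b).
Hypothesis D0 : forall b, bdry Om b -> D y @[y --> within Om (nbhs b)] --> (0 : R).
Hypothesis DN : forall b j, bdry Om b -> pd (e_ j) D y @[y --> within Om (nbhs b)] --> - nu b 0 j.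
Hypothesis robin : forall b, bdry Om b -> exists (u0 p0 : R) (U : 'I_n -> R),
  [/\ u y @[y --> within Om (nbhs b)] --> u0, Phi y @[y --> within Om (nbhs b)] --> p0,
    forall j, pd (e_ j) u y @[y --> within Om (nbhs b)] --> U j & \sum_j U j * nu b 0 j = p0 - u0].
Hypotheses (uM : forall y, Om y -> `|u y| <= M0) (PB : forall y, Om y -> `|Phi y| <= CP).
Hypothesis DB : forall j k y, Om y -> `|pd (e_ j) (pd (e_ k) D) y| <= CD.
Hypothesis AE : 2 * (n%:R ^+ 2 * CD) + (CP + M0) + 1 <= A.
Hypothesis M00 : 0 <= M0.

Let v y := 1 - D y.
Let psi y := Phi y * D y.
Let w := bern_w v u psi.
Let eta := bern_eta M0 A u D.

Lemma CkL_aux_v : CkL 3 Om cl v. Proof. by apply: (CkL_sub oOm (CkL_cst _ _ _ _)). Qed.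
Lemma CkL_aux_psi : CkL 3 Om cl psi. Proof. exact: CkL_mul. Qed.

Lemma CkL_aux_w : CkL 2 Om cl w.
Proof.
apply: (CkL_add oOm); last exact: (CkLW (leqnSn 2) CkL_aux_psi).
by apply: (CkL_mul oOm _ Hu); exact: (CkLW (leqnSn 2) CkL_aux_v).
Qed.

Lemma CkL_within k f b : CkL k Om cl f -> bdry Om b -> exists l : R, f y @[y --> within Om (nbhs b)] --> l.
Proof. by move=> Hf [cb _]; exact: (CkL_lim Hf). Qed.

Lemma pd_aux_w y a : Om y -> pd a w y = v y * pd a u y - pd a D y * u y + (Phi y * pd a D y + D y * pd a Phi y).
Proof.
move=> Oy; have H1 := CkLW (isT : (1 <= 3)%N); have Hu1 := CkLW (isT : (1 <= 2)%N) Hu.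
rewrite (pd_add oOm a (CkL_mul oOm (H1 _ _ _ _ _ CkL_aux_v) Hu1) (H1 _ _ _ _ _ CkL_aux_psi) Oy).
rewrite (pd_mul oOm a (H1 _ _ _ _ _ CkL_aux_v) Hu1 Oy) (pd_mul oOm a (H1 _ _ _ _ _ HP) (H1 _ _ _ _ _ HD) Oy).
have -> : pd a v y = - pd a D y.
  have := pd_is_derive oOm a HD Oy => dD; apply: pd_val.
  by rewrite -[- _]add0r; apply: is_deriveB.
by ring.
Qed.

(** On the boundary [D = 0] and [grad D = - nu], so the normal derivative of
    [w = u + D (Phi - u)] is [u_nu - (phi - u)], which the boundary condition makes
    vanish. *)
Lemma neumann b : bdry Om b -> exists2 W : 'I_n -> R,
  forall j, pd (e_ j) w y @[y --> within Om (nbhs b)] --> W j & \sum_j W j * nu b 0 j = 0.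
Proof.
move=> bb; have [u0 [p0 [U [Lu LP LU RB]]]] := robin bb.
exists (fun j => (1 - 0) * U j - (- nu b 0 j) * u0 + (p0 * (- nu b 0 j) + 0 * lim (pd (e_ j) Phi y @[y --> within Om (nbhs b)]))).
  move=> j; have [F LF] := CkL_within (CkL_pd oOm (e_ j) HP) bb.
  have PF := within_proper (proj1 bb).
  rewrite (cvg_lim _ LF) //; apply: (within_ext (fun y Oy => esym (pd_aux_w (e_ j) Oy))).
  have LD := D0 bb; have LN := @DN b j bb.
  exact: (cvgD (cvgB (cvgM (cvgB (cvg_cst _) LD) (LU j)) (cvgM LN Lu)) (cvgD (cvgM LP LN) (cvgM LD LF))).
have [_ [_ [_ [_ [_ _ nu1 _]]]]] := normal_chart (on bb).
rewrite (eq_bigr (fun j => U j * nu b 0 j + (u0 - p0) * nu b 0 j ^+ 2)) => [|j _]; last by ring.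
by rewrite big_split -mulr_sumr /= nu1 RB; ring.
Qed.

(** At a boundary maximum with [Dw != 0] the inner normal derivative of
    [|Dw|^2 exp eta] would be positive: the second derivatives of [w] that it
    contains reduce to those of [D], because [w] has vanishing normal derivative
    along the boundary, and the weight [A] of [D] in [eta] outweighs them. *)
Lemma no_boundary_max x0 (H0 : R) : bdry Om x0 ->
  (fun y => sqgrad w y * expR (eta y)) y @[y --> within Om (nbhs x0)] --> H0 ->
  (forall y, Om y -> sqgrad w y * expR (eta y) <= H0) -> forall y, Om y -> sqgrad w y = 0.
Proof.
move=> bx LH mx; have clx : cl x0 := proj1 bx.
have [u0 [p0 [U [Lu LP LU RB]]]] := robin bx.
have [W LW WN] := neumann bx.
have PF := within_proper clx.
have Hw := CkL_aux_w; have HD2 := CkLW (leqnSn 2) HD.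
have Dw j := CkL_pd oOm (e_ j) Hw; have DD j := CkL_pd oOm (e_ j) HD2.
pose WW j k := lim (pd (e_ j) (pd (e_ k) w) y @[y --> within Om (nbhs x0)]).
have LWW j k : pd (e_ j) (pd (e_ k) w) y @[y --> within Om (nbhs x0)] --> WW j k.
  by have [l L] := CkL_within (CkL_pd oOm (e_ j) (Dw k)) bx; rewrite /WW (cvg_lim _ L).
pose d2 j k := lim (pd (e_ j) (pd (e_ k) D) y @[y --> within Om (nbhs x0)]).
have Ld2 j k : pd (e_ j) (pd (e_ k) D) y @[y --> within Om (nbhs x0)] --> d2 j k.
  by have [l L] := CkL_within (CkL_pd oOm (e_ j) (DD k)) bx; rewrite /d2 (cvg_lim _ L).
clearbody WW d2.
have [_ [_ [_ [_ [_ _ nu1 _]]]]] := normal_chart (on bx).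
have WWC j k : WW j k = WW k j.
  have L : pd (e_ j) (pd (e_ k) w) y @[y --> within Om (nbhs x0)] --> WW k j.
    apply: within_ext (LWW k j) => y Oy; exact: (pd_comm oOm _ _ Hw Oy).
  exact: (cvg_unique _ (LWW j k) L).
have d2B j k : `|d2 j k| <= CD by apply: (within_bound clx _ (Ld2 j k)) => y Oy; exact: DB.
(* [p] is the normal derivative of [w] continued inside by [- grad D]: it
   vanishes on the boundary, so its derivative in the tangential direction Dw
   does too, which expresses D^2 w (Dw, nu) through D^2 D (Dw, Dw) *)
pose p y := \sum_j pd (e_ j) w y * pd (e_ j) D y.
have Hp : CkL 1 Om cl p by apply: (CkL_sum _ oOm) => j; apply: CkL_mul.
have Hp0 : CkL 1 Om set0 p by move=> s x; have [h1 _ h3] := Hp s x; split.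
have pd_p k y : Om y -> pd (e_ k) p y = \sum_j (pd (e_ j) w y * pd (e_ k) (pd (e_ j) D) y + pd (e_ j) D y * pd (e_ k) (pd (e_ j) w) y).
  move=> Oy; rewrite (pd_bigsum oOm _ _ (fun j => CkL_mul oOm (Dw j) (DD j)) Oy).
  by apply: eq_bigr => j _; rewrite (pd_mul oOm _ (Dw j) (DD j) Oy).
have Lp k : pd (e_ k) p y @[y --> within Om (nbhs x0)] --> \sum_j (W j * d2 k j + (- nu x0 0 j) * WW k j).
  apply: (within_ext (fun y Oy => esym (pd_p k y Oy))).
  apply: (@cvg_bigsum _ _ _ (within Om (nbhs x0)) _) => j.
  exact: (cvgD (cvgM (LW j) (Ld2 k j)) (cvgM (@DN x0 j bx) (LWW k j))).
have p0b : \forall b \near x0, bdry Om b -> p y @[y --> within Om (nbhs b)] --> (0 : R).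
  apply: (near_dist_intro (@ltr01 R)) => b _ bb; have [W' LW' WN'] := neumann bb.
  have -> : 0 = \sum_j W' j * (- nu b 0 j).
    by rewrite (eq_bigr (fun j => - (W' j * nu b 0 j))) ?sumrN ?WN' ?oppr0 // => j _; rewrite mulrN.
  apply: (@cvg_bigsum _ _ _ (within Om (nbhs b)) _) => j; exact: (cvgM (LW' j) (@DN b j bb)).
have OO : \forall y \near x0, Om y -> Om y by apply: (near_dist_intro (@ltr01 R)).
have tan := normal_tangential oOm bx (on bx) oOm Hp0 OO Lp p0b (tau := \row_j W j).
have {}tan : \sum_k \sum_j W k * (nu x0 0 j * WW k j) = \sum_k \sum_j W k * W j * d2 k j.
  apply/esym/eqP; rewrite -subr_eq0 -sumrB; apply/eqP.
  rewrite -[RHS]tan; last by rewrite -[RHS]WN; apply: eq_bigr => j _; rewrite mxE.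
  apply: eq_bigr => k _; rewrite mxE mulr_sumr -sumrB; apply: eq_bigr => j _; ring.
have Heta : CkL 2 Om cl eta.
  have Hu' : CkL 2 Om cl (fun y => u y + (M0 + 1)) by apply: (CkL_add oOm Hu); exact: CkL_cst.
  exact: (CkL_add oOm (CkL_scale _ oOm (CkL_mul oOm Hu' Hu')) (CkL_scale _ oOm HD2)).
pose q0 := \sum_j W j * W j.
pose eta0 := bern_coef M0 * ((u0 + (M0 + 1)) * (u0 + (M0 + 1))) + A * 0.
have Lq : sqgrad w y @[y --> within Om (nbhs x0)] --> q0.
  by apply: (@cvg_bigsum _ _ _ (within Om (nbhs x0)) _) => j; exact: (cvgM (LW j) (LW j)).
have Lu1 : (fun y => u y + (M0 + 1)) y @[y --> within Om (nbhs x0)] --> u0 + (M0 + 1) by exact: (cvgD Lu (cvg_cst _)).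
have Leta : eta y @[y --> within Om (nbhs x0)] --> eta0.
  have LD : D y @[y --> within Om (nbhs x0)] --> (0 : R) := D0 bx.
  have L1 : (fun y => (u y + (M0 + 1)) * (u y + (M0 + 1))) y @[y --> within Om (nbhs x0)] --> (u0 + (M0 + 1)) * (u0 + (M0 + 1)).
    by apply: cvgM; exact: Lu1.
  have L2 : (fun y => bern_coef M0 * ((u y + (M0 + 1)) * (u y + (M0 + 1)))) y @[y --> within Om (nbhs x0)] --> bern_coef M0 * ((u0 + (M0 + 1)) * (u0 + (M0 + 1))).
    exact: (cvgM (cvg_cst (bern_coef M0)) L1).
  have L3 : (fun y => A * D y) y @[y --> within Om (nbhs x0)] --> A * 0 by exact: (cvgM (cvg_cst A) LD).
  exact: (cvgD L2 L3).
have LE : expR (eta y) @[y --> within Om (nbhs x0)] --> expR eta0.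
  exact: (cvg_comp _ _ Leta (@continuous_expR R eta0)).
have H0E : H0 = q0 * expR eta0 by exact: (cvg_unique _ LH (cvgM Lq LE)).
have q00 : 0 <= q0 by apply: sumr_ge0 => j _; rewrite -expr2 sqr_ge0.
have [/eqP qz|qn] := boolP (q0 == 0).
  move=> y Oy; have := mx y Oy; rewrite H0E qz mul0r => h.
  have s0 : 0 <= sqgrad w y by apply: sumr_ge0 => j _; rewrite -expr2 sqr_ge0.
  by apply/eqP; rewrite eq_le s0 andbT; move: h; rewrite pmulr_lle0 // expR_gt0.
have qp : 0 < q0 by rewrite lt_neqAle eq_sym qn.
exfalso.
pose Q y := sqgrad w y * expR (eta y).
have Hq : CkL 1 Om cl (sqgrad w) := CkL_sqgrad oOm Hw.
have HE : CkL 1 Om cl (fun y => expR (eta y)) by apply: (CkL_exp oOm); exact: (CkLW (leqnSn 1) Heta).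
have HQ : CkL 1 Om set0 Q by move=> s x; have [h1 _ h3] := CkL_mul oOm Hq HE s x; split.
have pd_Q j y : Om y -> pd (e_ j) Q y = sqgrad w y * (expR (eta y) * (2 * bern_coef M0 * (u y + (M0 + 1)) * pd (e_ j) u y + A * pd (e_ j) D y))
    + expR (eta y) * \sum_k (pd (e_ k) w y * pd (e_ j) (pd (e_ k) w) y + pd (e_ k) w y * pd (e_ j) (pd (e_ k) w) y).
  move=> Oy; rewrite (pd_mul oOm _ Hq HE Oy) (pd_exp oOm _ (CkLW (leqnSn 1) Heta) Oy).
  have HD0 : CkL 3 Om set0 D by move=> s x; have [h1 _ h3] := HD s x; split.
  rewrite (pd_eta oOm A M0 Hu3 HD0 _ Oy); congr (_ + _ * _).
  rewrite (pd_bigsum oOm _ _ (fun k => CkL_mul oOm (Dw k) (Dw k)) Oy).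
  by apply: eq_bigr => k _; rewrite (pd_mul oOm _ (Dw k) (Dw k) Oy).
pose PQ j := q0 * (expR eta0 * (2 * bern_coef M0 * (u0 + (M0 + 1)) * U j + A * (- nu x0 0 j)))
    + expR eta0 * \sum_k (W k * WW j k + W k * WW j k).
have LQ j : pd (e_ j) Q y @[y --> within Om (nbhs x0)] --> PQ j.
  apply: (within_ext (fun y Oy => esym (pd_Q j y Oy))).
  apply: cvgD.
    apply: (cvgM Lq); apply: (cvgM LE); apply: cvgD; last exact: (cvgM (cvg_cst _) (@DN x0 j bx)).
    exact: (cvgM (cvgM (cvg_cst _) Lu1) (LU j)).
  apply: (cvgM LE); apply: (@cvg_bigsum _ _ _ (within Om (nbhs x0)) _) => k.
  exact: (cvgD (cvgM (LW k) (LWW j k)) (cvgM (LW k) (LWW j k))).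
suff neg : \sum_j PQ j * nu x0 0 j < 0.
  have [y Oy] := boundary_increase oOm bx (on bx) oOm HQ OO LH LQ neg.
  by rewrite ltNge mx.
pose Q2 := \sum_k \sum_j W k * W j * d2 k j.
have E1 : \sum_j PQ j * nu x0 0 j = expR eta0 * (q0 * (2 * bern_coef M0 * (u0 + (M0 + 1)) * (p0 - u0) - A) + 2 * Q2).
  have -> : Q2 = \sum_j \sum_k W k * (nu x0 0 j * WW j k).
    by rewrite /Q2 -tan exchange_big; apply: eq_bigr => j _; apply: eq_bigr => k _; rewrite WWC.
  rewrite (eq_bigr (fun j => expR eta0 * q0 * (2 * bern_coef M0 * (u0 + (M0 + 1))) * (U j * nu x0 0 j)
     - expR eta0 * q0 * A * nu x0 0 j ^+ 2 + expR eta0 * 2 * \sum_k W k * (nu x0 0 j * WW j k))) => [|j _].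
    by rewrite !big_split /= sumrN -!mulr_sumr RB nu1; ring.
  rewrite /PQ mulrDl; congr (_ + _); first by ring.
  by rewrite -!mulrA; congr (_ * _); rewrite mulr_suml mulr_sumr; apply: eq_bigr => k _; ring.
rewrite E1 pmulr_rlt0 ?expR_gt0 //.
have Wq k : `|W k| ^+ 2 <= q0.
  by rewrite real_normK ?num_real // expr2 /q0 (bigD1 k) //= lerDl sumr_ge0 // => j _; rewrite -expr2 sqr_ge0.
have WWq k j : `|W k| * `|W j| <= q0.
  by have := Wq k; have := Wq j; have := sqr_ge0 (`|W k| - `|W j|); rewrite sqrrB mulr2n; lra.
have Q2B : Q2 <= n%:R ^+ 2 * CD * q0.
  have -> : n%:R ^+ 2 * CD * q0 = \sum_(k < n) \sum_(j < n) (q0 * CD).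
    rewrite (eq_bigr (fun=> n%:R * (q0 * CD))) => [|k _]; last by rewrite sumr_const card_ord mulr_natl.
    by rewrite sumr_const card_ord -[RHS]mulr_natl; ring.
  apply: ler_sum => k _; apply: ler_sum => j _; apply: (le_trans (ler_norm _)).
  by rewrite !normrM; apply: ler_pM => //; rewrite mulr_ge0.
have u0B : `|u0| <= M0 := within_bound clx uM Lu.
have p0B : `|p0| <= CP := within_bound clx PB LP.
have M0p := M00; have m1 : 1 <= 2 * M0 + 1 by lra.
have h1 : 0 <= 2 * bern_coef M0 * (u0 + (M0 + 1)) <= 1.
  move: u0B; rewrite ler_norml => /andP[ua ub].
  have bE : 2 * bern_coef M0 * (2 * M0 + 1) ^+ 2 = 1 by rewrite /bern_coef; field; apply/lt0r_neq0; lra.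
  have b0 : 0 < bern_coef M0 by rewrite invr_gt0 mulr_gt0 // exprn_gt0 //; lra.
  apply/andP; split; first by rewrite !mulr_ge0 ?ltW //; lra.
  rewrite -[leRHS]bE ler_pM2l ?mulr_gt0 //; apply: (@le_trans _ _ (2 * M0 + 1)); first by lra.
  by rewrite expr2 ler_peMl //; lra.
have h2 : 2 * bern_coef M0 * (u0 + (M0 + 1)) * (p0 - u0) <= CP + M0.
  move: h1 => /andP[h1a h1b]; apply: (le_trans (ler_norm _)); rewrite normrM ger0_norm //.
  have hb : `|p0 - u0| <= CP + M0 by apply: (le_trans (ler_normB _ _)); exact: lerD.
  by apply: le_trans hb; rewrite ler_piMl.
have h3 : q0 * (2 * bern_coef M0 * (u0 + (M0 + 1)) * (p0 - u0) - A) <= q0 * (- (2 * (n%:R ^+ 2 * CD)) - 1).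
  by rewrite ler_pM2l //; move: AE; lra.
have E3 : q0 * (- (2 * (n%:R ^+ 2 * CD)) - 1) = - (2 * (n%:R ^+ 2 * CD * q0)) - q0 by ring.
rewrite E3 in h3; move: h3 Q2B qp; move: (q0 * _) (_ * q0) => X Y h3 Q2B qp; lra.
Qed.

End BoundaryMax.

(** * The gradient bound *)

(** The weight of [D] in [eta] required by [no_boundary_max]. *)
Definition boundary_weight (R : realType) (n : nat) (CD CP M0 : R) : R :=
  2 * (n%:R ^+ 2 * CD) + (CP + M0) + 1.

(** Bounds [M0] and the derivatives up to order 3 of [1 - D], [D] and [Phi D]; the
    factor [2^3] comes from Leibniz' rule. *)
Definition data_bound (R : realType) (CD CP M0 : R) : R := M0 + (1 + CD) + 2 ^+ 3 * (CP * CD).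

Definition gradient_const (R : realType) (n : nat) (CD CP M0 sF DF : R) : R :=
  let A := boundary_weight n CD CP M0 in
  n%:R * (2 * (`|interior_const n (data_bound CD CP M0) A M0 sF DF| * expR (1 + A)
    + (CD * (M0 + CP) + CP))).

Section Global.
Variables (R : realType) (n k l : nat) (Om : set 'rV[R]_n).
Variables (u f Phi D : 'rV[R]_n -> R) (nu : 'rV[R]_n -> 'rV[R]_n) (M0 CD CP sF DF : R).
Local Notation e_ j := (delta_mx 0 j : 'rV[R]_n).
Hypotheses (lk : (l < k)%N) (kn : (k <= n)%N) (oOm : open Om) (bOm : bounded_set Om).
Hypotheses (Hu : CkL 2 Om (closure Om) u) (Hu3 : CkL 3 Om set0 u).
Hypotheses (HD : CkL 3 Om (closure Om) D) (HP : CkL 3 Om (closure Om) Phi) (Hf : CkL 1 Om set0 f).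
Hypothesis adm : admissible k Om u.
Hypothesis eqn : forall y, Om y -> sigma_mx k (hess u y) / sigma_mx l (hess u y) = f y.
Hypotheses (f0 : forall y, Om y -> 0 < f y) (fs : forall y, Om y -> f y <= sF)
  (fg : forall y, Om y -> enorm (grad f y) <= DF).
Hypothesis on : forall b, bdry Om b -> outer_unit_normal Om b (nu b).
Hypothesis D0 : forall b, bdry Om b -> D y @[y --> within Om (nbhs b)] --> (0 : R).
Hypothesis DN : forall b j, bdry Om b -> pd (e_ j) D y @[y --> within Om (nbhs b)] --> - nu b 0 j.
Hypothesis robin : forall b, bdry Om b -> exists (u0 p0 : R) (U : 'I_n -> R),
  [/\ u y @[y --> within Om (nbhs b)] --> u0, Phi y @[y --> within Om (nbhs b)] --> p0,
    forall j, pd (e_ j) u y @[y --> within Om (nbhs b)] --> U j & \sum_j U j * nu b 0 j = p0 - u0].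
Hypothesis uM : forall y, Om y -> `|u y| <= M0.
Hypothesis Db : forall y, Om y -> 0 <= D y <= 1 / 10.
Hypothesis DB : forall s y, (size s <= 3)%N -> Om y -> `|pderivs s D y| <= CD.
Hypothesis PB : forall s y, (size s <= 3)%N -> Om y -> `|pderivs s Phi y| <= CP.

(** The auxiliary function extends continuously to the compact closure and has a
    maximum there: if it lies on the boundary then [Dw = 0] everywhere, otherwise
    [interior_estimate] bounds it. Since [1 - D >= 9/10], a bound for [Dw] bounds
    [Du]. *)
Lemma global_gradient_bound x : Om x -> enorm (grad u x) <= gradient_const n CD CP M0 sF DF.
Proof.
move=> Ox.
have M00 : 0 <= M0 := le_trans (normr_ge0 _) (uM Ox).
have CD0 : 0 <= CD := le_trans (normr_ge0 _) (@DB [::] x isT Ox).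
have CP0 : 0 <= CP := le_trans (normr_ge0 _) (@PB [::] x isT Ox).
have sF0 : 0 <= sF := le_trans (ltW (f0 Ox)) (fs Ox).
have DF0 : 0 <= DF := le_trans (enorm_ge0 _) (fg Ox).
have PC0 : 0 <= CP * CD by rewrite mulr_ge0.
rewrite /gradient_const; set A := boundary_weight n CD CP M0; set K' := data_bound CD CP M0.
have N0 : 0 <= n%:R ^+ 2 * CD :> R by rewrite mulr_ge0 ?exprn_ge0.
have A0 : 0 <= A by rewrite /A /boundary_weight; lra.
have K'0 : 0 <= K' by rewrite /K' /data_bound !addr_ge0 // mulr_ge0 // exprn_ge0.
pose v y := 1 - D y; pose psi y := Phi y * D y.
pose w := bern_w v u psi; pose eta := bern_eta M0 A u D.
pose IC := interior_const n K' A M0 sF DF.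
have Hv : CkL 3 Om (closure Om) v := CkL_aux_v oOm HD.
have Hpsi : CkL 3 Om (closure Om) psi := CkL_aux_psi oOm HD HP.
have Hw : CkL 2 Om (closure Om) w := CkL_aux_w oOm Hu HD HP.
have weak m S g : CkL m Om S g -> CkL m Om set0 g by move=> H; apply: Ck_CkL; exact: (CkL_Ck H).
have Heta : CkL 2 Om (closure Om) eta.
  have Hu' : CkL 2 Om (closure Om) (fun y => u y + (M0 + 1)) by apply: (CkL_add oOm Hu); exact: CkL_cst.
  apply: (CkL_add oOm); apply: (CkL_scale _ oOm); last exact: (CkLW (leqnSn 2) HD).
  exact: (CkL_mul oOm Hu' Hu').
have HQ : CkL 1 Om (closure Om) (fun y => sqgrad w y * expR (eta y)).
  by apply: (CkL_mul oOm (CkL_sqgrad oOm Hw)); apply: (CkL_exp oOm); exact: (CkLW (leqnSn 1) Heta).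
have eta_b y : Om y -> 0 <= eta y <= 1 + A.
  move=> Oy; have := uM Oy; rewrite ler_norml => /andP[ua ub]; have /andP[da db] := Db Oy.
  have s0 : 0 <= (u y + (M0 + 1)) * (u y + (M0 + 1)) <= (2 * M0 + 1) ^+ 2.
    rewrite -expr2 sqr_ge0 /= ler_pXn2r ?nnegrE //; lra.
  have b0 : 0 < bern_coef M0 by rewrite invr_gt0 mulr_gt0 // exprn_gt0 //; lra.
  have b1 : bern_coef M0 * (2 * M0 + 1) ^+ 2 <= 1.
    have -> : bern_coef M0 * (2 * M0 + 1) ^+ 2 = 1 / 2 by rewrite /bern_coef; field; apply/lt0r_neq0; lra.
    by lra.
  have AD : 0 <= A * D y <= A by rewrite mulr_ge0 //= ler_piMr //; lra.
  move: s0 AD => /andP[s1 s2] /andP[a1 a2]; rewrite /eta /bern_eta; apply/andP; split.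
    by rewrite addr_ge0 // mulr_ge0 // ltW.
  by apply: lerD => //; apply: le_trans b1; rewrite ler_pM2l.
have q0 y : 0 <= sqgrad w y by apply: sumr_ge0 => j _; rewrite -expr2 sqr_ge0.
have E1 : 1 <= expR (1 + A) by rewrite -expR0 ler_expR addr_ge0.
have qB y : Om y -> sqgrad w y <= (`|IC| * expR (1 + A)) ^+ 2.
  have [F [Fc FE Fl]] := closure_extension oOm (fun z Oz => CkL_cont HQ Oz) (fun z cz => CkL_lim HQ cz).
  have ne : closure Om !=set0 by exists x; exact: subset_closure.
  have [c] := EVT_max_rV ne (closure_compact bOm) Fc; move=> /set_mem cc cmax.
  have mx z : Om z -> sqgrad w z * expR (eta z) <= F c.
    by move=> Oz; rewrite -FE //; apply: cmax; apply: mem_set; exact: subset_closure.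
  have [Oc|nOc] := pselect (Om c); last first.
    have bc : bdry Om c by split=> //; move/interior_subset.
    have DB2 j i y0 : Om y0 -> `|pd (e_ j) (pd (e_ i) D) y0| <= CD by move=> Oy0; have := @DB [:: j; i] y0 isT Oy0; rewrite !pdE.
    have z := @no_boundary_max R n Om oOm u Phi D nu M0 A CD CP Hu Hu3 HD HP on D0 DN robin uM
      (fun y0 O0 => @PB [::] y0 isT O0) DB2 (lexx _) M00 c (F c) bc (Fl c cc) mx.
    by move=> Oy; rewrite (z y Oy) sqr_ge0.
  have FcE := FE c Oc.
  have nmx : \forall y \near c, sqgrad w y * expR (eta y) <= sqgrad w c * expR (eta c).
    by rewrite -FcE; apply: filterS (open_nbhs_nbhs (conj oOm Oc)) => z; exact: mx.
  have gK g s : g = v \/ g = psi \/ g = D -> (size s <= 3)%N -> `|pderivs s g c| <= K'.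
    have P8 : 0 <= 2 ^+ 3 * (CP * CD) by rewrite mulr_ge0 // exprn_ge0.
    move=> [->|[->|->]] s3.
    - have -> : pderivs s v c = pderivs s (fun=> 1) c + pderivs s (fun z => - D z) c.
        by apply: (pderivs_add oOm (CkL_cst _ _ _ _) (CkL_opp oOm (CkLW s3 HD)) Oc).
      apply: (@le_trans _ _ (1 + CD)); last by rewrite /K' /data_bound; lra.
      apply: (le_trans (ler_normD _ _)); apply: lerD.
        by rewrite pderivs_cst; case: s {s3} => [|i s]; rewrite ?normr1 ?normr0.
      by rewrite (pderivs_opp oOm (CkLW s3 HD) Oc) normrN; exact: DB.
    - apply: (@le_trans _ _ (2 ^+ size s * (CP * CD))).
        apply: (pderivs_mul_bound oOm (CkLW s3 HP) (CkLW s3 HD) Oc CP0 CD0) => t ts.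
          by apply: PB => //; exact: leq_trans s3.
        by apply: DB => //; exact: leq_trans s3.
      apply: (@le_trans _ _ (2 ^+ 3 * (CP * CD))); last by rewrite /K' /data_bound; lra.
      by rewrite ler_wpM2r // ler_eXn2l // ltr1n.
    - by apply: le_trans (DB s3 Oc) _; rewrite /K' /data_bound; lra.
  have IE : sqgrad w c <= IC ^+ 2.
    apply: (interior_estimate oOm lk kn Hu3 Hf (weak _ _ _ Hv) (weak _ _ _ Hpsi) (weak _ _ _ HD) adm eqn Oc A0 M00
      (f0 Oc) (fs Oc) (fg Oc) (uM Oc) _ _ gK K'0 sF0 DF0 nmx).
      by rewrite /K' /data_bound; have : 0 <= 2 ^+ 3 * (CP * CD) by [rewrite mulr_ge0 // exprn_ge0]; lra.
    by have /andP[d1 d2] := Db Oc; rewrite /v; apply/andP; split; lra.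
  move=> Oy; have /andP[ey _] := eta_b y Oy; have /andP[_ ec] := eta_b c Oc.
  apply: (@le_trans _ _ (sqgrad w y * expR (eta y))).
    by rewrite ler_peMr // -expR0 ler_expR.
  apply: (le_trans (mx y Oy)); rewrite FcE.
  apply: (@le_trans _ _ (IC ^+ 2 * expR (1 + A))).
    by apply: ler_pM; rewrite ?expR_ge0 ?ler_expR.
  rewrite exprMn real_normK ?num_real //; apply: ler_wpM2l; first exact: sqr_ge0.
  by rewrite expr2 ler_peMr // ltW // expR_gt0.
set B := `|IC| * expR (1 + A) in qB *.
have B0 : 0 <= B by rewrite mulr_ge0 // expR_ge0.
have jb j : `|grad u x 0 j| <= 2 * (B + (CD * (M0 + CP) + CP)).
  rewrite gradE; have W1 : `|pd (e_ j) w x| <= B.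
    rewrite -(@ler_pXn2r _ 2) ?nnegrE // real_normK ?num_real //; apply: le_trans (qB x Ox).
    by rewrite /sqgrad (bigD1 j) //= -expr2 lerDl sumr_ge0 // => i _; rewrite -expr2 sqr_ge0.
  have E := pd_aux_w oOm Hu HD HP (e_ j) Ox.
  have D1 : `|pd (e_ j) D x| <= CD by have := @DB [:: j] x isT Ox; rewrite pdE.
  have P1 : `|pd (e_ j) Phi x| <= CP by have := @PB [:: j] x isT Ox; rewrite pdE.
  have P0 := @PB [::] x isT Ox; rewrite /= in P0; have U0 := uM Ox.
  have /andP[d1 d2] := Db Ox.
  have T1 : `|pd (e_ j) D x * u x| <= CD * M0 by rewrite normrM; exact: ler_pM.
  have T2 : `|Phi x * pd (e_ j) D x| <= CD * CP by rewrite normrM mulrC; exact: ler_pM.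
  have T3 : `|D x * pd (e_ j) Phi x| <= CP.
    by rewrite normrM ger0_norm //; apply: le_trans P1; rewrite ler_piMl //; lra.
  have V : `|(1 - D x) * pd (e_ j) u x| <= B + (CD * (M0 + CP) + CP).
    have -> : (1 - D x) * pd (e_ j) u x = pd (e_ j) w x + pd (e_ j) D x * u x - Phi x * pd (e_ j) D x - D x * pd (e_ j) Phi x.
      by rewrite /w E /v; ring.
    rewrite mulrDr; move: W1 T1 T2 T3; rewrite !ler_norml => /andP[? ?] /andP[? ?] /andP[? ?] /andP[? ?].
    by apply/andP; split; lra.
  rewrite normrM ger0_norm in V; last by lra.
  have := normr_ge0 (pd (e_ j) u x) => n0.
  have : (9 / 10) * `|pd (e_ j) u x| <= (1 - D x) * `|pd (e_ j) u x| by rewrite ler_wpM2r //; lra.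
  by move=> /le_trans/(_ V); move: n0; move: (B + _) `|pd (e_ j) u x| => X Z; lra.
apply: (le_trans (enorm_le_norm _)); apply: ler_wpM2l => //; apply: norm_le_coord => //.
by rewrite mulr_ge0 // !addr_ge0 // mulr_ge0 // addr_ge0.
Qed.

End Global.

Theorem theorem4p3 (R : realType) :
  exists (M1 : nat -> nat -> nat -> R -> R -> R -> R)
         (M1t : forall n : nat, nat -> nat -> R -> set 'rV[R]_n ->
                  R -> R -> R -> R -> R),
  forall (n k l : nat) (Om : set 'rV[R]_n) (nu : 'rV[R]_n -> 'rV[R]_n)
         (f phi u : 'rV[R]_n -> R) (mu M0 : R),
    (l < k)%N -> (k <= n)%N ->
    Ck_domain 3 Om -> bounded_set Om ->
    (forall x, bdry Om x -> outer_unit_normal Om x (nu x)) ->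
    Ck_upto 1 Om f -> (forall x, closure Om x -> 0 < f x) ->
    Ck_bdry 3 Om phi ->
    Ck_in 3 Om u -> Ck_upto 2 Om u -> admissible k Om u ->
    (forall x, Om x ->
       sigma_mx k (hess u x) / sigma_mx l (hess u x) = f x) ->
    (forall x, bdry Om x -> normal_deriv Om u x (nu x) = - u x + phi x) ->
    0 < mu < 1 / 10%:R -> Ck_upto 3 (collar Om mu) (dist_bdry Om) ->
    (ereal_sup [set (`|u x|)%:E | x in Om] <= M0%:E)%E ->
    let sup_f := sup [set f x | x in Om] in
    let norm_Df := sup [set enorm (grad f x) | x in Om] in
    let norm_phi := Ck_bdry_norm 3 Om phi in
    (ereal_sup [set (enorm (grad u x))%:E | x in collar Om mu] <=
     (Num.max (M1 n k l mu M0 norm_Df)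
              (M1t n k l mu Om M0 sup_f norm_Df norm_phi))%:E)%E.
Proof.
exists (fun _ _ _ _ _ _ => 0).
exists (fun n _ _ mu Om M0 sF DF Nphi =>
  gradient_const n (Ck_norm 3 Om (cut_dist Om mu)) (Nphi + 1) M0 sF DF).
move=> n k l Om nu f phi u mu M0 lk kn [oOm _ _ _] bOm on Hf fp Hphi Hu3 Hu2 adm eqn rob.
move=> /andP[mu0 mu1] Hd uM; cbv zeta.
set sup_f := sup [set f x | x in Om]; set norm_Df := sup [set enorm (grad f x) | x in Om].
set norm_phi := Ck_bdry_norm 3 Om phi.
have [Phi [HPhi PhiE] PhiN] := bdry_norm_extension oOm bOm Hphi.
have HD := cut_dist_CkL oOm mu0 (Ck_upto_CkL Hd).
have HP := Ck_upto_CkL HPhi; have Hf1 := Ck_upto_CkL Hf.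
have lim_bdry m g b : Ck_upto m Om g -> bdry Om b -> g y @[y --> within Om (nbhs b)] --> g b.
  move=> [_ /subspace_continuousP gc _] [cb _]; apply: dist_within => e e0.
  have [d d0 H] := within_dist (gc b cb) e0.
  by exists d => // y Oy yb; apply: H => //; exact: subset_closure.
have uM' x : Om x -> `|u x| <= M0.
  by move=> Ox; rewrite -lee_fin; apply: le_trans uM; apply: ereal_sup_ubound; exists x.
have bound_sup (g : 'rV[R]_n -> R) (C x : R) y : (forall z, Om z -> g z <= C) -> Om y -> g y <= sup [set g z | z in Om].
  move=> gC Oy; apply: ub_le_sup; last by exists y.
  by exists C => _ [z Oz <-]; exact: gC.
have fs x : Om x -> f x <= sup_f.
  have [C HC] := @CkL_bounded _ _ 1 _ f [::] oOm bOm Hf1 isT.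
  by apply: (bound_sup f C 0) => z Oz; apply: le_trans (HC z Oz); exact: ler_norm.
have fg x : Om x -> enorm (grad f x) <= norm_Df.
  have ex (i : 'I_n) : exists C : R, forall x, Om x -> `|pderivs [:: i] f x| <= C.
    exact: (@CkL_bounded _ _ 1 _ f [:: i] oOm bOm Hf1 isT).
  have [C HC] := choice ex.
  apply: (bound_sup _ (n%:R * \sum_i `|C i|) 0) => z Oz.
  apply: (le_trans (enorm_le_norm _)); apply: ler_wpM2l => //; apply: norm_le_coord; first exact: sumr_ge0.
  move=> i; rewrite mxE; apply: (le_trans (HC i z Oz)); apply: (le_trans (ler_norm _)).
  by rewrite (bigD1 i) //= lerDl sumr_ge0.
apply: ge_ereal_sup => _ [x [Ox _] <-]; rewrite lee_fin le_max; apply/orP; right.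
have DB s y : (size s <= 3)%N -> Om y -> `|pderivs s (cut_dist Om mu) y| <= Ck_norm 3 Om (cut_dist Om mu).
  by move=> s3 Oy; exact: (Ck_norm_bound oOm bOm HD s3 Oy).
have PB s y : (size s <= 3)%N -> Om y -> `|pderivs s Phi y| <= norm_phi + 1.
  by move=> s3 Oy; apply: le_trans PhiN; exact: (Ck_norm_bound oOm bOm HP s3 Oy).
have Db y : Om y -> 0 <= cut_dist Om mu y <= 1 / 10.
  by move=> Oy; have /andP[h1 h2] := cut_dist_bound Om mu0 y; apply/andP; split=> //; lra.
have robin b : bdry Om b -> exists (u0 p0 : R) (U : 'I_n -> R),
  [/\ u y @[y --> within Om (nbhs b)] --> u0, Phi y @[y --> within Om (nbhs b)] --> p0,
    forall j, pd (delta_mx 0 j) u y @[y --> within Om (nbhs b)] --> U j & \sum_j U j * nu b 0 j = p0 - u0].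
  move=> bb; exists (u b), (Phi b), (fun j => lim (pderivs [:: j] u y @[y --> within Om (nbhs b)])).
  split.
  - exact: lim_bdry Hu2 bb.
  - exact: lim_bdry HPhi bb.
  - move=> j; have PF := within_proper (proj1 bb).
    have [L HL] := CkL_lim (CkL_D j (Ck_upto_CkL Hu2)) (proj1 bb).
    by rewrite pdE (cvg_lim _ HL).
  - rewrite (PhiE b bb) addrC -(rob b bb); apply: eq_bigr => j _; exact: mulrC.
exact: (@global_gradient_bound R n k l Om u f Phi (cut_dist Om mu) nu M0 _ _ _ _ lk kn oOm bOm
  (Ck_upto_CkL Hu2) (Ck_CkL Hu3) HD HP (Ck_CkL (CkL_Ck Hf1)) adm eqn (fun y Oy => fp y (subset_closure Oy)) fs fg on
  (fun b bb => cut_dist_lim0 mu0 bb) (fun b j bb => cut_dist_grad oOm bOm mu0 (Ck_upto_CkL Hd) bb (on b bb))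
  robin uM' Db DB PB x Ox).
Qed.
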